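(* Let $K$ be a compact set in $\mathbb{C}^n$ and let $\{K_i\}_{i\in\mathbb{N}}$ be a sequence of compact sets in $\mathbb{C}^n$ with $K=\bigcap_{i=1}^{\infty}K_i$ (all these compact sets being polynomially convex and non-pluripolar). Assume that $K_i\in(SP)$ for all $i\in\mathbb{N}$. Then there exists a sequence of analytic functionals $\{f_i^*\}$ such that $f_i^*\in A(K_i)^*$ for each $i\in\mathbb{N}$ and, with $f_i'=T(f_i^* )$, $$\lim_{i\to\infty}D(f_i')=d(K).$$
   Context: Multi-indices: $\mathbb{Z}_+^n$ is the set of $n$-vectors of non-negative integers; $z^k=z_1^{k_1}\cdots z_n^{k_n}$, $|k|=k_1+\dots+k_n$. Let $\{k(i)\}_{i\in\mathbb{N}}$, $\mathbb{N}=\{1,2,\dots\}$, be the enumeration of $\mathbb{Z}_+^n$ with $|k(i)|\le |k(i+1)|$ and which on each set $\{|k(i)|=s\}$ coincides with the lexicographic order in $k_1,\dots,k_n$. Put $s(i)=|k(i)|$, $e_\alpha(z)=z^{k(\alpha)}$. Let $m_s=\binom{s+n}{s}$ be the number of multi-indices of degree at most $s$, $N_s$ the number of those of degree exactly $s$, and $l_s=\sum_{q=0}^{s} qN_q$. Transfinite diameter: for a compact set $K\subset\mathbb{C}^n$, let $V_i=\sup\{|\det(e_\alpha(\zeta_\beta))_{\alpha,\beta=1}^{i}| : (\zeta_1,\dots,\zeta_i)\in K^i\}$ and $d(K)=\limsup_{s\to\infty}(V_{m_s})^{1/l_s}$. A set is pluripolar if it is contained in the $-\infty$ set of a plurisubharmonic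 function on $\mathbb{C}^n$ that is not identically $-\infty$. Functionals: $A(\mathbb{C}^n)$ is the space of entire functions on $\mathbb{C}^n$ with the topology of locally uniform convergence. $A(K)$ is the space of germs of analytic functions on $K$ with the countable inductive limit topology $A(K)=\mathrm{lim\,ind}_{j}\,A(D_j)$, where $D_j$ are open sets with $D_{j+1}\Subset D_j$ and $K=\bigcap_j D_j$. A star denotes the space of continuous linear functionals; elements of $A(\mathbb{C}^n)^*$ are called analytic functionals, and an element of $A(K)^*$ is regarded as an element of $A(\mathbb{C}^n)^*$ by restriction to entire functions. $A_0(\{\infty^n\})$ is the space of analytic germs at $\infty^n=(\infty,\dots,\infty)\in\overline{\mathbb{C}}^n$ with expansion $f'(z)=\sum_{k\in\mathbb{Z}_+^n} a_k/z^{k+I}$, $I=(1,\dots,1)$, converging near $\infty^n$. $T:A(\mathbb{C}^n)^*\to A_0(\{\infty^n\})$ is the isomorphism such that, for $f'=Tf^*$, $f^*(\varphi)=\left(\frac{1}{2\pi i}\right)^n\int_{\mathbb{T}_R^n}\varphi(\zeta)f'(\zeta)\,d\zeta$ for all $\varphi\in A(\mathbb{C}^n)$, where $\mathbb{T}_R^n=\{|z_\nu|=R,\ \nu=1,\dots,n\}$ with $R=R(f^* )$ sufficiently large. Thus the coefficients of $f'=Tf^*$ are $a_k=f^*(z^k)$. Hankel-like determinants: $H_i(f^* )=\det\left(a_{k(\alpha)+k(\beta)}\right)_{\alpha,\beta=1}^{i}$, and $D(f')=\limsup_{i\to\infty}|H_i(f^* )|^{1/(2l_{s(i)})}$. Sharpness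 property: a polynomially convex compact set $K\subset\mathbb{C}^n$ satisfies the sharpness property in the Polya inequality, written $K\in(SP)$, if $d(K)=\sup\{D(f') : f'=T(f^* ),\ f^*\in A(K)^*\}$. *)

(* Defs.v *)
From HB Require Import structures.
From mathcomp Require Import all_boot all_order all_algebra.
From mathcomp Require Import complex.
From mathcomp Require Import all_classical all_reals all_analysis.
From mathcomp Require mpoly.
Set Implicit Arguments.
Unset Strict Implicit.
Unset Printing Implicit Defensive.
Import Order.TTheory GRing.Theory Num.Theory.
Import numFieldNormedType.Exports.
Local Open Scope classical_set_scope.
Local Open Scope ring_scope.
Local Open Scope complex_scope.

Import Normc.

Notation mindex n := {ffun 'I_n -> nat}.

Section Multiindices.
Variable n : nat.
Local Open Scope nat_scope.
Implicit Types k l : mindex n.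

Definition mdeg k : nat := \sum_(v < n) k v.

Definition lexle : rel (mindex n) :=
  fun k l => (codom k <= codom l :> seqlexi nat)%O.

Definition mindices (s : nat) : seq (mindex n) :=
  sort lexle [seq k <- [seq [ffun v => g v : nat] | g : {ffun 'I_n -> 'I_s.+1}]
              | mdeg k == s].

(* k(i+1) in the 1-based numbering; each degree contributes at least one index
   when n > 0, so degrees 0, ..., i suffice to reach position i *)
Definition kidx (i : nat) : mindex n :=
  nth (0%R : mindex n) (flatten [seq mindices s | s <- iota 0 i.+1]) i.

Definition m_ (s : nat) : nat := 'C(s + n, s).
Definition N_ (s : nat) : nat := size (mindices s).
Definition l_ (s : nat) : nat := \sum_(q < s.+1) q * N_ q.

Let L m := flatten [seq mindices s | s <- iota 0 m].

Lemma lexle_total : total lexle.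
Proof. by move=> k l; apply: le_total. Qed.

Lemma lexle_trans : transitive lexle.
Proof. by move=> k l m; apply: le_trans. Qed.

Lemma lexle_anti : antisymmetric lexle.
Proof.
move=> k l /le_anti e; apply/ffunP => v.
have := congr1 (fun s => nth 0 s (enum_rank v)) e.
by rewrite !nth_codom enum_rankK.
Qed.

Lemma mem_mindices s k : (k \in mindices s) = (mdeg k == s).
Proof.
rewrite mem_sort mem_filter; case: eqP => //= ks.
apply/mapP.
have le v : k v < s.+1 by rewrite ltnS -ks /mdeg (bigD1 v) //= leq_addr.
exists [ffun v => Ordinal (le v)]; first by rewrite mem_enum.
by apply/ffunP => v; rewrite !ffunE.
Qed.

Lemma mindices_uniq s : uniq (mindices s).
Proof.
rewrite sort_uniq filter_uniq // map_inj_uniq ?enum_uniq // => f g /ffunP e.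
by apply/ffunP => v; apply/val_inj; have := e v; rewrite !ffunE.
Qed.

Let LS m : L m.+1 = L m ++ mindices m.
Proof. by rewrite /L -addn1 iotaD map_cat flatten_cat /= cats0. Qed.

Let mem_L m k : (k \in L m) = (mdeg k < m).
Proof.
elim: m => [//|m IH]; by rewrite LS mem_cat IH mem_mindices ltnS orbC -leq_eqVlt.
Qed.

Let L_uniq m : uniq (L m).
Proof.
elim: m => [//|m IH]; rewrite LS cat_uniq IH mindices_uniq andbT /=.
apply/hasPn => k; rewrite mem_mindices mem_L => /eqP ->; by rewrite ltnn.
Qed.

Let L_nth m p i : m <= p -> i < size (L m) -> nth (0%R : mindex n) (L p) i = nth 0%R (L m) i.
Proof.
move=> /subnK <-; elim: (p - m) => [//|q IH] im; rewrite addSn LS nth_cat.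
case: ifP => [_|]; first exact: IH.
move=> /negP[].
apply: leq_trans im _; elim: q {IH} => [//|q IH].
by rewrite addSn LS size_cat (leq_trans IH) // leq_addr.
Qed.

Hypothesis n_gt0 : 0 < n.

Let L_size m : m <= size (L m).
Proof.
elim: m => [//|m IH]; rewrite LS size_cat -addn1 leq_add //.
pose k : mindex n := [ffun v => if v == Ordinal n_gt0 then m else 0].
suff : k \in mindices m by case: (mindices m).
rewrite mem_mindices /mdeg (bigD1 (Ordinal n_gt0)) //= ffunE eqxx.
by rewrite big1 ?addn0 // => v /negPf vn; rewrite ffunE vn.
Qed.

Let kidxE i m : i < size (L m) -> kidx i = nth 0%R (L m) i.
Proof.
move=> im; rewrite /kidx -/(L i.+1); have [le|/ltnW le] := leqP m i.+1; first exact: L_nth.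
by apply/esym/L_nth => //; apply: L_size.
Qed.

Lemma kidx_inj : injective kidx.
Proof.
move=> i j e; pose m := (maxn i j).+1.
have im : i < size (L m) by apply: leq_trans (L_size _); rewrite ltnS leq_maxl.
have jm : j < size (L m) by apply: leq_trans (L_size _); rewrite ltnS leq_maxr.
by apply/eqP; rewrite -(nth_uniq 0%R im jm (L_uniq m)) -!kidxE // e.
Qed.

Lemma kidx_surj k : exists i, kidx i = k.
Proof.
have kL : k \in L (mdeg k).+1 by rewrite mem_L.
by exists (index k (L (mdeg k).+1)); rewrite (@kidxE _ (mdeg k).+1) ?nth_index ?index_mem.
Qed.

Definition glexle : rel (mindex n) :=
  fun k l => (mdeg k < mdeg l) || (mdeg k == mdeg l) && lexle k l.

Let glexle_trans : transitive glexle.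
Proof.
move=> k l m /orP[h1|/andP[/eqP h1 g1]] /orP[h2|/andP[/eqP h2 g2]]; apply/orP.
- by left; apply: ltn_trans h1 h2.
- by left; rewrite -h2.
- by left; rewrite h1.
- by right; rewrite h1 h2 eqxx (lexle_trans g1 g2).
Qed.

Let L_sorted m : sorted glexle (L m).
Proof.
elim: m => [//|m IH]; rewrite LS sorted_pairwise // pairwise_cat.
apply/and3P; split; last first.
- have : pairwise lexle (mindices m).
    by rewrite -(sorted_pairwise lexle_trans) sort_sorted //; apply: lexle_total.
  apply: (@sub_in_pairwise _ (mem (mindices m))); last by apply/allP.
  move=> k l hk hl h.
  have /eqP h1 : mdeg k == m by rewrite -mem_mindices; exact: hk.
  have /eqP h2 : mdeg l == m by rewrite -mem_mindices; exact: hl.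
  by rewrite /glexle h1 h2 eqxx h orbT.
- by rewrite -sorted_pairwise.
- apply/allrelP => k l; rewrite mem_L mem_mindices => h /eqP h2.
  by rewrite /glexle h2 h.
Qed.

Lemma kidx_glex i j : i <= j -> glexle (kidx i) (kidx j).
Proof.
move=> ij; have jm := L_size j.+1.
have im := leq_ltn_trans ij jm.
rewrite (kidxE im) (kidxE jm); apply: (sorted_leq_nth glexle_trans) => //.
by move=> k; rewrite /glexle eqxx /= /lexle lexx orbT.
Qed.

End Multiindices.

(* The Euclidean topology of C, and through it of the row vectors C^n. *)
HB.instance Definition _ (R : realType) := GRing.ComAlgebra.copy R[i] R[i]^o.
HB.instance Definition _ (R : realType) := Vector.copy R[i] R[i]^o.
HB.instance Definition _ (R : realType) := NormedModule.copy R[i] R[i]^o.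

Section ComplexSpace.
Variables (R : realType) (n : nat).
Local Notation C := R[i].
Local Notation Cn := 'rV[R[i]]_n.

Definition monomial (k : mindex n) (z : Cn) : C := \prod_(v < n) z 0 v ^+ k v.

(* e_(i+1) in the 1-based numbering *)
Definition e_ (i : nat) : Cn -> C := monomial (kidx n i).

Definition vandermonde i (zeta : 'I_i -> Cn) : C :=
  \det (\matrix_(alpha < i, beta < i) e_ alpha (zeta beta)).

Definition V_ (K : set Cn) (i : nat) : R :=
  sup [set normc (vandermonde zeta) | zeta in
        [set zeta : 'I_i -> Cn | forall beta, K (zeta beta)]].

Definition transfinite_diameter (K : set Cn) : \bar R :=
  limn_esup (fun s => (V_ K (m_ n s) `^ ((l_ n s)%:R^-1))%:E).

Definition polynomially_convex (K : set Cn) : Prop :=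
  forall z : Cn,
    (forall p : mpoly.mpoly n C,
       normc (mpoly.meval (fun v => z 0 v) p) <=
       sup [set normc (mpoly.meval (fun v => w 0 v) p) | w in K]) ->
    K z.

Definition cis (t : R) : C := cos t +i* sin t.

Definition plurisubharmonic (u : Cn -> \bar R) : Prop :=
  [/\ (forall z, u z < +oo)%E,
      lower_semicontinuous (fun z => - u z)%E &
      forall a b : Cn,
        (u a <= ((2 * pi)^-1)%R%:E *
          \int[lebesgue_measure]_(t in `[0%R, (2 * pi)%R]) u (a + cis t *: b)%R)%E].

Definition pluripolar (E : set Cn) : Prop :=
  exists u : Cn -> \bar R,
    [/\ plurisubharmonic u, (exists z, u z <> -oo%E) &
        E `<=` [set z | u z = -oo%E]].

(* Sum of a convergent multiple power series centred at w on an open polydisc;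
   convergence on an open polydisc does not depend on the order of summation. *)
Definition analytic_at (f : Cn -> C) (w : Cn) : Prop :=
  exists (c : mindex n -> C) (r : R), 0 < r /\
    forall z : Cn, (forall v, normc (z 0 v - w 0 v) < r) ->
      series (fun i => c (kidx n i) * e_ i (z - w)) @ \oo --> f z.

Definition analytic_on (U : set Cn) (f : Cn -> C) : Prop :=
  forall w, U w -> analytic_at f w.

Definition entire : (Cn -> C) -> Prop := analytic_on setT.

(* W is a neighbourhood of 0 in A(D), D open, with the topology of locally
   uniform convergence. *)
Definition A_nbhs0 (D : set Cn) (W : set (Cn -> C)) : Prop :=
  exists (Q : set Cn) (e : R), [/\ compact Q, Q `<=` D, 0 < e &
    forall f, analytic_on D f -> (forall z, Q z -> normc (f z) < e) -> W f].

(* A germ on K is represented by any total function that is analytic near K;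
   two such functions represent the same germ when they agree near K. *)
Definition germ (K : set Cn) (f : Cn -> C) : Prop :=
  exists U, [/\ open U, K `<=` U & analytic_on U f].

Definition germ_eq (K : set Cn) (f g : Cn -> C) : Prop :=
  exists U, [/\ open U, K `<=` U & forall z, U z -> f z = g z].

Definition shrinking_to (K : set Cn) (D : nat -> set Cn) : Prop :=
  [/\ forall j, open (D j),
      forall j, compact (closure (D j.+1)) /\ closure (D j.+1) `<=` D j &
      K = \bigcap_j D j].

Definition absolutely_convex (W : set (Cn -> C)) : Prop :=
  forall f g (a b : C), W f -> W g -> normc a + normc b <= 1 ->
    W (fun z => a * f z + b * g z).

(* Neighbourhoods of 0 for the locally convex inductive limit of the A(D_j):
   those containing an absolutely convex set of germs whose inverse image in
   every A(D_j) is a neighbourhood of 0. *)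
Definition indlim_nbhs0 (K : set Cn) (D : nat -> set Cn)
    (W : set (Cn -> C)) : Prop :=
  exists B : set (Cn -> C),
    [/\ absolutely_convex B,
        (forall f g, germ K f -> germ K g -> germ_eq K f g -> B f -> B g),
        (forall j, A_nbhs0 (D j) B) &
        forall f, germ K f -> B f -> W f].

Definition functional : Type := (Cn -> C) -> C.

(* L is linear on S and continuous for the translation invariant topology on S
   whose neighbourhoods of 0 are given by nbhs0. *)
Definition continuous_linear (S : set (Cn -> C))
    (nbhs0 : set (Cn -> C) -> Prop) (L : functional) : Prop :=
  (forall (a b : C) f g, S f -> S g ->
     L (fun z => a * f z + b * g z) = a * L f + b * L g) /\
  (forall f (eps : R), S f -> 0 < eps ->
     exists2 W, nbhs0 W & forall h, S h -> W h ->
       normc (L (fun z => f z + h z) - L f) < eps).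

(* A(C^n)^* *)
Definition analytic_functional (L : functional) : Prop :=
  continuous_linear entire (A_nbhs0 setT) L.

(* A(K)^*; the inductive limit does not depend on the choice of the D_j.  Since
   germs are represented by functions on all of C^n, restricting L to entire
   functions leaves L unchanged. *)
Definition dual_germs (K : set Cn) (L : functional) : Prop :=
  (forall f g, germ K f -> germ K g -> germ_eq K f g -> L f = L g) /\
  (forall D, shrinking_to K D ->
     continuous_linear (germ K) (indlim_nbhs0 K D) L).

(* An element f' of A_0({oo^n}) is represented by the family (a_k) of the
   coefficients of its expansion  f'(z) = sum_k a_k / z^(k+I). *)
Definition inf_series (a : mindex n -> C) (z : Cn) : C^nat :=
  series (fun i => a (kidx n i) / monomial (kidx n i + [ffun=> 1%N]) z).

Definition germ_infty (a : mindex n -> C) : Prop :=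
  exists2 r : R, 0 < r &
    forall z : Cn, (forall v, r < normc (z 0 v)) -> cvgn (inf_series a z).

Definition germ_infty_val (a : mindex n -> C) (z : Cn) : C :=
  limn (inf_series a z).

End ComplexSpace.

Section TorusIntegral.
Variable R : realType.
Local Notation C := R[i].

Definition circle_integral (r : R) (g : C -> C) : C :=
  let h t := g (r%:C * cis t) * ('i%C * r%:C * cis t) in
  (\int[lebesgue_measure]_(t in `[0, 2 * pi]) complex.Re (h t))%R +i*
  (\int[lebesgue_measure]_(t in `[0, 2 * pi]) complex.Im (h t))%R.

(* iterated integral over |z_1| = ... = |z_n| = r *)
Fixpoint torus_integral (r : R) (n : nat) : ('rV[C]_n -> C) -> C :=
  match n with
  | 0 => fun F => F 0
  | p.+1 => fun F => circle_integral r (fun x =>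
      @torus_integral r p (fun z => F (row_mx (const_mx x : 'rV_1) z)))
  end.

End TorusIntegral.

Section Polya.
Variables (R : realType) (n : nat).
Local Notation C := R[i].
Local Notation Cn := 'rV[R[i]]_n.

(* f' = T f^* *)
Definition T_transform (L : functional R n) (a : mindex n -> C) : Prop :=
  [/\ analytic_functional L, germ_infty a &
      \forall r \near +oo, forall phi : Cn -> C, entire phi ->
        L phi = (2%:R * (pi : R)%:C * 'i%C) ^- n *
          torus_integral r (fun z => phi z * germ_infty_val a z)].

Definition hankel (a : mindex n -> C) (i : nat) : C :=
  \det (\matrix_(alpha < i, beta < i) a (kidx n alpha + kidx n beta)).

(* The i-th term below is the term of index i+1 in the 1-based numbering. *)
Definition D_ (a : mindex n -> C) : \bar R :=
  limn_esup (fun i =>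
    (normc (hankel a i.+1) `^ ((2 * l_ n (mdeg (kidx n i)))%:R^-1))%:E).

Definition sharpness_property (K : set Cn) : Prop :=
  transfinite_diameter K =
  ereal_sup [set D_ a | a in
    [set a | exists2 L, dual_germs K L & T_transform L a]].

End Polya.

(* Main.v *)
Require Import Defs.
From HB Require Import structures.
From mathcomp Require Import all_boot all_order all_algebra.
From mathcomp Require Import all_fingroup cyclic separable cyclotomic.
From mathcomp Require Import complex.
From mathcomp Require Import all_classical all_reals all_analysis.
From mathcomp Require Import ring lra zify.
Set Implicit Arguments.
Unset Strict Implicit.
Unset Printing Implicit Defensive.
Import Order.TTheory GRing.Theory Num.Theory.
Import numFieldNormedType.Exports.
Import Normc.
Local Open Scope classical_set_scope.
Local Open Scope ring_scope.
Local Open Scope complex_scope.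

(** The sequence of functionals can be taken constant. The compact set K is nonempty, because the
    empty set is pluripolar, and it carries a functional f in A(K)^* with D(f') = d(K) exactly
    ([extremal_functional]); as K is contained in each K_i, f also belongs to each A(K_i)^*.

    The functional is a series of point masses f = sum_j c_j delta_(zeta_j) with zeta_j in K and
    sum_j |c_j| <= 1. Two facts determine D(f').

    - Andreief's identity ([det_gram]) writes i! H_i(f) as the sum, over all i-tuples of nodes, of
      the product of their weights and of the square of their Vandermonde determinant. Hence
      |H_i(f)| <= V_i^2. The indices i between m_(s-1) and m_s are compared with m_(s-1) through
      V_(i+1) <= (i+1) B^s V_i, where B >= 1 bounds the coordinates on K; this is harmless because
      l_(s-1) / l_s tends to 1. Hence
      D(f') <= d(K) ([polya_inequality]).

    - The nodes are added in finite blocks. Let y < d(K) and choose a large s and m_s points of K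
      whose Vandermonde determinant det U exceeds y^(l_s). If these points all receive the weight t,
      the determinant H_(m_s) becomes det (A + t U U^T), where A comes from the earlier nodes: a
      polynomial in t of degree m_s with leading coefficient (det U)^2. By the maximum principle
      some t of given modulus w makes it at least w^(m_s) |det U|^2 ([det_perturbation]). Since
      m_s = O(l_s / s) and m_s is polynomial in s, a block of any prescribed mass m_s w can be used
      at no cost for the limit of the l_s-th roots ([add_nodes]). Later blocks are given masses so
      small that this determinant stays large ([hankel_stable]). With y increasing to d(K) along
      the blocks, D(f') >= d(K) ([extremal_nodes]).

    It remains to see that f' is the transform of f. Near infinity the series of moments sums to
    sum_j c_j prod_v 1 / (z_v - zeta_(j,v)) ([moments_expansion]), so the integral representation
    is Cauchy's formula on a torus ([torus_cauchy]), summed over the nodes. It follows by iterating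
    Cauchy's formula on circles: the restriction of an entire function to a line parallel to a
    coordinate axis is the sum of a power series near each of its points ([slice_power_series]),
    hence continuously differentiable ([power_series_C1]), and for such functions the formula
    holds because the integral over the circles zeta + s (x - zeta), |x| = r, against a fixed
    kernel does not depend on s ([cauchy_circle]). *)

(** * Moduli, limits and absolutely convergent series of complex numbers *)

Section ComplexModulus.
Variable R : realType.
Local Notation C := R[i].
Implicit Types (x y : C) (a b : R).

Lemma normr_normc x : `|x| = (normc x)%:C. Proof. by case: x. Qed.

Lemma normc_ge0 x : 0 <= normc x.
Proof. by case: x => a b; apply: sqrtr_ge0. Qed.

Lemma normcB x y : normc (x - y) <= normc x + normc y.
Proof. by rewrite -(normcN y) le_normcD. Qed.

Lemma normc_distC x y : normc (x - y) = normc (y - x).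
Proof. by rewrite -normcN opprB. Qed.

Lemma normc_triangle y x z : normc (x - z) <= normc (x - y) + normc (y - z).
Proof. by have := le_normcD (x - y) (y - z); rewrite addrA subrK. Qed.

Lemma normcX x k : normc (x ^+ k) = normc x ^+ k.
Proof.
by elim: k => [|k IH]; rewrite ?expr0 ?normc1 // !exprS normcM IH.
Qed.

Lemma normc_sum I (r : seq I) (P : pred I) (F : I -> C) :
  normc (\sum_(i <- r | P i) F i) <= \sum_(i <- r | P i) normc (F i).
Proof.
elim/big_ind2: _ => //; first by rewrite normc0.
by move=> x a y b h1 h2; apply: le_trans (le_normcD _ _) (lerD h1 h2).
Qed.

Lemma normc_prod I (r : seq I) (P : pred I) (F : I -> C) :
  normc (\prod_(i <- r | P i) F i) = \prod_(i <- r | P i) normc (F i).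
Proof.
by elim/big_ind2: _ => //; [rewrite normc1 | move=> x a y b <- <-; apply: normcM].
Qed.

Lemma normc_real a : normc a%:C = `|a|.
Proof. by rewrite /= expr0n addr0 sqrtr_sqr. Qed.

Lemma normc_nat k : normc (k%:R : C) = k%:R.
Proof.
by rewrite -(normr_nat R k) -normc_real; congr normc; rewrite rmorph_nat.
Qed.

Lemma normc_eq0 x : (normc x == 0) = (x == 0).
Proof.
by apply/eqP/eqP => [|->]; [apply: eq0_normc | apply: normc0].
Qed.

Lemma normc_Re x : `|complex.Re x| <= normc x.
Proof.
by case: x => a b /=; rewrite -(sqrtr_sqr a) ler_wsqrtr // lerDl sqr_ge0.
Qed.

Lemma normc_Im x : `|complex.Im x| <= normc x.
Proof.
by case: x => a b /=; rewrite -(sqrtr_sqr b) ler_wsqrtr // lerDr sqr_ge0.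
Qed.

Lemma normc_ReIm x : normc x <= `|complex.Re x| + `|complex.Im x|.
Proof.
case: x => a b /=; rewrite -[leRHS]ger0_norm ?addr_ge0 // -sqrtr_sqr.
apply: ler_wsqrtr; rewrite sqrrD !real_normK ?num_real //.
by rewrite -addrA lerD2l lerDr mulrn_wge0 ?mulr_ge0.
Qed.

Lemma normc_cis a : normc (cis a) = 1.
Proof. by rewrite /normc /= cos2Dsin2 sqrtr1. Qed.

Lemma normc_i : normc ('i%C : C) = 1.
Proof. by rewrite /normc /= expr0n expr1n add0r sqrtr1. Qed.

Lemma normc_inv_gap x z (r rho : R) : rho < r -> r <= normc x -> normc z <= rho ->
  normc (x - z)^-1 <= (r - rho)^-1.
Proof.
move=> rr xr zr; have gap : r - rho <= normc (x - z).
  by have := le_normcD (x - z) z; rewrite subrK; lra.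
rewrite normcV lef_pV2 ?posrE ?subr_gt0 //.
by apply: lt_le_trans gap; rewrite subr_gt0.
Qed.

Lemma ltr0_complex (e : C) : 0 < e -> exists2 d : R, 0 < d & e = d%:C.
Proof.
by case: e => a b; rewrite ltcE /= => /andP[/eqP -> h]; exists a.
Qed.

(** Convergence is measured by the real modulus, so that all estimates are inequalities in R. *)
Definition clim (u : nat -> C) (l : C) : Prop :=
  forall e : R, 0 < e -> exists N, forall k, (N <= k)%N -> normc (u k - l) <= e.

Lemma climP (u : nat -> C) l : u @ \oo --> l <-> clim u l.
Proof.
split=> [/cvgrPdist_le h e e0|h].
  have /(h _) [N _ hN] : 0 < e%:C by rewrite ltcR.
  exists N => k /hN; rewrite /= normc_distC => {hN}.
  by rewrite normr_normc lecR normc_distC.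
apply/cvgrPdist_le => _ /ltr0_complex [e e0 ->].
have [N hN] := h _ e0; exists N => // k /= /hN.
by rewrite normr_normc lecR normc_distC.
Qed.

Lemma clim_unique u l l' : clim u l -> clim u l' -> l = l'.
Proof.
move=> h h'; apply/eqP; rewrite -subr_eq0 -normc_eq0; apply: contraT => n0.
have e0 : 0 < normc (l - l') / 3 by rewrite divr_gt0 // lt0r n0 normc_ge0.
have [N hN] := h _ e0; have [N' hN'] := h' _ e0.
have := hN (maxn N N') (leq_maxl _ _); have := hN' (maxn N N') (leq_maxr _ _).
have := normc_triangle (u (maxn N N')) l l'; rewrite [normc (l - u _)]normc_distC.
lra.
Qed.

Lemma clim_le (u : nat -> C) l x M :
  clim u l -> (exists N, forall k, (N <= k)%N -> normc (u k - x) <= M) ->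
  normc (l - x) <= M.
Proof.
move=> h [N hN]; apply/ler_addgt0Pr => e e0.
have [N' hN'] := h _ e0.
have := hN (maxn N N') (leq_maxl _ _); have := hN' (maxn N N') (leq_maxr _ _).
have := normc_triangle (u (maxn N N')) l x; rewrite [normc (l - u _)]normc_distC.
lra.
Qed.

Lemma clim_ge (u : nat -> C) l M :
  clim u l -> (exists N, forall k, (N <= k)%N -> M <= normc (u k)) ->
  M <= normc l.
Proof.
move=> h [N hN]; apply/ler_addgt0Pr => e e0.
have [N' hN'] := h _ e0.
have := hN (maxn N N') (leq_maxl _ _); have := hN' (maxn N N') (leq_maxr _ _).
have := le_normcD (u (maxn N N') - l) l; rewrite subrK.
lra.
Qed.

Lemma clim_cst l : clim (fun=> l) l.
Proof. by move=> e e0; exists 0%N => k _; rewrite subrr normc0 ltW. Qed.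

Lemma climD u v l l' : clim u l -> clim v l' -> clim (fun k => u k + v k) (l + l').
Proof.
move=> h h' e e0; have e20 : 0 < e / 2 by lra.
have [N hN] := h _ e20; have [N' hN'] := h' _ e20.
exists (maxn N N') => k; rewrite geq_max => /andP[/hN h1 /hN' h2].
by have := le_normcD (u k - l) (v k - l'); rewrite addrACA -opprD; lra.
Qed.

Lemma climM u v l l' : clim u l -> clim v l' -> clim (fun k => u k * v k) (l * l').
Proof.
move=> h h' e e0; pose B := normc l + normc l' + 1.
have hl := normc_ge0 l; have hl' := normc_ge0 l'.
have B0 : 0 < B by rewrite /B; lra.
pose d := Num.min 1 (e / (2 * B)).
have d0 : 0 < d by rewrite lt_min ltr01 divr_gt0 // mulr_gt0.
have d1 : d <= 1 by rewrite ge_min lexx.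
have dB : d * B <= e / 2.
  have : d <= e / (2 * B) by rewrite ge_min lexx orbT.
  by rewrite ler_pdivlMr ?mulr_gt0 //; lra.
have [N hN] := h _ d0; have [N' hN'] := h' _ d0.
exists (maxn N N') => k; rewrite geq_max => /andP[/hN h1 /hN' h2].
have hu : normc (u k) <= B.
  by have := le_normcD (u k - l) l; rewrite subrK /B; lra.
have -> : u k * v k - l * l' = u k * (v k - l') + (u k - l) * l' by ring.
apply: le_trans (le_normcD _ _) _; rewrite !normcM.
have h3 : normc (u k) * normc (v k - l') <= B * d.
  by apply: ler_pM => //; apply: normc_ge0.
have h4 : normc (u k - l) * normc l' <= d * B.
  by apply: ler_pM; rewrite ?normc_ge0 // /B; lra.
lra.
Qed.

Lemma clim_sum I (r : seq I) (P : pred I) (u : I -> nat -> C) (l : I -> C) :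
  (forall i, P i -> clim (u i) (l i)) ->
  clim (fun k => \sum_(i <- r | P i) u i k) (\sum_(i <- r | P i) l i).
Proof.
move=> h; elim: r => [|i r IH].
  by rewrite big_nil => e e0; exists 0%N => k _; rewrite big_nil subrr normc0 ltW.
under [X in clim X]eq_fun do rewrite big_cons.
by rewrite big_cons; case: ifP => // Pi; apply: climD => //; apply: h.
Qed.

Lemma clim_prod I (r : seq I) (P : pred I) (u : I -> nat -> C) (l : I -> C) :
  (forall i, P i -> clim (u i) (l i)) ->
  clim (fun k => \prod_(i <- r | P i) u i k) (\prod_(i <- r | P i) l i).
Proof.
move=> h; elim: r => [|i r IH].
  by rewrite big_nil => e e0; exists 0%N => k _; rewrite big_nil subrr normc0 ltW.
under [X in clim X]eq_fun do rewrite big_cons.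
by rewrite big_cons; case: ifP => // Pi; apply: climM => //; apply: h.
Qed.

(** Absolute convergence together with a bound for the sum of the moduli: the estimates below use
    the bound more often than the convergence. *)
Definition summable_by (u : nat -> C) (M : R) : Prop :=
  forall N, \sum_(j < N) normc (u j) <= M.

Definition csum (u : nat -> C) : C := xget 0 (clim (fun N => \sum_(j < N) u j)).

Lemma csum_eq (u : nat -> C) l : clim (fun N => \sum_(j < N) u j) l -> csum u = l.
Proof.
move=> h; rewrite /csum; case: xgetP => [x -> hx|/(_ l)]; last by [].
exact: clim_unique hx h.
Qed.

(** The real and imaginary parts converge absolutely, so that the completeness of R suffices. *)
Lemma csumP u M : summable_by u M -> clim (fun N => \sum_(j < N) u j) (csum u).
Proof.
move=> hM.
have real_cvg (p : C -> R) : (forall x, `|p x| <= normc x) ->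
    cvgn (series (p \o u)).
  move=> hp; apply: normed_cvg; apply: nondecreasing_is_cvgn.
    by apply: nondecreasing_series => k _ _ /=.
  exists M => _ [N _ <-]; rewrite /= /series /= big_mkord.
  by apply: le_trans (hM N); apply: ler_sum => j _; apply: hp.
have := real_cvg _ normc_Re; have := real_cvg _ normc_Im.
set b := limn _ => /[swap]; set a := limn _ => ha hb.
suff h : clim (fun N => \sum_(j < N) u j) (a +i* b) by rewrite (csum_eq h).
move/cvgrPdist_le in ha; move/cvgrPdist_le in hb.
move=> e e0; have e20 : 0 < e / 2 by lra.
have [N1 _ h1] := ha _ e20; have [N2 _ h2] := hb _ e20.
exists (maxn N1 N2) => k; rewrite geq_max => /andP[/h1 /= h1k /h2 /= h2k].
apply: le_trans (normc_ReIm _) _.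
have -> : complex.Re (\sum_(j < k) u j - a +i* b) =
    series (@complex.Re R \o u) k - a.
  rewrite /series /= big_mkord raddfB /=; congr (_ - _).
  exact: (raddf_sum (@complex.Re R : Rcomplex R -> R)).
have -> : complex.Im (\sum_(j < k) u j - a +i* b) =
    series (@complex.Im R \o u) k - b.
  rewrite /series /= big_mkord raddfB /=; congr (_ - _).
  exact: (raddf_sum (@complex.Im R : Rcomplex R -> R)).
by rewrite ![`|series _ _ - _|]distrC; lra.
Qed.

Lemma eq_csum (u v : nat -> C) : u =1 v -> csum u = csum v.
Proof. by move=> /funext ->. Qed.

Lemma csum_lin (a b : C) u v M M' : summable_by u M -> summable_by v M' ->
  csum (fun j => a * u j + b * v j) = a * csum u + b * csum v.
Proof.
move=> /csumP hu /csumP hv; apply: csum_eq.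
under [X in clim X]eq_fun do rewrite big_split /= -!mulr_sumr.
by apply: climD; apply: climM => //; apply: clim_cst.
Qed.

Lemma csum_mull (a : C) u M : summable_by u M ->
  csum (fun j => a * u j) = a * csum u.
Proof.
move=> hu; have := csum_lin a 0 hu hu; rewrite mul0r addr0 => <-.
by apply: eq_csum => j; rewrite mul0r addr0.
Qed.

Lemma csum_le u M : summable_by u M -> normc (csum u) <= M.
Proof.
move=> hu; rewrite -(subr0 (csum u)); apply: (clim_le (csumP hu)).
exists 0%N => k _; rewrite subr0; apply: le_trans (normc_sum _ _ _) (hu k).
Qed.

Lemma summable_byM (u f : nat -> C) M B : 0 <= B -> summable_by u M ->
  (forall j, normc (f j) <= B) -> summable_by (fun j => u j * f j) (M * B).
Proof.
move=> B0 hu hf N; apply: le_trans (_ : (\sum_(j < N) normc (u j)) * B <= _).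
  rewrite mulr_suml; apply: ler_sum => j _; rewrite normcM.
  by apply: ler_pM => //; apply: normc_ge0.
by apply: ler_wpM2r.
Qed.

Lemma summable_ge0 u M : summable_by u M -> 0 <= M.
Proof. by move=> /(_ 0%N); rewrite big_ord0. Qed.

Lemma csum_tail u M J e : summable_by u M ->
  (forall N, (J <= N)%N -> \sum_(J <= j < N) normc (u j) <= e) ->
  normc (csum u - \sum_(j < J) u j) <= e.
Proof.
move=> /csumP h he; apply: (clim_le h); exists J => N JN.
rewrite -!(big_mkord xpredT u) [X in X - _](big_cat_nat _ (n := J)) //= addrAC subrr add0r.
exact: le_trans (normc_sum _ _ _) (he _ JN).
Qed.

Lemma summable_tail u M : summable_by u M ->
  forall e, 0 < e -> exists J, forall N, (J <= N)%N ->
    \sum_(J <= j < N) normc (u j) <= e.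
Proof.
move=> hu e e0.
have nd : nondecreasing_seq (series (fun j => normc (u j))).
  by apply: nondecreasing_series => k _ _; apply: normc_ge0.
have : cvgn (series (fun j => normc (u j))).
  apply: nondecreasing_is_cvgn => //.
  by exists M => _ [N _ <-]; rewrite /series /= big_mkord.
move=> cv; have /cvgrPdist_le /(_ e e0) [J _ hJ] := cv.
exists J => N JN; have /= := hJ J (leqnn J).
have := nondecreasing_cvgn_le nd cv N.
have := nondecreasing_cvgn_le nd cv J.
rewrite /series /= (big_cat_nat _ (n := J) (p := N)) //= => h1 h2.
by rewrite ger0_norm ?subr_ge0 //; lra.
Qed.

End ComplexModulus.

(** * Power series in one variable *)

Section PowerSeries.
Variable R : realType.
Local Notation C := R[i].

Definition power_series_at (f : C -> C) (x : C) : Prop :=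
  exists (b : nat -> C) (r : R), 0 < r /\
    forall h, normc h < r ->
      clim (fun N => \sum_(m < N) b m * h ^+ m) (f (x + h)).

Lemma sum_halfE N : \sum_(m < N) (2^-1 : R) ^+ m = 2 - 2 * 2^-1 ^+ N.
Proof.
elim: N => [|N IH]; first by rewrite big_ord0 expr0; ring.
by rewrite big_ord_recr /= IH exprS; lra.
Qed.

Lemma sum_half N : \sum_(m < N) (2^-1 : R) ^+ m <= 2.
Proof.
rewrite sum_halfE; have : 0 <= (2^-1 : R) ^+ N by rewrite exprn_ge0.
lra.
Qed.

Lemma clim_terms_bounded (u : nat -> C) l :
  clim (fun N => \sum_(m < N) u m) l -> exists2 M, 0 <= M & forall m, normc (u m) <= M.
Proof.
move=> /(_ 1 ltr01) [N hN].
exists (2 + \sum_(m < N) normc (u m)).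
  by rewrite addr_ge0 // sumr_ge0 // => i _; apply: normc_ge0.
move=> m; have [mN|Nm] := ltnP m N.
  rewrite (bigD1 (Ordinal mN)) //= addrCA lerDl addr_ge0 // sumr_ge0 // => i _.
  exact: normc_ge0.
have h1 := hN _ Nm; have h2 := hN _ (leqW Nm).
rewrite ler_wpDr ?sumr_ge0 // => [i _|]; first exact: normc_ge0.
have -> : u m = (\sum_(i < m.+1) u i - l) - (\sum_(i < m) u i - l).
  by rewrite big_ord_recr /=; ring.
by apply: le_trans (normcB _ _) _; lra.
Qed.

(** The remainders satisfy E_(m+1) = v E_m + m u^(m-1) (v - u)^2, whence a bound with the factor
    m (m - 1) / 2, replaced by the more convenient 2^m; the factor r^2 avoids the exponent m - 2. *)
Lemma taylor2_monomial (u v : C) (r : R) m : normc u <= r -> normc v <= r ->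
  r ^+ 2 * normc (v ^+ m - u ^+ m - m%:R * u ^+ m.-1 * (v - u))
  <= 2 ^+ m * r ^+ m * normc (v - u) ^+ 2.
Proof.
move=> ur vr; have r0 : 0 <= r := le_trans (normc_ge0 _) ur.
have d0 := normc_ge0 (v - u).
elim: m => [|m IH].
  by rewrite !expr0 subrr mul0r mul0r subrr normc0 mulr0 !mul1r sqr_ge0.
have -> : v ^+ m.+1 - u ^+ m.+1 - m.+1%:R * u ^+ m.+1.-1 * (v - u) =
    v * (v ^+ m - u ^+ m - m%:R * u ^+ m.-1 * (v - u)) +
    m%:R * u ^+ m.-1 * (v - u) ^+ 2.
  case: m {IH} => [|m] /=; first by rewrite !expr0; ring.
  by rewrite -!natr1 !exprS; ring.
apply: le_trans (ler_wpM2l (sqr_ge0 r) (le_normcD _ _)) _.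
rewrite !normcM !normcX normc_nat mulrDr.
have h1 : r ^+ 2 * (normc v * normc (v ^+ m - u ^+ m - m%:R * u ^+ m.-1 * (v - u)))
    <= 2 ^+ m * r ^+ m.+1 * normc (v - u) ^+ 2.
  rewrite [X in _ <= X](_ : _ = r * (2 ^+ m * r ^+ m * normc (v - u) ^+ 2)); last by rewrite [r ^+ m.+1]exprS; ring.
  by rewrite mulrCA; apply: ler_pM => //; rewrite ?normc_ge0 // mulr_ge0 ?sqr_ge0 ?normc_ge0.
have h2 : r ^+ 2 * (m%:R * normc u ^+ m.-1 * normc (v - u) ^+ 2)
    <= 2 ^+ m * r ^+ m.+1 * normc (v - u) ^+ 2.
  rewrite mulrA ler_wpM2r ?sqr_ge0 //.
  case: m {IH h1} => [|m] /=; first by rewrite mul0r mulr0 mul1r.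
  have -> : r ^+ m.+2 = r ^+ 2 * r ^+ m by rewrite -exprD.
  rewrite [leRHS]mulrCA ler_wpM2l ?sqr_ge0 //; apply: ler_pM => //.
  - by rewrite exprn_ge0 ?normc_ge0.
  - by rewrite -natrX ler_nat ltnW // ltn_expl.
  - by apply: lerXn2r => //; rewrite nnegrE ?normc_ge0.
by rewrite [2 ^+ m.+1]exprS; lra.
Qed.

(** The expansion joins two arbitrary points near x, instead of starting from x: this uniformity
    in u is what makes the derivative continuous. *)
Lemma power_series_taylor2 f x : power_series_at f x ->
  exists (rho M : R) (A : C -> C), [/\ 0 < rho, 0 <= M &
    forall u v, normc u <= rho -> normc v <= rho ->
      normc (f (x + v) - f (x + u) - A u * (v - u)) <= M * normc (v - u) ^+ 2].
Proof.
move=> [b [r [r0 hf]]].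
(* The coefficients are O((4 rho)^-m), since 4 rho < r; this leaves 2^-m after the factor 2^m of
   [taylor2_monomial]. *)
pose rho := r / 8; have rho0 : 0 < rho by rewrite /rho; lra.
have : normc (4 * rho)%:C < r by rewrite normc_real gtr0_norm /rho; lra.
move=> /hf; move=> /(@clim_terms_bounded (fun m => b m * (4 * rho)%:C ^+ m)) [M M0 hM].
have hb m : normc (b m) * (2 ^+ m * rho ^+ m) <= M * 2^-1 ^+ m.
  have := hM m; rewrite normcM normcX normc_real gtr0_norm; last by lra.
  move=> h; have e : (4 : R) = 2 * 2 by lra.
  rewrite exprVn ler_pdivlMr ?exprn_gt0 //; apply: le_trans h.
  by rewrite e !exprMn; lra.
exists rho, (2 * M / rho ^+ 2), (fun u => csum (fun m => m.+1%:R * b m.+1 * u ^+ m)).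
split => // [|u v ur vr]; first by rewrite divr_ge0 ?sqr_ge0 ?mulr_ge0.
have small w : normc w <= rho -> normc w < r.
  by move=> h; apply: le_lt_trans h _; rewrite /rho; lra.
have /hf hu := small _ ur; have /hf hv := small _ vr.
have sA : summable_by (fun m => m.+1%:R * b m.+1 * u ^+ m) (2 * (M / rho)).
  move=> N; apply: le_trans (_ : \sum_(m < N) 2^-1 ^+ m * (M / rho) <= _); last first.
    by rewrite -mulr_suml ler_wpM2r ?sum_half // divr_ge0 // ltW.
  apply: ler_sum => m _; rewrite !normcM normcX normc_nat.
  have := hb m.+1; rewrite !exprS => h.
  have : (m.+1%:R : R) <= 2 ^+ m by rewrite -natrX ler_nat ltn_expl.
  move=> h2; rewrite mulrA ler_pdivlMr //.
  have h3 : normc u ^+ m <= rho ^+ m by rewrite lerXn2r ?nnegrE ?normc_ge0 // ltW.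
  apply: le_trans (_ : (2 ^+ m * normc (b m.+1) * rho ^+ m) * rho <= _).
    rewrite ler_wpM2r ?(ltW rho0) //; apply: ler_pM => //.
    - by rewrite mulr_ge0 ?normc_ge0.
    - by rewrite exprn_ge0 ?normc_ge0.
    - by rewrite ler_wpM2r ?normc_ge0.
  by have : 0 <= M * 2^-1 ^+ m; [rewrite mulr_ge0 ?exprn_ge0 | lra].
have lim : clim (fun N => \sum_(m < N.+1) b m * (v ^+ m - u ^+ m - m%:R * u ^+ m.-1 * (v - u)))
   (f (x + v) - f (x + u) - csum (fun m => m.+1%:R * b m.+1 * u ^+ m) * (v - u)).
  have e N : \sum_(m < N.+1) b m * (v ^+ m - u ^+ m - m%:R * u ^+ m.-1 * (v - u)) =
     (\sum_(m < N.+1) b m * v ^+ m + -1 * \sum_(m < N.+1) b m * u ^+ m) +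
     (u - v) * \sum_(m < N) m.+1%:R * b m.+1 * u ^+ m.
    have -> : \sum_(m < N) m.+1%:R * b m.+1 * u ^+ m =
        \sum_(m < N.+1) m%:R * b m * u ^+ m.-1.
      by rewrite [RHS]big_ord_recl mul0r mul0r add0r.
    by rewrite !mulr_sumr -!big_split /=; apply: eq_bigr => m _; ring.
  under [X in clim X]eq_fun do rewrite e.
  have sh (w : nat -> C) l : clim w l -> clim (fun N => w N.+1) l.
    by move=> h e' e0; have [N hN] := h _ e0; exists N => k /leqW; apply: hN.
  have -> : f (x + v) - f (x + u) - csum (fun m => m.+1%:R * b m.+1 * u ^+ m) * (v - u)
    = (f (x + v) + -1 * f (x + u)) + (u - v) * csum (fun m => m.+1%:R * b m.+1 * u ^+ m).
    ring.
  apply: climD; [apply: climD; [exact: (sh _ _ hv)|]|]; apply: climM.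
  - exact: clim_cst.
  - exact: (sh (fun N => \sum_(m < N) b m * u ^+ m) _ hu).
  - exact: clim_cst.
  - exact: csumP sA.
rewrite -[X in normc X]subr0; apply: (clim_le lim); exists 0%N => N _; rewrite subr0.
apply: le_trans (normc_sum _ _ _) _.
apply: le_trans (_ : \sum_(m < N.+1) 2^-1 ^+ m * (M / rho ^+ 2 * normc (v - u) ^+ 2) <= _).
  apply: ler_sum => m _; rewrite normcM.
  have h := taylor2_monomial m ur vr.
  rewrite -(ler_pM2l (_ : 0 < rho ^+ 2)) ?exprn_gt0 //.
  have -> : rho ^+ 2 * (2^-1 ^+ m * (M / rho ^+ 2 * normc (v - u) ^+ 2)) =
      M * 2^-1 ^+ m * normc (v - u) ^+ 2 by field; lra.
  apply: le_trans (_ : normc (b m) * (2 ^+ m * rho ^+ m) * normc (v - u) ^+ 2 <= _).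
    by rewrite mulrCA -[leRHS]mulrA; apply: ler_wpM2l => //; apply: normc_ge0.
  by rewrite ler_wpM2r ?sqr_ge0.
rewrite -mulr_suml.
have -> : 2 * M / rho ^+ 2 * normc (v - u) ^+ 2 = 2 * (M / rho ^+ 2 * normc (v - u) ^+ 2).
  by ring.
by rewrite ler_wpM2r ?sum_half // mulr_ge0 ?divr_ge0 ?sqr_ge0.
Qed.

Definition complex_C1 (f A : C -> C) : Prop :=
  (forall y (e : R), 0 < e -> exists2 d : R, 0 < d & forall h, normc h <= d ->
     normc (f (y + h) - f y - A y * h) <= e * normc h) /\
  (forall y (e : R), 0 < e -> exists2 d : R, 0 < d & forall h, normc h <= d ->
     normc (A (y + h) - A y) <= e).

(** It identifies the derivatives provided by the expansions around different centres. *)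
Lemma derivative_unique (f : C -> C) y a a' (M M' d : R) : 0 < d ->
  (forall h, normc h <= d -> normc (f (y + h) - f y - a * h) <= M * normc h ^+ 2) ->
  (forall h, normc h <= d -> normc (f (y + h) - f y - a' * h) <= M' * normc h ^+ 2) ->
  a = a'.
Proof.
move=> d0 ha ha'; apply/eqP; rewrite -subr_eq0 -normc_eq0; apply: contraT => n0.
set N := normc (a - a'); have N0 : 0 < N by rewrite lt0r n0 normc_ge0.
pose B := `|M| + `|M'| + 1.
have B0 : 0 < B by rewrite /B ltr_wpDl // addr_ge0.
pose t := Num.min d (N / (2 * B)).
have t0 : 0 < t by rewrite lt_min d0 divr_gt0 // mulr_gt0.
have td : t <= d by rewrite ge_min lexx.
have tN : t * B <= N / 2.
  have : t <= N / (2 * B) by rewrite ge_min lexx orbT.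
  by rewrite ler_pdivlMr ?mulr_gt0 //; lra.
have nt : normc t%:C = t by rewrite normc_real gtr0_norm.
have := ha t%:C; have := ha' t%:C; rewrite nt => /(_ td) h1 /(_ td) h2.
have : N * t <= (M + M') * t ^+ 2.
  rewrite -[X in _ * X <= _]nt -normcM.
  have -> : (a - a') * t%:C = (f (y + t%:C) - f y - a' * t%:C) - (f (y + t%:C) - f y - a * t%:C).
    by ring.
  by apply: le_trans (normcB _ _) _; lra.
rewrite expr2 mulrA ler_pM2r // => h3.
have h4 : (M + M') * t <= t * B.
  rewrite mulrC ler_pM2l // /B.
  have := ler_norm M; have := ler_norm M'; lra.
by move: h3; rewrite leNgt => /negP []; apply: le_lt_trans h4 _; lra.
Qed.

Lemma power_series_C1 f : (forall x, power_series_at f x) ->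
  exists A, complex_C1 f A.
Proof.
move=> hf.
have [rho /choice [M /choice [A hA]]] := choice (fun x => power_series_taylor2 (hf x)).
pose B y := A y 0.
have rho0 x : 0 < rho x by have [] := hA x.
have M0 x : 0 <= M x by have [] := hA x.
have hB x u : normc u <= rho x / 2 -> B (x + u) = A x u.
  move=> hu; pose d := Num.min (rho (x + u)) (rho x / 2).
  apply: (@derivative_unique f (x + u) _ _ (M (x + u)) (M x) d).
  - by rewrite lt_min rho0 divr_gt0.
  - move=> h; rewrite le_min => /andP[h1 _].
    have [_ _ /(_ 0 h)] := hA (x + u); rewrite normc0 addr0 subr0.
    by apply => //; apply: ltW.
  - move=> h; rewrite le_min => /andP[_ h1].
    have [_ _ /(_ u (u + h))] := hA x; rewrite addrA [u + h]addrC addrK.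
    have := le_normcD h u => h3; apply; have := rho0 x; lra.
exists B; split=> y e e0; have My := M0 y; have ry := rho0 y; have [_ _ hy] := hA y.
  exists (Num.min (rho y) (e / (M y + 1))); first by rewrite lt_min ry divr_gt0 //; lra.
  move=> h; rewrite le_min [X in _ && X]ler_pdivlMr; last by lra.
  move=> /andP[h1 h2].
  have := hy 0 h; rewrite normc0 addr0 subr0 => /(_ (ltW ry) h1) h3.
  apply: le_trans h3 _; rewrite expr2 mulrA ler_wpM2r ?normc_ge0 //.
  by apply: le_trans h2; rewrite mulrC ler_wpM2l ?normc_ge0 //; lra.
exists (Num.min (rho y / 2) (e / (6 * M y + 1))).
  by rewrite lt_min !divr_gt0 //; lra.
move=> h; rewrite le_min [X in _ && X]ler_pdivlMr; last by lra.
move=> /andP[h1 h2].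
have [->|hn0] := eqVneq h 0; first by rewrite addr0 subrr normc0 ltW.
have n0 : 0 < normc h by rewrite lt0r normc_eq0 hn0 normc_ge0.
rewrite hB // /B.
have nd : normc (h + h) <= rho y by have := le_normcD h h; lra.
have z0 : normc 0 <= rho y by rewrite normc0 ltW.
have hr : normc h <= rho y by lra.
(* The expansions joining y, y + h and y + 2 h two by two combine into a Lipschitz bound for the
   derivative at y. *)
have t1 := hy 0 h z0 hr; have t2 := hy 0 (h + h) z0 nd; have t3 := hy h (h + h) hr nd.
move: t1 t2 t3; rewrite addr0 !subr0 addrK.
have -> : normc (h + h) = 2 * normc h by rewrite -mulr2n normcMn mulr_natl.
move=> t1 t2 t3; apply: le_trans h2.
rewrite -(ler_pM2r n0) -normcM.
have -> : (A y h - A y 0) * h = (f (y + (h + h)) - f y - A y 0 * (h + h))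
   - (f (y + h) - f y - A y 0 * h) - (f (y + (h + h)) - f (y + h) - A y h * h) by ring.
apply: le_trans (normcB _ _) _.
apply: le_trans (lerD (normcB _ _) (lexx _)) _.
have : M y * (2 * normc h) ^+ 2 = 4 * (M y * normc h ^+ 2) by ring.
have : normc h * (6 * M y + 1) * normc h = 6 * (M y * normc h ^+ 2) + normc h ^+ 2 by ring.
have := sqr_ge0 (normc h); lra.
Qed.

End PowerSeries.

(** * Curves in the complex plane *)

Section Curves.
Variable R : realType.
Local Notation C := R[i].
Local Notation mu := (@lebesgue_measure R).
Implicit Types (g k : R -> C) (f A : C -> C).

Definition curve_derive g (t : R) (D : C) : Prop :=
  forall e : R, 0 < e -> exists2 d : R, 0 < d & forall h, `|h| <= d ->
     normc (g (t + h) - g t - h%:C * D) <= e * `|h|.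

Definition curve_continuous g : Prop :=
  forall t (e : R), 0 < e -> exists2 d : R, 0 < d & forall h, `|h| <= d ->
     normc (g (t + h) - g t) <= e.

(** The map p stands for the real or the imaginary part. *)
Lemma real_part_derive (p : {additive C -> R}) g t D :
  (forall x, `|p x| <= normc x) -> (forall (a : R) x, p (a%:C * x) = a * p x) ->
  curve_derive g t D -> is_derive t (1 : R) (p \o g) (p D).
Proof.
move=> hp pZ hg.
have lim : (fun h : R => h^-1 *: ((p \o g) (h *: (1 : R) + t) - (p \o g) t)) @ 0^' --> p D.
  apply/cvgrPdist_le => e e0; have [d d0 hd] := hg e e0.
  near=> h.
  have hn0 : h != 0 by near: h; apply: nbhs_dnbhs_neq.
  have hs : `|h| <= d by near: h; apply: dnbhs0_le.
  have := hd h hs; rewrite /= [h *: 1]mulr1 [h + t]addrC => hle.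
  rewrite -normrN opprB -(ler_pM2r (_ : 0 < `|h|)) ?normr_gt0 // -normrM.
  rewrite mulrBl mulrAC mulVf // mul1r -!raddfB [_ * h]mulrC -pZ -raddfB.
  exact: le_trans (hp _) hle.
by split; [apply/cvg_ex; exists (p D) | apply/cvg_lim].
Unshelve. all: by end_near. Qed.

Lemma curve_derive_Re g t D :
  curve_derive g t D -> is_derive t (1 : R) (fun s => complex.Re (g s)) (complex.Re D).
Proof.
apply: (@real_part_derive (@complex.Re R : Rcomplex R -> R)); first exact: normc_Re.
by move=> a [x y] /=; rewrite mul0r subr0.
Qed.

Lemma curve_derive_Im g t D :
  curve_derive g t D -> is_derive t (1 : R) (fun s => complex.Im (g s)) (complex.Im D).
Proof.
apply: (@real_part_derive (@complex.Im R : Rcomplex R -> R)); first exact: normc_Im.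
by move=> a [x y] /=; rewrite mul0r addr0.
Qed.

Lemma curve_continuous_Re g : curve_continuous g -> continuous (fun s => complex.Re (g s)).
Proof.
move=> hg t; apply/cvgrPdist_le => e e0; have [d d0 hd] := hg t e e0.
near=> s; have /hd : `|s - t| <= d.
  by rewrite distrC; near: s; apply: cvgr_dist_le => //; apply: cvg_id.
rewrite [t + _]addrC subrK => h; rewrite distrC; apply: le_trans h.
by rewrite -raddfB; apply: normc_Re.
Unshelve. all: by end_near. Qed.

Lemma curve_continuous_Im g : curve_continuous g -> continuous (fun s => complex.Im (g s)).
Proof.
move=> hg t; apply/cvgrPdist_le => e e0; have [d d0 hd] := hg t e e0.
near=> s; have /hd : `|s - t| <= d.
  by rewrite distrC; near: s; apply: cvgr_dist_le => //; apply: cvg_id.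
rewrite [t + _]addrC subrK => h; rewrite distrC; apply: le_trans h.
by rewrite -raddfB; apply: normc_Im.
Unshelve. all: by end_near. Qed.

Lemma curve_derive_continuous g D :
  (forall t, curve_derive g t (D t)) -> curve_continuous g.
Proof.
move=> hg t e e0; have [d d0 hd] := hg t 1 ltr01.
pose B := normc (D t) + 1.
have B0 : 0 < B by rewrite /B ltr_wpDl // normc_ge0.
exists (Num.min d (e / B)); first by rewrite lt_min d0 divr_gt0.
move=> h; rewrite le_min ler_pdivlMr // => /andP[h1 h2].
have := hd h h1; rewrite mul1r => h3.
have := le_normcD (g (t + h) - g t - h%:C * D t) (h%:C * D t).
by rewrite subrK normcM normc_real; move: h2; rewrite /B; lra.
Qed.

Lemma curve_derive_comp f A g t D : complex_C1 f A ->
  curve_derive g t D -> curve_derive (f \o g) t (A (g t) * D).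
Proof.
move=> [hf _] hg e e0.
pose B := normc (D) + 1; pose B' := normc (A (g t)) + 1.
have B0 : 0 < B by rewrite /B ltr_wpDl // normc_ge0.
have B'0 : 0 < B' by rewrite /B' ltr_wpDl // normc_ge0.
have e10 : 0 < e / (2 * B) by rewrite divr_gt0 // mulr_gt0.
have e20 : 0 < Num.min 1 (e / (2 * B')).
  by rewrite lt_min ltr01 divr_gt0 // mulr_gt0.
have [d1 d10 h1] := hf (g t) _ e10; have [d2 d20 h2] := hg _ e20.
exists (Num.min d2 (d1 / B)); first by rewrite lt_min d20 divr_gt0.
move=> h; rewrite le_min ler_pdivlMr // => /andP[h3 h4].
have := h2 h h3; set k := Num.min _ _ => h5.
have k1 : k <= 1 by rewrite ge_min lexx.
have k2 : k * B' <= e / 2.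
  have : k <= e / (2 * B') by rewrite ge_min lexx orbT.
  by rewrite ler_pdivlMr ?mulr_gt0 //; lra.
pose q := g (t + h) - g t.
have h6 : normc q <= `|h| * B.
  have := le_normcD (q - h%:C * D) (h%:C * D).
  rewrite subrK normcM normc_real => h6; apply: le_trans h6 _.
  have : k * `|h| <= 1 * `|h| by rewrite ler_wpM2r.
  by rewrite /B; lra.
have eq : g t + q = g (t + h) by rewrite addrC subrK.
have := h1 q (le_trans h6 h4); rewrite eq => h7 /=.
have -> : f (g (t + h)) - f (g t) - h%:C * (A (g t) * D) =
  (f (g (t + h)) - f (g t) - A (g t) * q) + A (g t) * (q - h%:C * D) by ring.
apply: le_trans (le_normcD _ _) _; rewrite normcM.
have h8 : normc (A (g t)) * normc (q - h%:C * D) <= B' * (k * `|h|).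
  by apply: ler_pM => //; rewrite ?normc_ge0 // /B'; lra.
have h9 : e / (2 * B) * normc q <= e / (2 * B) * (`|h| * B).
  by rewrite ler_wpM2l // ltW.
have h10 : e / (2 * B) * (`|h| * B) = e / 2 * `|h| by field; lra.
have h11 : B' * (k * `|h|) <= e / 2 * `|h|.
  by rewrite mulrA [B' * k]mulrC ler_wpM2r.
have h12 : e / 2 * `|h| + e / 2 * `|h| = e * `|h| by field.
lra.
Qed.

Lemma curve_derive_affine (p q : C) t : curve_derive (fun s => p + s%:C * q) t q.
Proof.
move=> e e0; exists 1 => // h _; rewrite rmorphD /=.
have -> : p + (t%:C + h%:C) * q - (p + t%:C * q) - h%:C * q = 0 by ring.
by rewrite normc0 mulr_ge0 // ltW.
Qed.

Lemma curve_deriveM (c : C) g t D : curve_derive g t D ->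
  curve_derive (fun s => c * g s) t (c * D).
Proof.
move=> hg e e0; pose B := normc c + 1.
have B0 : 0 < B by rewrite /B ltr_wpDl // normc_ge0.
have [d d0 hd] := hg (e / B) (divr_gt0 e0 B0); exists d => // h /hd h1.
have -> : c * g (t + h) - c * g t - h%:C * (c * D) = c * (g (t + h) - g t - h%:C * D).
  by ring.
rewrite normcM; apply: le_trans (_ : B * (e / B * `|h|) <= _); last first.
  by have -> : B * (e / B * `|h|) = e * `|h| by field; lra.
by apply: ler_pM; rewrite ?normc_ge0 // /B; lra.
Qed.

Lemma curve_deriveD (p : C) g t D : curve_derive g t D ->
  curve_derive (fun s => p + g s) t D.
Proof.
move=> hg e e0; have [d d0 hd] := hg e e0; exists d => // h /hd h1.
by rewrite opprD addrACA subrr add0r.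
Qed.

Lemma real_expansion (g : R -> R) t D : is_derive t (1 : R) g D ->
  forall e : R, 0 < e -> exists2 d : R, 0 < d & forall h, `|h| <= d ->
     `|g (t + h) - g t - h * D| <= e * `|h|.
Proof.
move=> [dg eD] e e0.
have /cvgrPdist_le /(_ e e0) [d /= d0 hd] : (fun h : R => h^-1 *: (g (h *: (1 : R) + t) - g t)) @ 0^' --> D.
  by rewrite -eD; apply: dg.
exists (d / 2) => [|h hh]; first by rewrite divr_gt0.
have [->|hn0] := eqVneq h 0; first by rewrite addr0 subrr mul0r subr0 normr0 mulr0.
have /= := hd h; rewrite sub0r normrN => /(_ _ hn0).
rewrite /GRing.scale /= mulr1 [h + t]addrC => hle.
have -> : g (t + h) - g t - h * D = - (h * (D - h^-1 * (g (t + h) - g t))) by field.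
rewrite normrN normrM mulrC; apply: ler_wpM2r => //; apply: hle.
by apply: le_lt_trans hh _; lra.
Qed.

Lemma curve_derive_cis t : curve_derive (@cis R) t ('i%C * cis t).
Proof.
move=> e e0; have e20 : 0 < e / 2 by rewrite divr_gt0.
have [d1 d10 h1] := real_expansion (is_derive_cos t) e20.
have [d2 d20 h2] := real_expansion (is_derive_sin t) e20.
exists (Num.min d1 d2) => [|h]; first by rewrite lt_min d10.
rewrite le_min => /andP[/h1 {}h1 /h2 {}h2].
apply: le_trans (normc_ReIm _) _.
have -> : complex.Re (cis (t + h) - cis t - h%:C * ('i%C * cis t)) =
    cos (t + h) - cos t - h * - sin t by rewrite /cis /=; ring.
have -> : complex.Im (cis (t + h) - cis t - h%:C * ('i%C * cis t)) =
    sin (t + h) - sin t - h * cos t by rewrite /cis /=; ring.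
lra.
Qed.

Lemma curve_continuous_comp (f : C -> C) g :
  (forall y (e : R), 0 < e -> exists2 d : R, 0 < d & forall h, normc h <= d ->
     normc (f (y + h) - f y) <= e) ->
  curve_continuous g -> curve_continuous (f \o g).
Proof.
move=> hf hg t e e0; have [d d0 h1] := hf (g t) e e0; have [d' d'0 h2] := hg t d d0.
by exists d' => // h /h2 /h1; rewrite [g t + _]addrC subrK.
Qed.

Lemma curve_continuousM g k : curve_continuous g -> curve_continuous k ->
  curve_continuous (fun t => g t * k t).
Proof.
move=> hg hk t e e0; pose B := normc (g t) + normc (k t) + 1.
have n1 := normc_ge0 (g t); have n2 := normc_ge0 (k t).
have B0 : 0 < B by rewrite /B; lra.
pose d := Num.min 1 (e / (2 * B)).
have d0 : 0 < d by rewrite lt_min ltr01 divr_gt0 // mulr_gt0.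
have d1 : d <= 1 by rewrite ge_min lexx.
have dB : d * B <= e / 2.
  have : d <= e / (2 * B) by rewrite ge_min lexx orbT.
  by rewrite ler_pdivlMr ?mulr_gt0 //; lra.
have [a a0 ha] := hg t d d0; have [b b0 hb] := hk t d d0.
exists (Num.min a b) => [|h]; first by rewrite lt_min a0.
rewrite le_min => /andP[/ha h1 /hb h2].
have -> : g (t + h) * k (t + h) - g t * k t =
  (g (t + h) - g t) * (k (t + h) - k t) + (g (t + h) - g t) * k t
   + g t * (k (t + h) - k t) by ring.
apply: le_trans (le_normcD _ _) _; apply: le_trans (lerD (le_normcD _ _) (lexx _)) _.
rewrite !normcM.
have h3 : normc (g (t + h) - g t) * normc (k (t + h) - k t) <= d * 1.
  by apply: ler_pM; rewrite ?normc_ge0 //; lra.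
have h4 : normc (g (t + h) - g t) * normc (k t) <= d * normc (k t).
  by rewrite ler_wpM2r.
have h5 : normc (g t) * normc (k (t + h) - k t) <= normc (g t) * d.
  by rewrite ler_wpM2l.
have : d * B = d * 1 + d * normc (k t) + normc (g t) * d by rewrite /B; ring.
lra.
Qed.

Lemma curve_continuousV g : (forall t, g t != 0) -> curve_continuous g ->
  curve_continuous (fun t => (g t)^-1).
Proof.
move=> g0 hg t e e0.
have n0 s : 0 < normc (g s) by rewrite lt0r normc_eq0 g0 normc_ge0.
pose d := Num.min (normc (g t) / 2) (e * normc (g t) ^+ 2 / 2).
have d0 : 0 < d by rewrite lt_min !divr_gt0 ?mulr_gt0 ?exprn_gt0.
have [a a0 ha] := hg t d d0; exists a => // h /ha; rewrite le_min => /andP[h1 h2].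
have -> : (g (t + h))^-1 - (g t)^-1 = - ((g (t + h) - g t) / (g (t + h) * g t)).
  by field; rewrite !g0.
rewrite normcN normcM normcV normcM ler_pdivrMr ?mulr_gt0 //.
apply: le_trans h2 _.
have h3 : normc (g t) / 2 <= normc (g (t + h)).
  by have := le_normcD (g t - g (t + h)) (g (t + h)); rewrite subrK normc_distC; lra.
rewrite -mulrA ler_wpM2l ?(ltW e0) // expr2 -mulrA mulrCA mulrC ler_wpM2r //.
exact: ltW.
Qed.

Lemma curve_continuousD g k : curve_continuous g -> curve_continuous k ->
  curve_continuous (fun t => g t + k t).
Proof.
move=> hg hk t e e0; have e20 : 0 < e / 2 by rewrite divr_gt0.
have [a a0 ha] := hg t _ e20; have [b b0 hb] := hk t _ e20.
exists (Num.min a b) => [|h]; first by rewrite lt_min a0.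
rewrite le_min => /andP[/ha h1 /hb h2]; rewrite opprD addrACA.
by apply: le_trans (le_normcD _ _) _; lra.
Qed.

Lemma curve_continuous_cst (c : C) : curve_continuous (fun=> c).
Proof. by move=> t e e0; exists 1 => // h _; rewrite subrr normc0 ltW. Qed.

Lemma curve_continuous_cis : curve_continuous (@cis R).
Proof. exact: curve_derive_continuous curve_derive_cis. Qed.

End Curves.

(** * Integrals over a period *)

Lemma compact_locally_bounded (R : realType) (X : topologicalType) (K : set X) (g : X -> R) :
  compact K -> (forall x, K x -> exists M, \forall y \near x, g y <= M) ->
  exists M, forall x, K x -> g x <= M.
Proof.
move=> /compact_near_coveringP cK loc.
have : \forall n \near \oo, K `<=` (fun y => g y <= n%:R).
  apply: (cK nat \oo (fun n y => g y <= n%:R)) => x /loc [M hM].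
  near=> y n => /=; apply: le_trans (_ : M <= _).
    by near: y.
  by near: n; exists (Num.truncn M).+1 => // k /= hk;
     apply: le_trans (ltW (truncnS_gt M)) _; rewrite ler_nat.
by case=> N _ /(_ N) /= h; exists N%:R => x Kx; apply: h.
Unshelve. all: by end_near. Qed.

Section CircleIntegrals.
Variable R : realType.
Local Notation C := R[i].
Local Notation mu := (@lebesgue_measure R).
Local Notation period := `[0, 2 * pi : R]%classic.
Implicit Types (g k : R -> C) (f A : C -> C).

Lemma continuous_integrable (p : R -> R) :
  continuous p -> mu.-integrable period (EFin \o p).
Proof.
move=> cp; apply: continuous_compact_integrable; first exact: segment_compact.
exact: continuous_subspaceT.
Qed.

Lemma integral_derivative (F p : R -> R) :
  (forall t, is_derive t (1 : R) F (p t)) -> continuous p ->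
  (\int[mu]_(t in period) p t)%R = F (2 * pi) - F 0.
Proof.
move=> hF cp; have pi0 := pi_gt0 R.
have cF : continuous F.
  by move=> t; apply: differentiable_continuous; apply/derivable1_diffP; case: (hF t).
rewrite /Rintegral (@continuous_FTC2 _ p F 0 (2 * pi)) //; first by rewrite mulr_gt0.
- exact: continuous_subspaceT.
- split=> [t _| |]; first by case: (hF t).
  + by apply: cvg_at_right_filter; apply: cF.
  + by apply: cvg_at_left_filter; apply: cF.
- by move=> t _; rewrite derive1E; case: (hF t).
Qed.

(** The integral is taken separately on real and imaginary parts, so that [circle_integral] is
    convertible to an integral of this form. *)
Definition period_integral g : C :=
  (\int[mu]_(t in period) complex.Re (g t))%R +i*
  (\int[mu]_(t in period) complex.Im (g t))%R.

Lemma eq_period_integral g k : g =1 k -> period_integral g = period_integral k.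
Proof. by move=> /funext ->. Qed.

Lemma period_integral_derivative g k :
  (forall t, curve_derive g t (k t)) -> curve_continuous k ->
  period_integral k = g (2 * pi) - g 0.
Proof.
move=> hg ck; rewrite /period_integral.
have hR t := curve_derive_Re (hg t); have hI t := curve_derive_Im (hg t).
rewrite (integral_derivative hR (curve_continuous_Re ck)).
rewrite (integral_derivative hI (curve_continuous_Im ck)).
by case: (g (2 * pi)) (g 0) => [a b] [a' b'].
Qed.

Lemma integral_bound (p : R -> R) M : continuous p -> (forall t, `|p t| <= M) ->
  `|\int[mu]_(t in period) p t|%R <= 2 * pi * M.
Proof.
move=> cp hp.
have cn : continuous (fun t => `|p t|).
  by move=> t; apply: (cvg_norm (cp t)).
apply: le_trans (le_normr_Rintegral _ (continuous_integrable cp)) _; first exact: measurable_itv.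
apply: le_trans (@le_Rintegral _ _ _ mu period _ (cst M) _ (continuous_integrable cn) _ _) _ => //.
- by apply: continuous_integrable; apply: cst_continuous.
- rewrite Rintegral_cst //.
  have h : mu period = (2 * pi)%:E.
    have := lebesgue_measure_itv `[0, 2 * pi : R] => /= ->.
    by rewrite lte_fin mulr_gt0 ?pi_gt0 // sube0.
  rewrite (_ : fine _ = 2 * pi); first by rewrite mulrC.
  exact: (congr1 fine h).
Qed.

(** Bounding the real and the imaginary parts separately costs a factor 2. *)
Lemma period_integral_bound g M : curve_continuous g -> (forall t, normc (g t) <= M) ->
  normc (period_integral g) <= 4 * pi * M.
Proof.
move=> cg hg; apply: le_trans (normc_ReIm _) _ => /=.
have h1 := @integral_bound _ M (curve_continuous_Re cg) (fun t => le_trans (normc_Re _) (hg t)).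
have h2 := @integral_bound _ M (curve_continuous_Im cg) (fun t => le_trans (normc_Im _) (hg t)).
lra.
Qed.

Lemma period_integralD g k : curve_continuous g -> curve_continuous k ->
  period_integral (fun t => g t + k t) = period_integral g + period_integral k.
Proof.
move=> cg ck; rewrite /period_integral.
have -> : (fun t => complex.Re (g t + k t)) = (fun t => complex.Re (g t) + complex.Re (k t)).
  by apply/funext => t; rewrite raddfD.
have -> : (fun t => complex.Im (g t + k t)) = (fun t => complex.Im (g t) + complex.Im (k t)).
  by apply/funext => t; rewrite raddfD.
rewrite !RintegralD //; apply: continuous_integrable;
  by [apply: curve_continuous_Re | apply: curve_continuous_Im].
Qed.

Lemma period_integralM (c : C) g : curve_continuous g ->
  period_integral (fun t => c * g t) = c * period_integral g.
Proof.
move=> cg; rewrite /period_integral; case: c => a b.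
have cR := continuous_integrable (curve_continuous_Re cg).
have cI := continuous_integrable (curve_continuous_Im cg).
have iZ (x : R) (p : R -> R) : continuous p -> mu.-integrable period (EFin \o (fun t => x * p t)).
  move=> cp; apply: continuous_integrable => t.
  by apply: cvgM; [apply: cvg_cst | apply: cp].
have -> : (fun t => complex.Re ((a +i* b) * g t)) =
    (fun t => a * complex.Re (g t) + (- b) * complex.Im (g t)).
  by apply/funext => t; case: (g t) => x y /=; rewrite mulNr.
have -> : (fun t => complex.Im ((a +i* b) * g t)) =
    (fun t => a * complex.Im (g t) + b * complex.Re (g t)).
  by apply/funext => t; case: (g t) => x y /=.
rewrite !RintegralD ?RintegralZl //; try (apply: iZ;
  by [apply: curve_continuous_Re | apply: curve_continuous_Im]).
by apply/eqP; rewrite eq_complex /= mulNr !eqxx.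
Qed.

Lemma period_integral_sum (u : nat -> R -> C) J : (forall j, curve_continuous (u j)) ->
  period_integral (fun t => \sum_(j < J) u j t) = \sum_(j < J) period_integral (u j).
Proof.
move=> cu; elim: J => [|J IH].
  rewrite big_ord0 (_ : (fun t => _) = (fun t => 0 * 0)); last first.
    by apply/funext => t; rewrite big_ord0 mul0r.
  by rewrite period_integralM ?mul0r //; apply: curve_continuous_cst.
rewrite big_ord_recr /= -IH -period_integralD //; last first.
  elim: J {IH} => [|J IH].
    rewrite (_ : (fun t => _) = (fun t => 0)); first exact: curve_continuous_cst.
    by apply/funext => t; rewrite big_ord0.
  rewrite (_ : (fun t => _) = (fun t => \sum_(j < J) u j t + u J t)); first exact: curve_continuousD.
  by apply/funext => t; rewrite big_ord_recr.
by apply: eq_period_integral => t; rewrite big_ord_recr.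
Qed.

Lemma cis2pi : cis (2 * pi) = cis 0 :> C.
Proof. by rewrite /cis mulr_natl cos2pi sin2pi cos0 sin0. Qed.

Lemma complex_C1_bounded f A : complex_C1 f A ->
  forall B : R, exists M, forall z, normc z <= B -> normc (A z) <= M.
Proof.
move=> [_ cA] B.
have : compact (`[-B, B]%classic `*` `[-B, B]%classic : set (R * R)).
  by apply: compact_setX; apply: segment_compact.
move=> /(@compact_locally_bounded R _ _ (fun p => normc (A (p.1 +i* p.2)))) [].
  move=> [x y] _; exists (normc (A (x +i* y)) + 1).
  have [d d0 hd] := cA (x +i* y) 1 ltr01.
  have d20 : 0 < d / 2 by rewrite divr_gt0.
  exists (ball x (d / 2), ball y (d / 2)); first by split; apply: nbhsx_ballx.
  move=> [x' y'] [/= h1 h2].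
  have := hd ((x' +i* y') - (x +i* y)); rewrite [x +i* y + _]addrC subrK => h.
  have := le_normcD (A (x' +i* y') - A (x +i* y)) (A (x +i* y)); rewrite subrK => h3.
  apply: le_trans h3 _; rewrite addrC lerD2l; apply: h.
  apply: le_trans (normc_ReIm _) _ => /=.
  move: h1 h2; rewrite /ball /= => h1 h2; rewrite distrC [`|y' - y|]distrC; lra.
move=> M hM; exists M => z hz; case: z hz => x y hz.
apply: (hM (x, y)); split => /=; rewrite in_itv /= -ler_norml.
  exact: le_trans (normc_Re (x +i* y)) hz.
exact: le_trans (normc_Im (x +i* y)) hz.
Qed.

End CircleIntegrals.

(** * Cauchy's formula on a circle *)

Section Cauchy.
Variable R : realType.
Local Notation C := R[i].
Local Notation mu := (@lebesgue_measure R).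
Local Notation period := `[0, 2 * pi : R]%classic.
Implicit Types (g k : R -> C) (f A : C -> C).

Lemma real_part_integral_derive (p : {additive C -> R}) (G D : R -> R -> C) (a : R) :
  (forall x, `|p x| <= normc x) -> (forall (b : R) x, p (b%:C * x) = b * p x) ->
  (forall g, curve_continuous g -> continuous (p \o g)) ->
  (forall s t, curve_derive (G^~ t) s (D s t)) ->
  (forall s, curve_continuous (G s)) ->
  (exists M, forall s t, `|s - a| < 1 -> normc (D s t) <= M) ->
  is_derive a (1 : R) (fun s => \int[mu]_(t in period) p (G s t))%R
    (\int[mu]_(t in period) p (D a t))%R.
Proof.
move=> hp pZ pc hG cG [M hM].
pose F s t := p (G s t).
have dF s t : is_derive s (1 : R) (F^~ t) (p (D s t)) := real_part_derive hp pZ (hG s t).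
have dFE s t : partial1of2 F s t = p (D s t).
  by rewrite partial1of2E; case: (dF s t).
have mB : measurable period by apply: measurable_itv.
have Ia : `]a - 1, a + 1[%classic a by rewrite /= in_itv /=; apply/andP; split; lra.
have intF x : `]a - 1, a + 1[%classic x -> mu.-integrable period (EFin \o F x).
  by move=> _; apply: continuous_integrable; apply: pc.
have derF x y : `]a - 1, a + 1[%classic x -> period y -> derivable (F^~ y) x 1.
  by move=> _ _; case: (dF x y).
have G0 (y : R) : 0 <= cst `|M| y by [].
have intG : mu.-integrable period (EFin \o cst `|M|).
  by apply: continuous_integrable; apply: cst_continuous.
have ub x y : `]a - 1, a + 1[%classic x -> period y -> `|partial1of2 F x y| <= cst `|M| y.
  rewrite /= in_itv /= => /andP[h1 h2] _; rewrite dFE.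
  apply: le_trans (hp _) _; apply: le_trans (hM x y _) (ler_norm M).
  by rewrite ltr_norml; apply/andP; split; lra.
have h1 := @derivable_under_integral R _ (measurableTypeR R) mu F period mB a _ _ Ia intF derF (cst `|M|) G0 intG ub.
have h2 := @differentiation_under_integral R _ (measurableTypeR R) mu F period mB a _ _ Ia intF derF (cst `|M|) G0 intG ub.
split; first exact: h1.
rewrite -derive1E [LHS]h2; apply: eq_Rintegral => t _; exact: dFE.
Qed.

(** Differentiation under the integral sign: the integral of D s is the derivative in s of the
    integral of G s. *)
Lemma period_integral_constant (G D : R -> R -> C) :
  (forall s t, curve_derive (G^~ t) s (D s t)) ->
  (forall s, curve_continuous (G s)) ->
  (forall a : R, exists M : R, forall s t, `|s - a| < 1 -> normc (D s t) <= M) ->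
  (forall s, period_integral (D s) = 0) ->
  forall s s', period_integral (G s) = period_integral (G s').
Proof.
move=> hG cG bD D0 s s'; rewrite /period_integral; congr (_ +i* _).
- apply: (@is_derive_0_is_cst R (fun s => \int[mu]_(t in period) complex.Re (G s t))%R) => a.
  have := @real_part_integral_derive (@complex.Re R : Rcomplex R -> R) G D a
    (@normc_Re R) _ (@curve_continuous_Re R) hG cG (bD a).
  rewrite (_ : \int[mu]_(t in period) _ = 0)%R; last by case: (D0 a).
  by apply => b [x y] /=; rewrite mul0r subr0.
- apply: (@is_derive_0_is_cst R (fun s => \int[mu]_(t in period) complex.Im (G s t))%R) => a.
  have := @real_part_integral_derive (@complex.Im R : Rcomplex R -> R) G D a
    (@normc_Im R) _ (@curve_continuous_Im R) hG cG (bD a).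
  rewrite (_ : \int[mu]_(t in period) _ = 0)%R; last by case: (D0 a).
  by apply => b [x y] /=; rewrite mul0r addr0.
Qed.

Lemma cisD (a b : R) : cis (a + b) = cis a * cis b :> C.
Proof.
by rewrite /cis cosD sinD; apply/eqP; rewrite eq_complex /= eqxx /= addrC [cos a * _]mulrC.
Qed.

Lemma cis0 : cis 0 = 1 :> C.
Proof. by rewrite /cis cos0 sin0. Qed.

Lemma cisX (a : R) m : cis a ^+ m = cis (m%:R * a) :> C.
Proof.
elim: m => [|m IH]; first by rewrite mul0r cis0.
by rewrite exprS IH -cisD; congr cis; rewrite -natr1; ring.
Qed.

Lemma cisN (a : R) : cis (- a) = (cis a)^-1 :> C.
Proof.
have h : cis (- a) * cis a = 1 :> C by rewrite -cisD addNr cis0.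
by rewrite -[LHS]mulr1 -(mulfV (x := cis a)) ?mulrA ?h ?mul1r // -normc_eq0 normc_cis oner_eq0.
Qed.

Lemma curve_derive_scale g (c : R) t D : curve_derive g (c * t) D ->
  curve_derive (fun s => g (c * s)) t (c%:C * D).
Proof.
move=> hg e e0; pose B := `|c| + 1.
have B0 : 0 < B by rewrite /B ltr_wpDl.
have [d d0 hd] := hg (e / B) (divr_gt0 e0 B0).
exists (d / B) => [|h]; first by rewrite divr_gt0.
rewrite ler_pdivlMr // => hh.
have hc : `|c| * `|h| <= `|h| * B by rewrite mulrC ler_wpM2l // /B; lra.
have := hd (c * h); rewrite normrM => /(_ (le_trans hc hh)).
rewrite -mulrDr rmorphM /= mulrA [h%:C * _]mulrC => h1; apply: le_trans h1 _.
apply: le_trans (_ : e / B * (`|h| * B) <= _).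
  by rewrite ler_wpM2l // divr_ge0 // ltW.
by have -> : e / B * (`|h| * B) = e * `|h| by field; lra.
Qed.

Section Circle.
Variables (r : R) (zeta : C).
Hypotheses (r0 : 0 < r) (zr : normc zeta < r).

Lemma normc_circle t : normc (r%:C * cis t) = r.
Proof. by rewrite normcM normc_real normc_cis mulr1 gtr0_norm. Qed.

Lemma circle_gap t : r - normc zeta <= normc (r%:C * cis t - zeta).
Proof. by have := le_normcD (r%:C * cis t - zeta) zeta; rewrite subrK normc_circle; lra. Qed.

Lemma circle_neq t : r%:C * cis t - zeta != 0.
Proof. by rewrite -normc_eq0 gt_eqF //; apply: lt_le_trans (circle_gap t); rewrite subr_gt0. Qed.

(** With x = r e^(it), the form dx / (x - zeta) is i times this function times dt. *)
Definition cauchy_kernel t : C := r%:C * cis t / (r%:C * cis t - zeta).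

Lemma curve_continuous_circle : curve_continuous (fun t => r%:C * cis t).
Proof.
by apply: curve_continuousM; [apply: curve_continuous_cst | apply: curve_continuous_cis].
Qed.

Lemma curve_continuous_cauchy_kernel : curve_continuous cauchy_kernel.
Proof.
apply: curve_continuousM curve_continuous_circle _.
apply: curve_continuousV circle_neq _.
by apply: curve_continuousD curve_continuous_circle _; apply: curve_continuous_cst.
Qed.

(** The primitive of a nonconstant exponential is periodic. *)
Lemma period_integral_cis m : (0 < m)%N ->
  period_integral (fun t => cis (- m%:R * t)) = 0 :> C.
Proof.
move=> m0.
have mn0 : (m%:R : R) != 0 by rewrite pnatr_eq0 -lt0n.
pose c : C := ((- m%:R)%:C * 'i%C)^-1.
have i0 : 'i%C != 0 :> C by rewrite -normc_eq0 normc_i oner_eq0.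
have c0 : (- m%:R)%:C * 'i%C != 0 :> C.
  rewrite mulf_eq0 negb_or i0 andbT -normc_eq0 normc_real normr_eq0 oppr_eq0 //.
rewrite (@period_integral_derivative _ (fun t => c * cis (- m%:R * t))).
- rewrite mulr0 mulNr cisN -cisX cis2pi cis0 expr1n invr1 subrr //.
- move=> t; rewrite (_ : cis _ = c * ((- m%:R)%:C * ('i%C * cis (- m%:R * t)))).
    by apply: curve_deriveM; apply: curve_derive_scale; apply: curve_derive_cis.
  by rewrite ![in RHS]mulrA -[c * _ * _]mulrA mulVf // mul1r.
- apply: (@curve_derive_continuous _ _ (fun t => (- m%:R)%:C * ('i%C * cis (- m%:R * t)))) => t.
  by apply: curve_derive_scale; apply: curve_derive_cis.
Qed.

Lemma period_integral_cst (c : C) : period_integral (fun=> c) = (2 * pi)%:C * c.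
Proof.
rewrite (@period_integral_derivative _ (fun t => 0 + t%:C * c)).
- by rewrite /= !add0r mul0r subr0.
- by move=> t; apply: curve_derive_affine.
- exact: curve_continuous_cst.
Qed.

(** The expansion in powers of zeta / x is stopped at order N, so that no sum is exchanged with an
    integral. *)
Lemma cauchy_kernel_expansion N t : cauchy_kernel t =
  \sum_(m < N) (zeta / r%:C) ^+ m * cis (- m%:R * t) +
  (zeta / r%:C) ^+ N * (cis (- N%:R * t) * cauchy_kernel t).
Proof.
have rC0 : r%:C != 0 by rewrite -normc_eq0 normc_real normr_eq0 gt_eqF.
have c0 : cis t != 0 :> C by rewrite -normc_eq0 normc_cis oner_eq0.
have eX m : cis (- m%:R * t) = (cis t)^-1 ^+ m :> C.
  by rewrite mulNr cisN -cisX exprVn.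
elim: N => [|N IH]; first by rewrite big_ord0 eX !expr0 !mul1r add0r.
rewrite big_ord_recr /= {1}IH -addrA; congr (_ + _).
rewrite !eX !exprS; set a := (_ / _) ^+ N; set b := _ ^+ N.
rewrite /cauchy_kernel; have hz := circle_neq t.
by field; rewrite rC0 c0 hz.
Qed.

(** In the expansion of the kernel, only the constant term has a nonzero mean, and the remainder
    decreases geometrically with N. *)
Lemma period_integral_cauchy_kernel : period_integral cauchy_kernel = (2 * pi)%:C.
Proof.
pose q := normc zeta / r; have q1 : q < 1 by rewrite ltr_pdivrMr // mul1r.
have q0 : 0 <= q by rewrite divr_ge0 ?normc_ge0 // ltW.
pose B := 4 * pi * (r / (r - normc zeta)).
have key N : normc (period_integral cauchy_kernel - (2 * pi)%:C) <= q ^+ N.+1 * B.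
  have ck := curve_continuous_cauchy_kernel.
  have cc m : curve_continuous (fun t => cis (- m%:R * t) : C).
    apply: (@curve_derive_continuous _ _ (fun t => (- m%:R)%:C * ('i%C * cis (- m%:R * t)))) => t.
    by apply: curve_derive_scale; apply: curve_derive_cis.
  have cc' m : curve_continuous (fun t => (zeta / r%:C) ^+ m * cis (- m%:R * t) : C).
    by apply: curve_continuousM => //; apply: curve_continuous_cst.
  have cR : curve_continuous (fun t => cis (- N.+1%:R * t) * cauchy_kernel t).
    exact: curve_continuousM.
  rewrite (eq_period_integral (cauchy_kernel_expansion N.+1)).
  rewrite period_integralD; last 2 first.
  - elim: (N.+1) => [|J IH].
      rewrite (_ : (fun t => _) = (fun t => 0)); first exact: curve_continuous_cst.
      by apply/funext => t; rewrite big_ord0.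
    rewrite (_ : (fun t => _) = (fun t => \sum_(j < J) (zeta / r%:C) ^+ j * cis (- j%:R * t) +
       (zeta / r%:C) ^+ J * cis (- J%:R * t))); first exact: curve_continuousD.
    by apply/funext => t; rewrite big_ord_recr.
  - by apply: curve_continuousM => //; apply: curve_continuous_cst.
  rewrite (period_integral_sum _ cc') big_ord_recl big1 => [|m _]; last first.
    by rewrite period_integralM // period_integral_cis ?mulr0.
  rewrite addr0 period_integralM // expr0 mul1r period_integralM //.
  rewrite (_ : (fun t => cis (- (ord0 : 'I_N.+1)%:R * t)) = (fun=> 1)); last first.
    by apply/funext => t; rewrite oppr0 mul0r cis0.
  rewrite period_integral_cst mulr1 addrC addKr normcM normcX normcM normcV normc_real.
  rewrite gtr0_norm // -/q ler_wpM2l ?exprn_ge0 //.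
  apply: period_integral_bound => // t.
  rewrite normcM normc_cis mul1r normcM normc_circle ler_wpM2l ?(ltW r0) //.
  by apply: normc_inv_gap; rewrite ?normc_circle.
apply/eqP; rewrite -subr_eq0 -normc_eq0 eq_le normc_ge0 andbT.
have : (fun N => q ^+ N.+1 * B) @ \oo --> 0 * B.
  by apply: cvgM; [rewrite (cvg_shiftS (fun N => q ^+ N)); apply: cvg_expr; rewrite ger0_norm | apply: cvg_cst].
by rewrite mul0r => h; apply: (cvgr_to_ge h); apply: nearW => N; apply: key.
Qed.

End Circle.
End Cauchy.

Section CauchyFormula.
Variable R : realType.
Local Notation C := R[i].

Lemma curve_continuous_sum (u : nat -> R -> C) J : (forall j, curve_continuous (u j)) ->
  curve_continuous (fun t => \sum_(j < J) u j t).
Proof.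
move=> cu; elim: J => [|J IH].
  rewrite (_ : (fun t => _) = (fun t => 0)); first exact: curve_continuous_cst.
  by apply/funext => t; rewrite big_ord0.
rewrite (_ : (fun t => _) = (fun t => \sum_(j < J) u j t + u J t)); first exact: curve_continuousD.
by apply/funext => t; rewrite big_ord_recr.
Qed.

Lemma power_series_circle_continuous (f : C -> C) (r : R) :
  (forall x, power_series_at f x) -> curve_continuous (fun t => f (r%:C * cis t)).
Proof.
move=> /power_series_C1 [A hA].
apply: (@curve_derive_continuous _ _ (fun t => A (r%:C * cis t) * (r%:C * ('i%C * cis t)))) => t.
have h : curve_derive (fun s => r%:C * cis s) t (r%:C * ('i%C * cis t)).
  by apply: curve_deriveM; apply: curve_derive_cis.
exact: (curve_derive_comp hA h).
Qed.

(** The circle is contracted to zeta by gam s t = zeta + s (x - zeta), with x = r e^(it), while the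
    kernel x / (x - zeta) is kept. The derivative in s of the integrand is f'(gam s t) x, which is,
    for s <> 0, the derivative in t of f (gam s t) / (i s); its integral over a period vanishes.
    At s = 0 only f (zeta) times the integral of the kernel is left. *)
Lemma cauchy_circle (f : C -> C) (r : R) (zeta : C) : 0 < r -> normc zeta < r ->
  (forall x, power_series_at f x) ->
  period_integral (fun t => f (r%:C * cis t) * cauchy_kernel r zeta t) = (2 * pi)%:C * f zeta.
Proof.
move=> r0 zr hf; have [A hA] := power_series_C1 hf.
pose gam (s t : R) := zeta + s%:C * (r%:C * cis t - zeta).
pose G s t := cauchy_kernel r zeta t * f (gam s t).
pose D s t := A (gam s t) * (r%:C * cis t).
have ck := curve_continuous_cauchy_kernel r0 zr.
have dgam s t : curve_derive (gam s) t (s%:C * (r%:C * ('i%C * cis t))).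
  apply: curve_deriveD; apply: curve_deriveM.
  rewrite (_ : (fun s => _) = (fun s => - zeta + r%:C * cis s)); last first.
    by apply/funext => u; rewrite addrC.
  by apply: curve_deriveD; apply: curve_deriveM; apply: curve_derive_cis.
have cgam s : curve_continuous (gam s) := curve_derive_continuous (dgam s).
have cG s : curve_continuous (G s).
  by apply: curve_continuousM => //; apply: (curve_derive_continuous (fun t => curve_derive_comp hA (dgam s t))).
have cD s : curve_continuous (D s).
  apply: curve_continuousM; last exact: curve_continuous_circle.
  by apply: (curve_continuous_comp hA.2).
have hG s t : curve_derive (G^~ t) s (D s t).
  rewrite (_ : D s t = cauchy_kernel r zeta t * (A (gam s t) * (r%:C * cis t - zeta))).
    apply: curve_deriveM; apply: (@curve_derive_comp _ f A (gam^~ t)) => //.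
    exact: curve_derive_affine.
  by rewrite /D /cauchy_kernel; field; apply: circle_neq.
have bD (a : R) : exists M, forall s t, `|s - a| < 1 -> normc (D s t) <= M.
  have [M hM] := complex_C1_bounded hA (normc zeta + (`|a| + 1) * (r + normc zeta)).
  exists (`|M| * r) => s t sa; rewrite normcM normc_circle // ler_wpM2r ?(ltW r0) //.
  apply: le_trans (hM _ _) (ler_norm M).
  apply: le_trans (le_normcD _ _) _; rewrite lerD2l normcM normc_real.
  apply: ler_pM; rewrite ?normc_ge0 //.
    by have := ler_normD (s - a) a; rewrite subrK; lra.
  by apply: le_trans (normcB _ _) _; rewrite normc_circle.
have i0 : 'i%C != 0 :> C by rewrite -normc_eq0 normc_i oner_eq0.
have D0 s : period_integral (D s) = 0.
  have [->|s0] := eqVneq s 0.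
    rewrite (@period_integral_derivative _ (fun t => A zeta * (r%:C / 'i%C) * cis t)).
    - by rewrite cis2pi subrr.
    - move=> t; rewrite (_ : D 0 t = A zeta * (r%:C / 'i%C) * ('i%C * cis t)).
        by apply: curve_deriveM; apply: curve_derive_cis.
      by rewrite /D /gam mul0r addr0; field.
    - exact: cD.
  have sC0 : s%:C != 0 by rewrite -normc_eq0 normc_real normr_eq0.
  rewrite (@period_integral_derivative _ (fun t => (s%:C * 'i%C)^-1 * f (gam s t))).
  - by rewrite /gam cis2pi subrr.
  - move=> t; rewrite (_ : D s t = (s%:C * 'i%C)^-1 * (A (gam s t) * (s%:C * (r%:C * ('i%C * cis t))))).
      by apply: curve_deriveM; apply: (curve_derive_comp hA (dgam s t)).
    by rewrite /D; field; rewrite i0 sC0.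
  - exact: cD.
have := period_integral_constant hG cG bD D0 1 0.
rewrite /G /gam => e; transitivity (period_integral (G 0)).
  rewrite -[RHS]e; apply: eq_period_integral => t.
  by rewrite mul1r [zeta + _]addrC subrK mulrC.
rewrite (@eq_period_integral _ _ (fun t => f zeta * cauchy_kernel r zeta t)); last first.
  by move=> t; rewrite /G /gam mul0r addr0 mulrC.
by rewrite period_integralM // period_integral_cauchy_kernel // mulrC.
Qed.

(** The series converges uniformly on the circle, because the nodes stay at distance at least
    r - rho from it. *)
Lemma cauchy_circle_sum (r rho : R) (c : nat -> C) (M B : R) (f : nat -> C -> C)
    (zeta : nat -> C) (G : C -> C) :
  0 < r -> rho < r -> 0 <= B -> summable_by c M ->
  (forall j x, power_series_at (f j) x) ->
  (forall j x, normc x <= r -> normc (f j x) <= B) ->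
  (forall j, normc (zeta j) <= rho) ->
  (forall x, normc x = r -> G x = csum (fun j => c j * (f j x / (x - zeta j)))) ->
  circle_integral r G = 2%:R * (pi : R)%:C * 'i%C * csum (fun j => c j * f j (zeta j)).
Proof.
move=> r0 rr B0 hc hf hB hz hG.
have zr j : normc (zeta j) < r by apply: le_lt_trans (hz j) rr.
pose u j t := 'i%C * c j * (f j (r%:C * cis t) * cauchy_kernel r (zeta j) t).
have cu j : curve_continuous (u j).
  apply: curve_continuousM; first exact: curve_continuous_cst.
  apply: curve_continuousM; first exact: power_series_circle_continuous.
  exact: curve_continuous_cauchy_kernel.
pose Q := B * (r / (r - rho)).
have Q0 : 0 <= Q by rewrite mulr_ge0 // divr_ge0 ?ltW // subr_gt0.
have hk j t : normc (f j (r%:C * cis t) * cauchy_kernel r (zeta j) t) <= Q.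
  rewrite normcM; apply: ler_pM; rewrite ?normc_ge0 //.
    by apply: hB; rewrite normc_circle.
  rewrite normcM normc_circle // ler_wpM2l ?(ltW r0) //.
  by apply: normc_inv_gap; rewrite ?normc_circle.
have hu j t : normc (u j t) <= normc (c j) * Q.
  by rewrite normcM normcM normc_i mul1r ler_wpM2l ?normc_ge0.
pose h t := G (r%:C * cis t) * ('i%C * r%:C * cis t).
have hE t : h t = csum (fun j => u j t).
  rewrite /h hG ?normc_circle //.
  have sm : summable_by (fun j => c j * (f j (r%:C * cis t) / (r%:C * cis t - zeta j)))
      (M * (B * (r - rho)^-1)).
    apply: (@summable_byM _ c (fun j => f j (r%:C * cis t) / (r%:C * cis t - zeta j))) => //.
      by rewrite mulr_ge0 // invr_ge0 subr_ge0 ltW.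
    move=> j; rewrite normcM; apply: ler_pM; rewrite ?normc_ge0 //.
      by apply: hB; rewrite normc_circle.
    by apply: normc_inv_gap; rewrite ?normc_circle.
  rewrite mulrC -(csum_mull _ sm); apply: eq_csum => j.
  by rewrite /u /cauchy_kernel; ring.
have sc : summable_by (fun j => (normc (c j) * Q)%:C) (M * Q).
  move=> N; rewrite (eq_bigr (fun j : 'I_N => normc (c j) * Q)); last first.
    by move=> j _; rewrite normc_real ger0_norm // mulr_ge0 ?normc_ge0.
  by rewrite -mulr_suml; apply: ler_wpM2r => //; apply: hc.
have su t : summable_by (fun j => u j t) (M * Q).
  move=> N; apply: le_trans (sc N); apply: ler_sum => j _.
  by rewrite normc_real ger0_norm ?hu // mulr_ge0 ?normc_ge0.
have unif e : 0 < e -> exists J, forall N t, (J <= N)%N ->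
    normc (h t - \sum_(j < N) u j t) <= e.
  move=> e0; have [J hJ] := summable_tail sc e0; exists J => N t JN.
  rewrite hE; apply: (csum_tail (su t)) => N' NN'.
  apply: le_trans (hJ N' (leq_trans JN NN')).
  rewrite [leRHS](big_cat_nat _ (n := N)) // ler_wpDl ?sumr_ge0 //.
    by move=> i _; apply: normc_ge0.
  by apply: ler_sum => j _; rewrite normc_real ger0_norm ?hu // mulr_ge0 ?normc_ge0.
have ch : curve_continuous h.
  move=> t e e0; have e30 : 0 < e / 3 by rewrite divr_gt0.
  have [J hJ] := unif _ e30.
  have [d d0 hd] := @curve_continuous_sum u J cu t _ e30.
  exists d => // s /hd h1; have h2 := hJ J t (leqnn J); have h3 := hJ J (t + s) (leqnn J).
  have -> : h (t + s) - h t = (h (t + s) - \sum_(j < J) u j (t + s))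
     + (\sum_(j < J) u j (t + s) - \sum_(j < J) u j t) - (h t - \sum_(j < J) u j t) by ring.
  apply: le_trans (normcB _ _) _; apply: le_trans (lerD (le_normcD _ _) (lexx _)) _.
  lra.
have lim : clim (fun N => \sum_(j < N) period_integral (u j)) (period_integral h).
  move=> e e0; have p0 := pi_gt0 R.
  have e40 : 0 < e / (4 * pi) by rewrite divr_gt0 // mulr_gt0.
  have [J hJ] := unif _ e40; exists J => N JN.
  rewrite -period_integral_sum //.
  have -> : period_integral (fun t => \sum_(j < N) u j t) - period_integral h =
     - period_integral (fun t => h t + -1 * \sum_(j < N) u j t).
    have cS : curve_continuous (fun t => \sum_(j < N) u j t) by apply: curve_continuous_sum.
    have cS' : curve_continuous (fun t => -1 * \sum_(j < N) u j t).
      by apply: curve_continuousM => //; apply: curve_continuous_cst.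
    by rewrite period_integralD // period_integralM //; ring.
  rewrite normcN; have -> : e = 4 * pi * (e / (4 * pi)) by field; lra.
  apply: period_integral_bound => [|t].
    apply: curve_continuousD => //; apply: curve_continuousM; first exact: curve_continuous_cst.
    exact: curve_continuous_sum.
  by rewrite mulN1r; apply: hJ.
have -> : circle_integral r G = period_integral h by [].
transitivity (csum (fun j => period_integral (u j))); first by apply/esym; exact: (csum_eq lim).
have sf : summable_by (fun j => c j * f j (zeta j)) (M * B).
  by apply: summable_byM => // j; apply: hB; apply: ltW.
rewrite -(csum_mull _ sf); apply: eq_csum => j.
rewrite /u period_integralM; last first.
  apply: curve_continuousM; first exact: power_series_circle_continuous.
  exact: curve_continuous_cauchy_kernel.
rewrite cauchy_circle // rmorphM /= rmorph_nat; ring.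
Qed.

(** * Cauchy's formula on a torus *)

Definition replace_coord n (w : 'rV[C]_n) (v : 'I_n) (x : C) : 'rV[C]_n :=
  \row_j (if j == v then x else w 0 j).

(** This is what the iterated formula needs of an entire function. Unlike the existence of an
    expansion in all variables, it is inherited at once when a coordinate is fixed, without any
    rearrangement of series. *)
Definition sliced_analytic n (phi : 'rV[C]_n -> C) : Prop :=
  (forall w v x, power_series_at (fun y => phi (replace_coord w v y)) x) /\
  (forall B : R, exists M : R, forall z : 'rV[C]_n, (forall v, normc (z 0 v) <= B) -> normc (phi z) <= M).

Lemma row_mx_ord0 p (x : C) (z : 'rV[C]_p) :
  row_mx (const_mx x : 'rV_1) z 0 (ord0 : 'I_(1 + p)) = x.
Proof.
have -> : (ord0 : 'I_(1 + p)) = lshift p ord0 by apply: val_inj.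
by rewrite row_mxEl mxE.
Qed.

Lemma row_mx_lift p (x : C) (z : 'rV[C]_p) v :
  row_mx (const_mx x : 'rV_1) z 0 (lift (ord0 : 'I_(1 + p)) v) = z 0 v.
Proof.
have -> : lift (ord0 : 'I_(1 + p)) v = rshift 1 v by apply: val_inj.
by rewrite row_mxEr.
Qed.

Lemma row_mx_replace_lift p (x y : C) (w : 'rV[C]_p) v :
  row_mx (const_mx x : 'rV_1) (replace_coord w v y) =
  replace_coord (row_mx (const_mx x : 'rV_1) w) (lift (ord0 : 'I_(1 + p)) v) y.
Proof.
apply/rowP => j; rewrite [RHS]mxE.
case: (unliftP ord0 j) => [k|] ->; last by rewrite !row_mx_ord0.
by rewrite !row_mx_lift mxE (inj_eq lift_inj).
Qed.

(** Induction on n. When the first coordinate x is fixed on its circle, the kernels of the other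
    coordinates come with the weights c_j / (x - zeta_(j,0)), which are again summable; this is
    why the statement is about a whole series of kernels: each step exchanges the sum with a single
    circle integral. *)
Lemma torus_cauchy (r rho : R) : 0 < r -> 0 <= rho -> rho < r ->
  forall n (c : nat -> C) (M : R) (zeta : nat -> 'rV[C]_n) (phi F : 'rV[C]_n -> C),
  summable_by c M -> sliced_analytic phi ->
  (forall j v, normc (zeta j 0 v) <= rho) ->
  (forall z : 'rV[C]_n, (forall v, normc (z 0 v) = r) ->
    F z = phi z * csum (fun j => c j * \prod_v (z 0 v - zeta j 0 v)^-1)) ->
  torus_integral r F = (2%:R * (pi : R)%:C * 'i%C) ^+ n * csum (fun j => c j * phi (zeta j)).
Proof.
move=> r0 rho0 rr; elim=> [|p IH] c M zeta phi F hc [ps bd] hz hF.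
  have [B hB] := bd 0; have hB' : normc (phi 0) <= B by apply: hB => -[].
  rewrite /= hF; last by case.
  rewrite expr0 mul1r -(csum_mull _ (M := M)).
    apply: eq_csum => j; rewrite big_ord0 mulr1 mulrC; congr (_ * phi _).
    by apply/rowP => -[].
  by move=> N; under eq_bigr do rewrite big_ord0 mulr1.
pose zeta' j : 'rV[C]_p := \row_v zeta j 0 (lift ord0 v).
have zetaE j x : row_mx (const_mx x : 'rV_1) (zeta' j) = replace_coord (zeta j) ord0 x.
  apply/rowP => k; rewrite [RHS]mxE.
  case: (unliftP ord0 k) => [v|] ->; last by rewrite eqxx row_mx_ord0.
  by rewrite row_mx_lift mxE.
have [B hB] := bd r.
have B0 : 0 <= B.
  apply: le_trans (normc_ge0 (phi 0)) (hB _ _) => v.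
  by rewrite mxE normc0 ltW.
have inner x : normc x = r ->
    torus_integral r (fun z => F (row_mx (const_mx x : 'rV_1) z)) =
    (2%:R * (pi : R)%:C * 'i%C) ^+ p *
    csum (fun j => c j / (x - zeta j 0 ord0) * phi (row_mx (const_mx x : 'rV_1) (zeta' j))).
  move=> xr.
  apply: (IH _ (M * (r - rho)^-1) _ (fun z => phi (row_mx (const_mx x : 'rV_1) z))).
  - apply: summable_byM => //; first by rewrite invr_ge0 subr_ge0 ltW.
    by move=> j; apply: normc_inv_gap; rewrite ?xr.
  - split=> [w v y|b].
      under eq_fun do rewrite row_mx_replace_lift.
      exact: ps.
    have [b' hb'] := bd (Num.max r b); exists b' => z hz'; apply: hb' => v.
    case: (unliftP ord0 v) => [k|] ->; rewrite le_max.
      by rewrite row_mx_lift hz' orbT.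
    by rewrite row_mx_ord0 xr lexx.
  - by move=> j v; rewrite mxE.
  - move=> z hzr; rewrite hF; last first.
      move=> v; case: (unliftP ord0 v) => [k|] ->; first by rewrite row_mx_lift.
      by rewrite row_mx_ord0.
    congr (_ * _); apply: eq_csum => j; rewrite big_ord_recl row_mx_ord0 mulrA.
    by congr (_ * _); apply: eq_bigr => v _; rewrite row_mx_lift mxE.
rewrite [torus_integral _ _]/=.
rewrite (@cauchy_circle_sum r rho (fun j => (2%:R * (pi : R)%:C * 'i%C) ^+ p * c j)
  (normc ((2%:R * (pi : R)%:C * 'i%C) ^+ p) * M) B
  (fun j x => phi (row_mx (const_mx x : 'rV_1) (zeta' j))) (fun j => zeta j 0 ord0)) //.
- rewrite exprS -[RHS]mulrA; congr (2%:R * _ * _ * _).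
  rewrite -(csum_mull _ (M := M * B)).
    apply: eq_csum => j; rewrite mulrA; congr (_ * phi _).
    by rewrite zetaE; apply/rowP => k; rewrite mxE; case: eqP => // ->.
  by apply: summable_byM => // j; apply: hB => v; apply: le_trans (hz j v) (ltW rr).
- move=> N; under eq_bigr do rewrite normcM.
  by rewrite -mulr_sumr; apply: ler_wpM2l; [apply: normc_ge0 | apply: hc].
- move=> j x; under eq_fun do rewrite zetaE.
  exact: ps.
- move=> j x xr; apply: hB => v; rewrite zetaE mxE; case: eqP => // _.
  exact: le_trans (hz j v) (ltW rr).
- move=> x xr; rewrite inner //.
  have h : summable_by (fun j => c j * ((x - zeta j 0 ord0)^-1 *
      phi (row_mx (const_mx x : 'rV_1) (zeta' j)))) (M * ((r - rho)^-1 * B)).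
    apply: (@summable_byM _ c (fun j => (x - zeta j 0 ord0)^-1 *
      phi (row_mx (const_mx x : 'rV_1) (zeta' j)))) => //.
      by rewrite mulr_ge0 // invr_ge0 subr_ge0 ltW.
    move=> j; rewrite normcM; apply: ler_pM; rewrite ?normc_ge0 //.
      by apply: normc_inv_gap; rewrite ?xr.
    apply: hB => v; rewrite zetaE mxE; case: eqP => [_|_]; first by rewrite xr.
    exact: le_trans (hz j v) (ltW rr).
  rewrite -(csum_mull _ (M := M * ((r - rho)^-1 * B))); first by apply: eq_csum => j; ring.
  by move=> N; apply: le_trans (h N); apply: ler_sum => j _; rewrite mulrA.
Qed.

End CauchyFormula.

(** * Compact subsets of C^n *)

Section Topology.
Variable R : realType.
Local Notation C := R[i].

Lemma near_polydisc n (w : 'rV[C]_n) (d : R) : 0 < d ->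
  \forall z \near w, forall v, normc ((z : 'rV[C]_n) 0 v - w 0 v) < d.
Proof.
move=> d0; apply/nbhs_ballP; exists d%:C; first by rewrite /= ltcR.
move=> z [_ h] v; have := h 0 v.
by rewrite -ball_normE /= normr_normc ltcR normc_distC.
Qed.

Lemma compact_square (B : R) :
  compact [set x : C | `|complex.Re x| <= B /\ `|complex.Im x| <= B].
Proof.
have -> : [set x : C | `|complex.Re x| <= B /\ `|complex.Im x| <= B] =
    (fun p : R * R => p.1 +i* p.2) @` (`[-B, B]%classic `*` `[-B, B]%classic).
  apply/seteqP; split=> [[x y] /= [h1 h2]|_ [[x y] [/= h1 h2] <-]] /=.
    by exists (x, y) => //=; rewrite !in_itv /= -!ler_norml.
  by move: h1 h2; rewrite !in_itv /= -!ler_norml.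
apply: continuous_compact; last by apply: compact_setX; apply: segment_compact.
apply: continuous_subspaceT => -[x y]; apply/cvgrPdist_lt => _ /ltr0_complex [e e0 ->].
have e20 : 0 < e / 2 by rewrite divr_gt0.
exists (ball x (e / 2), ball y (e / 2)); first by split; apply: nbhsx_ballx.
move=> [x' y'] [/= h1 h2]; rewrite normr_normc ltcR.
apply: le_lt_trans (normc_ReIm _) _ => /=.
by move: h1 h2; rewrite /ball /=; lra.
Qed.

Lemma compact_polydisc n (B : R) :
  exists2 Q : set 'rV[C]_n, compact Q & forall z : 'rV[C]_n, (forall v, normc (z 0 v) <= B) -> Q z.
Proof.
exists [set z : 'rV[C]_n | forall v : 'I_n, [set x : C | `|complex.Re x| <= B /\ `|complex.Im x| <= B] (z ord0 v)].
  exact: (@rV_compact C n (fun=> [set x : C | `|complex.Re x| <= B /\ `|complex.Im x| <= B])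
     (fun=> @compact_square B)).
move=> z hz v /=; split.
  exact: le_trans (normc_Re _) (hz v).
exact: le_trans (normc_Im _) (hz v).
Qed.

Lemma compact_coord_bounded n (K : set 'rV[C]_n) : compact K ->
  exists2 B : R, 0 < B & forall z : 'rV[C]_n, K z -> forall v, normc (z 0 v) <= B.
Proof.
move=> cK.
have : exists M : R, forall z : 'rV[C]_n, K z -> \sum_v normc (z 0 v) <= M.
  apply: compact_locally_bounded => // w Kw.
  exists (\sum_v (normc (w 0 v) + 1)).
  have := near_polydisc w (@ltr01 R); apply: filterS => z hz.
  apply: ler_sum => v _; have := le_normcD (z 0 v - w 0 v) (w 0 v); rewrite subrK.
  have := hz v; lra.
move=> [M hM]; exists (`|M| + 1); first by rewrite ltr_wpDl.
move=> z Kz v; apply: le_trans (_ : M <= _); last by have := ler_norm M; lra.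
apply: le_trans (hM z Kz); rewrite (bigD1 v) //= lerDl sumr_ge0 // => i _.
exact: normc_ge0.
Qed.

End Topology.

(** * The geometric series along the enumeration of multi-indices *)

Section Enumeration.
Variable n : nat.
Hypothesis n_gt0 : (0 < n)%N.
Local Notation kidx := (kidx n).

(** Sums of monomials over boxes factor into sums over each coordinate. *)
Definition box_index D (g : {ffun 'I_n -> 'I_D.+1}) : mindex n := [ffun v => g v : nat].

Lemma box_index_inj D : injective (@box_index D).
Proof.
move=> g g' /ffunP h; apply/ffunP => v; apply/val_inj.
by have := h v; rewrite !ffunE.
Qed.

Lemma mdeg_ge (k : mindex n) v : (k v <= mdeg k)%N.
Proof. by rewrite /mdeg (bigD1 v) //= leq_addr. Qed.

Lemma mdeg_kidx_mono i j : (i <= j)%N -> (mdeg (kidx i) <= mdeg (kidx j))%N.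
Proof.
by move=> /(kidx_glex n_gt0) /orP[/ltnW //|/andP[/eqP ->]].
Qed.

(** The set S is independent of F: the geometric series and its majorant are compared on the same
    set. *)
Lemma kidx_sum_box N D : (forall i v, (i < N)%N -> (kidx i v <= D)%N) ->
  exists S : {set {ffun 'I_n -> 'I_D.+1}}, forall (V : zmodType) (F : mindex n -> V),
    \sum_(i < N) F (kidx i) = \sum_(g in S) F (box_index g).
Proof.
move=> hD.
pose h (i : 'I_N) : {ffun 'I_n -> 'I_D.+1} := [ffun v => inord (kidx i v)].
have hE i : box_index (h i) = kidx i.
  by apply/ffunP => v; rewrite !ffunE inordK // ltnS hD.
have hinj : injective h.
  move=> i j /(congr1 (@box_index D)); rewrite !hE => /(kidx_inj n_gt0) e.
  exact: val_inj.
exists (h @: [set: 'I_N]) => V F.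
rewrite big_imset /=; last by move=> i j _ _; apply: hinj.
by apply: eq_big => [i|i _]; [rewrite in_setT | rewrite hE].
Qed.

Lemma box_sub_kidx D : exists N, forall g : {ffun 'I_n -> 'I_D.+1},
  exists2 i, (i < N)%N & kidx i = box_index g.
Proof.
have /choice [pos hpos] := fun g : {ffun 'I_n -> 'I_D.+1} => kidx_surj n_gt0 (box_index g).
exists (\max_g pos g).+1 => g; exists (pos g) => //.
by rewrite ltnS leq_bigmax.
Qed.

Section Weights.
Variable R : realType.
Local Notation C := R[i].

Lemma box_sum_prod (V : comPzRingType) D (a : 'I_n -> V) :
  \sum_(g : {ffun 'I_n -> 'I_D.+1}) \prod_v a v ^+ box_index g v =
  \prod_v \sum_(d < D.+1) a v ^+ d.
Proof.
rewrite bigA_distr_bigA; apply: eq_bigr => g _; apply: eq_bigr => v _.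
by rewrite ffunE.
Qed.

(** The geometric series at the point (1/2, ..., 1/2), which dominates it on the closed polydisc
    of radius 1/2; its sum is 2^n. *)
Definition half_sum N : R := \sum_(i < N) 2^-1 ^+ mdeg (kidx i).

Lemma half_mdeg (k : mindex n) : (2^-1 : R) ^+ mdeg k = \prod_(v < n) 2^-1 ^+ k v.
Proof. by rewrite /mdeg; elim/big_ind2: _ => // a b c d <- <-; rewrite exprD. Qed.

Lemma half_sum_box D : \sum_(g : {ffun 'I_n -> 'I_D.+1}) (2^-1 : R) ^+ mdeg (box_index g) =
  (\sum_(d < D.+1) 2^-1 ^+ d) ^+ n.
Proof.
under eq_bigr do rewrite half_mdeg.
by rewrite (box_sum_prod D (fun=> 2^-1)) prodr_const card_ord.
Qed.

Lemma ler_sum_set (T : finType) (S : {set T}) (F : T -> R) : (forall g, 0 <= F g) ->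
  \sum_(g in S) F g <= \sum_g F g.
Proof.
by move=> F0; rewrite big_mkcond; apply: ler_sum => g _; case: ifP.
Qed.

Lemma kidx_bounded N : exists D, forall i v, (i < N)%N -> (kidx i v <= D)%N.
Proof.
exists (mdeg (kidx N)) => i v /ltnW iN.
exact: leq_trans (mdeg_ge _ v) (mdeg_kidx_mono iN).
Qed.

Lemma half_sum_le N : half_sum N <= 2 ^+ n.
Proof.
have [D /kidx_sum_box [S hS]] := kidx_bounded N.
rewrite /half_sum (hS _ (fun k => 2^-1 ^+ mdeg k)).
apply: le_trans (ler_sum_set _ _) _ => [g|]; first exact: exprn_ge0.
rewrite half_sum_box lerXn2r ?nnegrE ?sumr_ge0 //; exact: sum_half.
Qed.

Lemma half_sum_lim (e : R) : 0 < e -> exists N, forall N', (N <= N')%N -> 2 ^+ n - half_sum N' <= e.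
Proof.
move=> e0.
have : (fun D => (2 - 2 * 2^-1 ^+ D.+1) ^+ n : R) @ \oo --> (2 - 2 * 0 : R) ^+ n.
  apply: (@cvg_comp _ _ _ (fun D => 2 - 2 * 2^-1 ^+ D.+1 : R) (fun x : R => x ^+ n) _ (nbhs (2 - 2 * 0 : R))); last exact: exprn_continuous.
  apply: cvgB; first exact: cvg_cst.
  apply: cvgM; first exact: cvg_cst.
  rewrite (cvg_shiftS (fun D => 2^-1 ^+ D : R)); apply: cvg_expr.
  by rewrite ger0_norm //; lra.
rewrite mulr0 subr0 => /cvgrPdist_le /(_ e e0) [D _ /(_ D (leqnn D)) /= hD].
have [N hN] := box_sub_kidx D; exists N => N' NN'.
have hh : (2 - 2 * 2^-1 ^+ D.+1) ^+ n <= half_sum N'.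
  rewrite -sum_halfE -half_sum_box.
  have /choice [pos hpos] : forall g : {ffun 'I_n -> 'I_D.+1}, exists i : 'I_N', kidx i = box_index g.
    move=> g; have [i iN hi] := hN g.
    by exists (Ordinal (leq_trans iN NN')).
  have pinj : injective pos.
    move=> g g' h; apply: box_index_inj.
    by rewrite -!hpos h.
  under eq_bigr do rewrite -hpos.
  have -> : \sum_(g : {ffun 'I_n -> 'I_D.+1}) (2^-1 : R) ^+ mdeg (kidx (pos g)) =
     \sum_(i in pos @: [set: {ffun 'I_n -> 'I_D.+1}]) 2^-1 ^+ mdeg (kidx i).
    rewrite big_imset /=; first by apply: eq_bigl => g; rewrite in_setT.
    by move=> g g' _ _; apply: pinj.
  by apply: ler_sum_set => i; apply: exprn_ge0.
have := le_trans (ler_norm _) hD; move: hh; set y := _ ^+ n; lra.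
Qed.

Lemma normc_monomial (k : mindex n) (z : 'rV[C]_n) :
  normc (monomial k z) = \prod_v normc (z 0 v) ^+ k v.
Proof. by rewrite normc_prod; apply: eq_bigr => v _; apply: normcX. Qed.

Lemma normc_monomial_le (k : mindex n) (z : 'rV[C]_n) (d : R) :
  (forall v, normc (z 0 v) <= d) -> normc (monomial k z) <= d ^+ mdeg k.
Proof.
move=> hz; rewrite normc_monomial.
have -> : d ^+ mdeg k = \prod_(v < n) d ^+ k v.
  by rewrite /mdeg; elim/big_ind2: _ => // a b c e <- <-; rewrite exprD.
apply: ler_prod => v _; rewrite exprn_ge0 ?normc_ge0 //= lerXn2r ?nnegrE ?normc_ge0 //.
exact: le_trans (normc_ge0 _) (hz v).
Qed.

(** The tail of the geometric series at q is dominated by its tail at (1/2, ..., 1/2). *)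
Lemma geometric_kernel (q : 'rV[C]_n) N : (forall v, normc (q 0 v) <= 2^-1) ->
  normc (\prod_v (1 - q 0 v)^-1 - \sum_(i < N) monomial (kidx i) q) <= 2 ^+ n - half_sum N.
Proof.
move=> hq.
have lim : clim (fun D => \prod_v \sum_(d < D.+1) q 0 v ^+ d) (\prod_v (1 - q 0 v)^-1).
  apply: clim_prod => v _ e e0.
  have h1 : 2^-1 <= normc (1 - q 0 v).
    by have := le_normcD (1 - q 0 v) (q 0 v); rewrite subrK normc1; have := hq v; lra.
  have n0 : 1 - q 0 v != 0 by rewrite -normc_eq0 gt_eqF //; lra.
  have : (fun D => 2^-1 ^+ D : R) @ \oo --> (0 : R).
    by apply: cvg_expr; rewrite ger0_norm //; lra.
  move=> /cvgrPdist_le /(_ e e0) [D0 _ hD0].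
  exists D0 => D hD.
  have -> : \sum_(d < D.+1) q 0 v ^+ d = (1 - q 0 v ^+ D.+1) / (1 - q 0 v).
    apply: (mulIf n0); rewrite divfK // mulrC -[in RHS](expr1n _ D.+1) subrXX.
    by congr (_ * _); apply: eq_bigr => d _; rewrite expr1n mul1r.
  rewrite mulrBl mul1r addrAC subrr add0r normcN normcM normcV normcX.
  have /= := hD0 D hD; rewrite sub0r normrN ger0_norm ?exprn_ge0 // => h2.
  apply: le_trans h2; rewrite exprSr ler_pdivrMr; last by lra.
  apply: ler_pM; rewrite ?exprn_ge0 ?mulr_ge0 ?normc_ge0 //.
    by rewrite lerXn2r ?nnegrE ?normc_ge0.
  by have := hq v; lra.
apply: (clim_le lim); have [D0 hD0] := kidx_bounded N; exists D0 => D DD.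
have [S hS] : exists S : {set {ffun 'I_n -> 'I_D.+1}}, forall (V : zmodType) (F : mindex n -> V),
    \sum_(i < N) F (kidx i) = \sum_(g in S) F (box_index g).
  by apply: kidx_sum_box => i v iN; apply: leq_trans (hD0 i v iN) DD.
rewrite -(box_sum_prod D (fun v => q 0 v)) (hS _ (fun k => monomial k q)).
rewrite (bigID (mem S)) /= addrAC subrr add0r.
apply: le_trans (normc_sum _ _ _) _.
apply: le_trans (_ : \sum_(g | g \notin S) 2^-1 ^+ mdeg (box_index g) <= _).
  by apply: ler_sum => g _; apply: normc_monomial_le.
have : (\sum_(d < D.+1) 2^-1 ^+ d : R) ^+ n <= 2 ^+ n.
  rewrite lerXn2r ?nnegrE ?sum_half ?sumr_ge0 // => d _; exact: exprn_ge0.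
rewrite -half_sum_box (bigID (mem S)) /= /half_sum (hS _ (fun k => 2^-1 ^+ mdeg k)).
lra.
Qed.

End Weights.
End Enumeration.

(** * Functions analytic near a compact set *)

Lemma half_step (F : realFieldType) (a p q e rho : F) : rho != 0 ->
  a * (e * (p * q)) = a * (rho * p) * (2 / rho * e * (2^-1 * q)).
Proof.
move=> h; have -> : a * (rho * p) * (2 / rho * e * (2^-1 * q)) =
  a * (e * (p * q)) * (rho / rho) * (2 / 2) by ring.
by rewrite !divff ?mulr1 // pnatr_eq0.
Qed.

Section AnalyticFunctions.
Variables (R : realType) (n : nat).
Hypothesis n_gt0 : (0 < n)%N.
Local Notation C := R[i].
Local Notation Cn := 'rV[R[i]]_n.
Local Notation kidx := (kidx n).
Implicit Types (f phi : Cn -> C) (w z u : Cn).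

Lemma series_bigord (u : nat -> C) : series u = (fun N => \sum_(i < N) u i).
Proof. by apply/funext => N; rewrite /series /= big_mkord. Qed.

Lemma analytic_atP f w : analytic_at f w ->
  exists (c : mindex n -> C) (r : R), 0 < r /\
    forall u, (forall v, normc (u 0 v) < r) ->
      clim (fun N => \sum_(i < N) c (kidx i) * monomial (kidx i) u) (f (w + u)).
Proof.
move=> [c [r [r0 h]]]; exists c, r; split=> // u hu.
have := h (w + u); rewrite [w + u]addrC addrK => /(_ _) h'.
have /climP : series (fun i => c (kidx i) * e_ i u) @ \oo --> f (u + w).
  by apply: h' => v; rewrite mxE addrK.
by rewrite series_bigord.
Qed.

Lemma monomial0 (k : mindex n) : monomial k (0 : Cn) = (mdeg k == 0)%N%:R.
Proof.
rewrite /monomial /mdeg; have [h|h] := eqVneq (\sum_(v < n) k v)%N 0%N.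
  rewrite big1 // => v _; have : k v = 0%N.
    by apply/eqP; rewrite -leqn0 -h (bigD1 v) //= leq_addr.
  by move=> ->; rewrite expr0.
have [v kv] : exists v, k v != 0%N.
  by apply/existsP; apply: contraNT h => /existsPn h; rewrite big1 // => v _;
     apply/eqP; have := h v; rewrite negbK.
by rewrite (bigD1 v) //= mxE expr0n (negPf kv) mul0r.
Qed.

(** Abel's lemma: convergence at the point (rho, ..., rho) bounds the coefficients, so that the
    series is dominated by a geometric one on the polydisc of radius rho / 2. Its terms of positive
    degree contain a factor e. *)
Lemma analytic_lipschitz f w : analytic_at f w ->
  exists (L d : R), [/\ 0 <= L, 0 < d & forall e u, e <= d ->
    (forall v, normc (u 0 v) <= e) -> normc (f (w + u) - f w) <= L * e].
Proof.
move=> /analytic_atP [c [r [r0 hf]]].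
pose rho := r / 2; have rho0 : 0 < rho by rewrite /rho; lra.
have : forall v, normc ((const_mx rho%:C : Cn) 0 v) < r.
  by move=> v; rewrite mxE normc_real gtr0_norm /rho; lra.
move=> /hf /(@clim_terms_bounded R (fun i => c (kidx i) * monomial (kidx i) (const_mx rho%:C))).
move=> [M M0 hM].
have hc i : normc (c (kidx i)) * rho ^+ mdeg (kidx i) <= M.
  apply: le_trans (hM i); rewrite normcM normc_monomial.
  rewrite (_ : \prod_v _ = rho ^+ mdeg (kidx i)) //.
  rewrite /mdeg; elim/big_ind2: _ => //; first by move=> a b x y -> ->; rewrite exprD.
  by move=> v _; rewrite mxE normc_real gtr0_norm.
exists (M * (2 / rho) * 2 ^+ n), (rho / 2); split=> [||e u ed hu].
- by rewrite mulr_ge0 ?exprn_ge0 // mulr_ge0 // divr_ge0 // ltW.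
- by rewrite divr_gt0.
have e0 : 0 <= e := le_trans (normc_ge0 _) (hu (Ordinal n_gt0)).
have h1 : forall v, normc (u 0 v) < r.
  by move=> v; apply: le_lt_trans (hu v) _; rewrite /rho in ed; lra.
have h0 : forall v, normc ((0 : Cn) 0 v) < r by move=> v; rewrite mxE normc0.
have lim : clim (fun N => \sum_(i < N) c (kidx i) * monomial (kidx i) u +
     -1 * \sum_(i < N) c (kidx i) * monomial (kidx i) 0) (f (w + u) + -1 * f w).
  apply: climD; first exact: hf.
  apply: climM; first exact: clim_cst.
  by have := hf _ h0; rewrite addr0.
rewrite mulN1r in lim.
rewrite -[X in normc X]subr0; apply: (clim_le lim); exists 0%N => N _; rewrite subr0.
rewrite mulr_sumr -big_split /=.
apply: le_trans (normc_sum _ _ _) _.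
apply: le_trans (_ : \sum_(i < N) M * (2 / rho) * e * 2^-1 ^+ mdeg (kidx i) <= _); last first.
  have -> : M * (2 / rho) * 2 ^+ n * e = M * (2 / rho) * e * 2 ^+ n by ring.
  rewrite -mulr_sumr; apply: ler_wpM2l; last exact: half_sum_le.
  by rewrite !mulr_ge0 // ?invr_ge0 ltW.
apply: ler_sum => i _.
have -> : c (kidx i) * monomial (kidx i) u + -1 * (c (kidx i) * monomial (kidx i) 0) =
  c (kidx i) * (monomial (kidx i) u - monomial (kidx i) 0) by ring.
rewrite normcM monomial0; have [k0|k0] := eqVneq (mdeg (kidx i)) 0%N.
  have -> : monomial (kidx i) u = 1.
    rewrite /monomial big1 // => v _; have := mdeg_ge (kidx i) v.
    by rewrite k0 leqn0 => /eqP ->; rewrite expr0.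
  by rewrite subrr normc0 mulr0 k0 expr0 mulr1 !mulr_ge0 // ?invr_ge0 ltW.
rewrite subr0; have hm := normc_monomial_le (kidx i) hu.
apply: le_trans (ler_wpM2l (normc_ge0 _) hm) _.
case: (mdeg (kidx i)) (hc i) k0 => // m hcm _.
have : e ^+ m.+1 <= e * (rho / 2) ^+ m.
  by rewrite exprS ler_wpM2l // lerXn2r ?nnegrE // divr_ge0 // ltW.
move=> h2; apply: le_trans (ler_wpM2l (normc_ge0 _) h2) _.
have -> : normc (c (kidx i)) * (e * (rho / 2) ^+ m) =
   (normc (c (kidx i)) * rho ^+ m.+1) * ((2 / rho) * e * 2^-1 ^+ m.+1).
  by rewrite exprMn !exprS; apply: half_step; rewrite gt_eqF.
have -> : M * (2 / rho) * e * 2^-1 ^+ m.+1 = M * ((2 / rho) * e * 2^-1 ^+ m.+1) by ring.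
by rewrite ler_wpM2r // !mulr_ge0 // ?exprn_ge0 // invr_ge0 ltW.
Qed.

Lemma analytic_locally_bounded f w : analytic_at f w ->
  exists M, \forall z \near w, normc (f z) <= M.
Proof.
move=> /analytic_lipschitz [L [d [L0 d0 h]]]; exists (normc (f w) + L * d).
have := near_polydisc w d0; apply: filterS => z hz.
have : normc (f (w + (z - w)) - f w) <= L * d.
  by apply: h => // v; rewrite !mxE; apply: ltW.
rewrite [w + _]addrC subrK => h1.
by have := le_normcD (f z - f w) (f w); rewrite subrK; lra.
Qed.

Lemma analytic_bounded f (Q : set Cn) : compact Q -> (forall w, Q w -> analytic_at f w) ->
  exists M, forall w, Q w -> normc (f w) <= M.
Proof.
move=> cQ hf; apply: (compact_locally_bounded (g := fun z => normc (f z)) cQ).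
by move=> w /hf /analytic_locally_bounded.
Qed.

(** The multi-indices whose monomials do not vanish on the v-th coordinate axis. *)
Definition axis (v : 'I_n) (m : nat) : mindex n := [ffun j => if j == v then m else 0%N].

Lemma mdeg_axis v m : mdeg (axis v m) = m.
Proof.
rewrite /mdeg (bigD1 v) //= ffunE eqxx big1 ?addn0 // => j /negPf jv.
by rewrite ffunE jv.
Qed.

Lemma monomial_axis v m (h : C) : monomial (axis v m) (h *: delta_mx 0 v) = h ^+ m.
Proof.
rewrite /monomial (bigD1 v) //= ffunE eqxx !mxE !eqxx mulr1 big1 ?mulr1 // => j /negPf jv.
by rewrite ffunE jv expr0.
Qed.

Lemma monomial_off_axis v (k : mindex n) (h : C) : (forall m, k <> axis v m) ->
  monomial k (h *: delta_mx 0 v) = 0.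
Proof.
move=> hk; have [j /andP[jv kj]] : exists j, (j != v) && (k j != 0%N).
  apply/existsP; apply: contra_notT (hk (k v)) => /existsPn h1.
  apply/ffunP => j; rewrite ffunE; have [->//|jv] := eqVneq j v.
  by have := h1 j; rewrite jv /= negbK => /eqP.
by rewrite /monomial (bigD1 j) //= !mxE (negPf jv) mulr0 expr0n (negPf kj) mul0r.
Qed.

(** The expansion is centred at the point of the slice under consideration, so that the monomials
    off the axis vanish along the slice. The enumeration being compatible with the degree, the
    others come in the order of the one-variable series. *)
Lemma slice_power_series f w v x : entire f ->
  power_series_at (fun y => f (replace_coord w v y)) x.
Proof.
move=> /(_ (replace_coord w v x) I) /analytic_atP [c [r [r0 hf]]].
exists (fun m => c (axis v m)), r; split=> // h hr.
(* Grouping up to the rank of the N-th index of the axis gives the N-th partial sum. *)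
have /choice [pos hpos] := fun m => kidx_surj n_gt0 (axis v m).
have pos_lt m m' : (m < m')%N -> (pos m < pos m')%N.
  move=> mm; rewrite ltnNge; apply/negP => /(mdeg_kidx_mono n_gt0).
  by rewrite !hpos !mdeg_axis leqNgt mm.
have pos_ge m : (m <= pos m)%N.
  by elim: m => // m IH; apply: leq_ltn_trans IH (pos_lt _ _ (ltnSn m)).
have off i : (forall m, i <> pos m) -> monomial (kidx i) (h *: delta_mx 0 v) = 0.
  move=> hi; apply: monomial_off_axis => m; rewrite -hpos => /(kidx_inj n_gt0).
  exact: hi.
have sumE N : \sum_(i < pos N) c (kidx i) * monomial (kidx i) (h *: delta_mx 0 v) =
    \sum_(m < N) c (axis v m) * h ^+ m.
  rewrite -(big_mkord xpredT (fun i => c (kidx i) * monomial (kidx i) (h *: delta_mx 0 v))).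
  elim: N => [|N IH].
    rewrite big_ord0 big1_seq // => i; rewrite mem_index_iota /= => ip.
    rewrite off ?mulr0 // => m e.
    have : (pos 0%N <= pos m)%N by case: m {e} => // m; apply/ltnW/pos_lt.
    by rewrite -e leqNgt ip.
  have lt := pos_lt _ _ (ltnSn N).
  rewrite (big_cat_nat _ (n := pos N)) //=; last exact: ltnW.
  rewrite IH big_ord_recr /=; congr (_ + _).
  rewrite big_ltn // hpos monomial_axis big1_seq ?addr0 // => i.
  rewrite mem_index_iota /= => /andP[i1 i2]; rewrite off ?mulr0 // => m e.
  have [mN|Nm] := leqP m N.
    have : (pos m <= pos N)%N by move: mN; rewrite leq_eqVlt => /predU1P[->//|/pos_lt/ltnW].
    by rewrite -e leqNgt i1.
  have : (pos N.+1 <= pos m)%N by move: Nm; rewrite leq_eqVlt => /predU1P[->//|/pos_lt/ltnW].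
  by rewrite -e leqNgt i2.
have hu : forall j, normc ((h *: delta_mx 0 v : Cn) 0 j) < r.
  move=> j; rewrite !mxE eqxx /=; case: eqP => _; first by rewrite mulr1.
  by rewrite mulr0 normc0.
have := hf _ hu.
have -> : replace_coord w v x + h *: delta_mx 0 v = replace_coord w v (x + h).
  apply/rowP => j; rewrite !mxE eqxx /=; case: eqP => _; first by rewrite mulr1.
  by rewrite mulr0 addr0.
move=> lim e e0; have [N hN] := lim e e0; exists N => k Nk.
by rewrite -sumE; apply: hN; apply: leq_trans Nk (pos_ge k).
Qed.

Lemma entire_sliced_analytic f : entire f -> sliced_analytic f.
Proof.
move=> hf; split=> [w v x|B]; first exact: slice_power_series.
have [Q cQ hQ] := @compact_polydisc R n B.
have [M hM] := analytic_bounded cQ (fun w _ => hf w I).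
by exists M => z /hQ /hM.
Qed.

End AnalyticFunctions.

(** * Functionals carried by a sequence of points *)

Section DiscreteFunctionals.
Variables (R : realType) (n : nat).
Hypothesis n_gt0 : (0 < n)%N.
Local Notation C := R[i].
Local Notation Cn := 'rV[R[i]]_n.
Local Notation kidx := (kidx n).
Implicit Types (f phi : Cn -> C) (w z u : Cn).

Definition discrete_functional (c : nat -> C) (zeta : nat -> Cn) : functional R n :=
  fun f => csum (fun j => c j * f (zeta j)).

Definition moments (c : nat -> C) (zeta : nat -> Cn) (k : mindex n) : C :=
  discrete_functional c zeta (@monomial R n k).

Variables (K : set Cn) (c : nat -> C) (zeta : nat -> Cn) (M : R).
Hypotheses (K_compact : compact K) (Kzeta : forall j, K (zeta j)).
Hypothesis (c_summable : summable_by c M).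
Local Notation L := (discrete_functional c zeta).
Local Notation a := (moments c zeta).

Definition small_on_nodes (e : R) : set (Cn -> C) :=
  [set h | forall j, normc (h (zeta j)) <= e].

Lemma summable_nodes f B : (forall w, K w -> normc (f w) <= B) ->
  summable_by (fun j => c j * f (zeta j)) (M * B).
Proof.
move=> hB; apply: (@summable_byM _ c (fun j => f (zeta j))) => // [|j].
  exact: le_trans (normc_ge0 _) (hB _ (Kzeta 0%N)).
exact: hB.
Qed.

(** For A(C^n) as for the germs, the functions that are small on the nodes form a neighbourhood of
    0, on which the functional is small. *)
Lemma discrete_continuous_linear (S : set (Cn -> C)) (nbhs0 : set (Cn -> C) -> Prop) :
  (forall f, S f -> exists B, forall w, K w -> normc (f w) <= B) ->
  (forall e, 0 < e -> nbhs0 (small_on_nodes e)) ->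
  continuous_linear S nbhs0 L.
Proof.
move=> bS nb; split=> [x y f g /bS [B hB] /bS [B' hB']|f eps /bS [B hB] eps0].
  rewrite /discrete_functional -(csum_lin _ _ (summable_nodes hB) (summable_nodes hB')).
  by apply: eq_csum => j; ring.
have M0 := summable_ge0 c_summable.
have e0 : 0 < eps / (M + 1) by rewrite divr_gt0 //; lra.
exists (small_on_nodes (eps / (M + 1))); first exact: nb.
move=> h _ hh; have sh : summable_by (fun j => c j * h (zeta j)) (M * (eps / (M + 1))).
  by apply: (@summable_byM _ c (fun j => h (zeta j))) => //; apply: ltW.
have -> : L (fun z => f z + h z) - L f = L h.
  have := csum_lin 1 1 (summable_nodes hB) sh; rewrite !mul1r => e.
  rewrite /discrete_functional (_ : csum _ = csum (fun j => c j * f (zeta j)) + csum (fun j => c j * h (zeta j))).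
    by rewrite addrAC subrr add0r.
  by rewrite -e; apply: eq_csum => j; ring.
apply: le_lt_trans (csum_le sh) _.
by rewrite mulrA ltr_pdivrMr ?mulrDr; last lra; rewrite mulr1 mulrC ltrDl.
Qed.

Lemma discrete_dual_germs (K' : set Cn) : K `<=` K' -> dual_germs K' L.
Proof.
move=> KK'; split=> [f g _ _ [U [_ K'U fg]]|D [_ _ KD]].
  by apply: eq_csum => j; rewrite fg //; apply/K'U/KK'.
apply: discrete_continuous_linear => [f [U [_ K'U hf]]|e e0].
  by apply: analytic_bounded => // w /KK' /K'U; apply: hf.
exists (small_on_nodes e); split=> //.
- move=> f g x y hf hg xy j; apply: le_trans (le_normcD _ _) _; rewrite !normcM.
  apply: le_trans (_ : normc x * e + normc y * e <= _).
    by apply: lerD; apply: ler_wpM2l; rewrite ?normc_ge0.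
  by rewrite -mulrDl -[leRHS]mul1r ler_wpM2r // ltW.
- move=> f g _ _ [U [_ K'U fg]] hf j; rewrite -fg; first exact: hf.
  exact/K'U/KK'.
- move=> j; exists K, e; split=> //; first by move=> w /KK'; rewrite KD => /(_ j I).
  by move=> f _ hf i; apply/ltW/hf.
Qed.

Lemma discrete_analytic_functional : analytic_functional L.
Proof.
apply: discrete_continuous_linear => [f hf|e e0].
  by apply: analytic_bounded => // w _; apply: hf.
by exists K, e; split=> // f _ hf j; apply/ltW/hf.
Qed.

Section Transform.
Variable rho : R.
Hypotheses (rho0 : 0 < rho) (zeta_le : forall j v, normc (zeta j 0 v) <= rho).

Lemma monomialD1 (k : mindex n) z :
  monomial (k + [ffun=> 1%N]) z = monomial k z * \prod_v z 0 v.
Proof.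
rewrite /monomial -big_split /=; apply: eq_bigr => v _.
by rewrite !ffunE exprD expr1.
Qed.

(** If |z_v| > 2 rho for all v, the points zeta_j / z belong to the polydisc of radius 1/2, where
    the geometric series converges uniformly; this allows its exchange with the sum over j. *)
Lemma moments_expansion z : (forall v, 2 * rho < normc (z 0 v)) ->
  clim (inf_series a z) (csum (fun j => c j * \prod_v (z 0 v - zeta j 0 v)^-1)).
Proof.
move=> hz; have rho1 := rho0.
have z0 v : z 0 v != 0 by rewrite -normc_eq0 gt_eqF //; have := hz v; lra.
pose q j : Cn := \row_v (zeta j 0 v / z 0 v).
have hq j v : normc (q j 0 v) <= 2^-1.
  rewrite mxE normcM normcV ler_pdivrMr; last by have := hz v; lra.
  by have := zeta_le j v; have := hz v; lra.
pose Z := \prod_v z 0 v.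
have Z0 : Z != 0 by apply/prodf_neq0 => v _.
have mq j i : monomial i (q j) = monomial i (zeta j) / monomial i z.
  rewrite /monomial -prodf_div; apply: eq_bigr => v _.
  by rewrite mxE expr_div_n.
have eP j : \prod_v (z 0 v - zeta j 0 v)^-1 = Z^-1 * \prod_v (1 - q j 0 v)^-1.
  rewrite /Z -prodfV -big_split /=; apply: eq_bigr => v _.
  rewrite mxE -invfM mulrBr mulr1; congr (_ - _)^-1.
  by rewrite mulrCA mulfV // mulr1.
have sP : summable_by (fun j => c j * \prod_v (1 - q j 0 v)^-1) (M * 2 ^+ n).
  apply: (@summable_byM _ c (fun j => \prod_v (1 - q j 0 v)^-1)) => // j.
  have := geometric_kernel n_gt0 0 (hq j).
  by rewrite big_ord0 subr0 /half_sum big_ord0 subr0.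
have sumD N : summable_by (fun j => c j * (\prod_v (1 - q j 0 v)^-1 - \sum_(i < N) monomial (kidx i) (q j)))
   (M * (2 ^+ n - half_sum n R N)).
  apply: (@summable_byM _ c (fun j => \prod_v (1 - q j 0 v)^-1 - \sum_(i < N) monomial (kidx i) (q j))) => // [|j].
    by rewrite subr_ge0 half_sum_le.
  exact: geometric_kernel.
have partial N : inf_series a z N =
    Z^-1 * csum (fun j => c j * \sum_(i < N) monomial (kidx i) (q j)).
  rewrite /inf_series series_bigord.
  have sm i : summable_by (fun j => c j * monomial (kidx i) (q j)) (M * 2^-1 ^+ mdeg (kidx i)).
    apply: (@summable_byM _ c (fun j => monomial (kidx i) (q j))) => // j.
    exact: normc_monomial_le.
  have -> : csum (fun j => c j * \sum_(i < N) monomial (kidx i) (q j)) =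
      \sum_(i < N) csum (fun j => c j * monomial (kidx i) (q j)).
    apply: csum_eq.
    have -> : (fun J => \sum_(j < J) c j * \sum_(i < N) monomial (kidx i) (q j)) =
       (fun J => \sum_(i < N) \sum_(j < J) c j * monomial (kidx i) (q j)).
      apply/funext => J; rewrite exchange_big /=.
      by apply: eq_bigr => j _; rewrite mulr_sumr.
    by apply: clim_sum => i _; apply: csumP (sm i).
  rewrite mulr_sumr; apply: eq_bigr => i _.
  rewrite monomialD1 invfM mulrA -/Z mulrC; congr (_ * _).
  rewrite mulrC -(csum_mull _ (M := M * rho ^+ mdeg (kidx i))).
    by apply: eq_csum => j; rewrite mq; ring.
  apply: (@summable_byM _ c (fun j => monomial (kidx i) (zeta j))) => // [|j].
    by rewrite exprn_ge0 // ltW.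
  exact: normc_monomial_le.
have -> : csum (fun j => c j * \prod_v (z 0 v - zeta j 0 v)^-1) =
    Z^-1 * csum (fun j => c j * \prod_v (1 - q j 0 v)^-1).
  by rewrite -(csum_mull _ sP); apply: eq_csum => j; rewrite eP; ring.
move=> e e0; have nZ : 0 < normc Z by rewrite lt0r normc_eq0 Z0 normc_ge0.
have M0 := summable_ge0 c_summable.
have d0 : 0 < e * normc Z / (M + 1) by rewrite divr_gt0 ?mulr_gt0 //; lra.
have [N hN] := half_sum_lim n_gt0 d0; exists N => k /hN hk.
rewrite partial -mulrBr normcM normcV mulrC ler_pdivrMr //.
have -> : csum (fun j => c j * \sum_(i < k) monomial (kidx i) (q j)) -
    csum (fun j => c j * \prod_v (1 - q j 0 v)^-1) =
    - csum (fun j => c j * (\prod_v (1 - q j 0 v)^-1 - \sum_(i < k) monomial (kidx i) (q j))).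
  have := csum_lin 1 (-1) sP (sumD k).
  rewrite (@eq_csum _ _ (fun j => c j * \sum_(i < k) monomial (kidx i) (q j))); last first.
    by move=> j; ring.
  by move=> ->; ring.
rewrite normcN; apply: le_trans (csum_le (sumD k)) _.
apply: le_trans (ler_wpM2l M0 hk) _.
rewrite mulrA ler_pdivrMr; last by lra.
by rewrite mulrC ler_wpM2l //; [rewrite mulr_ge0 // ltW | lra].
Qed.

Lemma germ_infty_val_moments z : (forall v, 2 * rho < normc (z 0 v)) ->
  cvgn (inf_series a z) /\
  germ_infty_val a z = csum (fun j => c j * \prod_v (z 0 v - zeta j 0 v)^-1).
Proof.
move=> /moments_expansion h.
have cv : cvgn (inf_series a z) by apply/cvg_ex; eexists; apply/climP; exact: h.
split=> //; apply: clim_unique h; apply/climP; exact: cv.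
Qed.

Lemma discrete_T_transform : T_transform L a.
Proof.
split; first exact: discrete_analytic_functional.
  exists (2 * rho); first by rewrite mulr_gt0.
  by move=> z /germ_infty_val_moments [].
near=> r => phi /(entire_sliced_analytic n_gt0) hphi.
have r2 : 2 * rho < r by near: r; apply: nbhs_pinfty_gt; rewrite num_real.
have r0 : 0 < r by have := rho0; lra.
rewrite (@torus_cauchy R r rho r0 (ltW rho0) _ n c M zeta phi) //; last first.
- move=> z hz; congr (_ * _); apply: (germ_infty_val_moments _).2 => v.
  by rewrite hz.
- by have := rho0; lra.
rewrite mulrA mulVf ?mul1r // expf_neq0 // !mulf_neq0 //.
- by rewrite -normc_eq0 normc_real normr_eq0 gt_eqF ?pi_gt0.
- by rewrite -normc_eq0 normc_i oner_eq0.
Unshelve. all: by end_near. Qed.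

End Transform.

End DiscreteFunctionals.

(** * Determinants of sums of rank one matrices *)

Section GramDeterminant.
Variables (F : comPzRingType) (i J : nat) (c : 'I_J -> F) (u : 'I_i -> 'I_J -> F).
Local Notation nodes := {ffun 'I_i -> 'I_J}.
Local Notation minor phi := (\det (\matrix_(alpha < i, beta < i) u alpha ((phi : nodes) beta))).

Lemma det_gram_expand :
  \det (\matrix_(alpha < i, beta < i) \sum_j c j * u alpha j * u beta j) =
  \sum_(phi : nodes) (\prod_alpha c (phi alpha)) * ((\prod_alpha u alpha (phi alpha)) * minor phi).
Proof.
have -> : \det (\matrix_(alpha < i, beta < i) \sum_j c j * u alpha j * u beta j) =
  \sum_(s : 'S_i) \sum_(phi : nodes)
   (-1) ^+ s * \prod_alpha (c (phi alpha) * u alpha (phi alpha) * u (s alpha) (phi alpha)).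
  apply: eq_bigr => s _; rewrite -mulr_sumr; congr (_ * _).
  rewrite -(bigA_distr_bigA (fun alpha j => c j * u alpha j * u (s alpha) j)).
  by apply: eq_bigr => alpha _; rewrite mxE.
rewrite exchange_big /=; apply: eq_bigr => phi _.
rewrite -det_tr !mulr_sumr; apply: eq_bigr => s _.
rewrite [X in _ = _ * (_ * (_ * X))](eq_bigr (fun alpha => u (s alpha) (phi alpha))).
  by rewrite !big_split /= -!mulrA [X in _ = _ * X]mulrCA [RHS]mulrCA.
by move=> alpha _; rewrite !mxE.
Qed.

(** Andreief's identity. In [det_gram_expand] each choice of nodes may be permuted; summing over
    the permutations turns the diagonal product, with the signs of the permuted minors, into a
    second copy of the minor. *)
Lemma det_gram : i`!%:R *
  \det (\matrix_(alpha < i, beta < i) \sum_j c j * u alpha j * u beta j) =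
  \sum_(phi : nodes) (\prod_alpha c (phi alpha)) * minor phi ^+ 2.
Proof.
have perm_minor (s : 'S_i) (phi : nodes) :
   minor [ffun alpha => phi (s alpha)] = (-1) ^+ s * minor phi.
  rewrite -odd_permV -det_perm mulrC -det_mulmx -col_permE; congr (\det _).
  by apply/matrixP => alpha beta; rewrite !mxE ffunE.
have each (s : 'S_i) :
  \det (\matrix_(alpha < i, beta < i) \sum_j c j * u alpha j * u beta j) =
  \sum_(phi : nodes) (\prod_alpha c (phi alpha)) *
     (((-1) ^+ s * \prod_alpha u alpha (phi (s alpha))) * minor phi).
  rewrite det_gram_expand (reindex_inj (h := fun phi : nodes => [ffun alpha => phi (s alpha)])) /=.
    apply: eq_bigr => phi _; rewrite perm_minor; congr (_ * _).
      rewrite [RHS](reindex_inj (@perm_inj _ s)).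
      by apply: eq_bigr => alpha _; rewrite ffunE.
    rewrite mulrA; congr (_ * _); rewrite mulrC; congr (_ * _).
    by apply: eq_bigr => alpha _; rewrite ffunE.
  move=> phi psi /ffunP h; apply/ffunP => alpha.
  by have := h (s^-1%g alpha); rewrite !ffunE permKV.
transitivity (\sum_(s : 'S_i) \det (\matrix_(alpha < i, beta < i) \sum_j c j * u alpha j * u beta j)).
  by rewrite sumr_const card_Sn mulr_natl.
rewrite (eq_bigr _ (fun s _ => each s)) exchange_big /=; apply: eq_bigr => phi _.
rewrite -mulr_sumr; congr (_ * _); rewrite -mulr_suml expr2; congr (_ * _).
by apply: eq_bigr => s _; congr (_ * _); apply: eq_bigr => alpha _; rewrite mxE.
Qed.

End GramDeterminant.

Section Perturbation.
Variable R : realType.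
Local Notation C := R[i].

Lemma complex_prim_root m : (0 < m)%N -> exists z : C, m.-primitive_root z.
Proof.
pose p : {poly C} := 'X^m - 1; have [r Dp] := closed_field_poly_normal p.
move=> m_gt0; rewrite (monicP _) ?monicXnsubC // scale1r in Dp.
have rn1: all m.-unity_root r by apply/allP=> z; rewrite -root_prod_XsubC -Dp.
have sz_r: (m < (size r).+1)%N.
  by rewrite -(size_prod_XsubC r id) -Dp size_XnsubC.
have [|z] := hasP (has_prim_root m_gt0 rn1 _ sz_r); last by exists z.
by rewrite -separable_prod_XsubC -Dp separable_Xn_sub_1 // pnatr_eq0 -lt0n.
Qed.

(** A form of the maximum principle: the mean of p(t) t^-m over the circle |t| = w is the leading
    coefficient of p, and so is the mean over w times the roots of unity of order m + 1. *)
Lemma monic_large_on_circle (p : {poly C}) m (w : R) : p \is monic -> size p = m.+1 ->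
  0 < w -> exists2 t : C, normc t = w & w ^+ m <= normc p.[t].
Proof.
move=> pm sp w0; have [z pz] := @complex_prim_root m.+1 isT.
have z1 : normc z = 1.
  have := prim_expr_order pz => /(congr1 (@normc R)); rewrite normcX normc1 => /eqP.
  by rewrite pexpr_eq1 ?normc_ge0 // => /eqP.
have nt k : normc (w%:C * z ^+ k) = w.
  by rewrite normcM normcX z1 expr1n mulr1 normc_real gtr0_norm.
have [[k hk]|hN] := pselect (exists k, w ^+ m <= normc p.[w%:C * z ^+ k]).
  by exists (w%:C * z ^+ k).
have small k : normc p.[w%:C * z ^+ k] < w ^+ m.
  by rewrite ltNge; apply/negP => h; apply: hN; exists k.
have avg : \sum_(k < m.+1) z ^+ k * p.[w%:C * z ^+ k] = m.+1%:R * w%:C ^+ m.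
  transitivity (\sum_(d < m.+1) p`_d * w%:C ^+ d * \sum_(k < m.+1) (z ^+ d.+1) ^+ k).
    under [RHS]eq_bigr do rewrite mulr_sumr.
    rewrite exchange_big /=; apply: eq_bigr => k _.
    rewrite horner_coef sp mulr_sumr; apply: eq_bigr => d _.
    by rewrite exprMn -!exprM mulSn exprD [(d * k)%N]mulnC; ring.
  rewrite big_ord_recr /= big1 ?add0r => [|d _].
    have -> : p`_m = 1 by have := monicP pm; rewrite lead_coefE sp.
    rewrite mul1r (prim_expr_order pz); under eq_bigr do rewrite expr1n.
    by rewrite sumr_const card_ord mulrC.
  have zd : z ^+ d.+1 != 1.
    by rewrite -(prim_order_dvd pz) gtnNdvd // ltnS.
  have : (z ^+ d.+1 - 1) * \sum_(k < m.+1) (z ^+ d.+1) ^+ k = 0.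
    by rewrite -subrX1 exprAC (prim_expr_order pz) expr1n subrr.
  by move/eqP; rewrite mulf_eq0 subr_eq0 (negPf zd) /= => /eqP ->; rewrite mulr0.
have : normc (\sum_(k < m.+1) z ^+ k * p.[w%:C * z ^+ k]) < \sum_(k < m.+1) w ^+ m.
  apply: le_lt_trans (normc_sum _ _ _) _.
  apply: ltr_sum => [|k _]; first by apply/hasP; exists ord0; rewrite ?mem_index_enum.
  by rewrite normcM normcX z1 expr1n mul1r.
rewrite avg normcM normc_nat normcX normc_real gtr0_norm // sumr_const card_ord.
by rewrite mulr_natl ltxx.
Qed.

(** As a function of t, the determinant is det (U U^T) times the characteristic polynomial of
    - (U U^T)^-1 A. *)
Lemma det_perturbation m (A U : 'M[C]_m) (w : R) : 0 < w -> \det U != 0 ->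
  exists2 t : C, normc t = w &
    w ^+ m * normc (\det U) ^+ 2 <= normc (\det (A + t *: (U *m U^T))).
Proof.
move=> w0 U0; set B := U *m U^T.
have detB : \det B = \det U ^+ 2 by rewrite det_mulmx det_tr expr2.
have uB : B \in unitmx by rewrite unitmxE detB unitfE expf_neq0.
have [t tw ht] := monic_large_on_circle (char_poly_monic (- (invmx B *m A)))
  (size_char_poly _) w0.
exists t => //.
have -> : A + t *: B = B *m (t%:M + invmx B *m A).
  rewrite mulmxDr mulmxA mulmxV // mul1mx addrC; congr (_ + _).
  by rewrite -mul_mx_scalar.
rewrite det_mulmx normcM detB normcX mulrC ler_wpM2l ?exprn_ge0 ?normc_ge0 //.
have -> : \det (t%:M + invmx B *m A) = (char_poly (- (invmx B *m A))).[t]; last by [].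
rewrite -horner_evalE /char_poly -det_map_mx; congr (\det _).
apply/matrixP => a b; rewrite !mxE /= horner_evalE hornerD hornerN hornerC opprK; congr (_ + _).
by rewrite hornerMn hornerX.
Qed.

End Perturbation.

(** * Counting multi-indices *)

Section Counting.
Variable n : nat.
Hypothesis n_gt0 : (0 < n)%N.
Local Open Scope nat_scope.
Local Notation kidx := (kidx n).

Definition low_degree (s : nat) : seq (mindex n) := flatten [seq mindices n q | q <- iota 0 s].

Lemma low_degreeS s : low_degree s.+1 = low_degree s ++ mindices n s.
Proof. by rewrite /low_degree -addn1 iotaD map_cat flatten_cat /= cats0. Qed.

Lemma mem_low_degree s k : (k \in low_degree s) = (mdeg k < s).
Proof.
by elim: s => // s IH; rewrite low_degreeS mem_cat IH mem_mindices orbC -leq_eqVlt ltnS.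
Qed.

Lemma low_degree_uniq s : uniq (low_degree s).
Proof.
elim: s => // s IH; rewrite low_degreeS cat_uniq IH mindices_uniq andbT /=.
by apply/hasPn => k; rewrite mem_mindices mem_low_degree => /eqP ->; rewrite ltnn.
Qed.

Lemma size_low_degree s : size (low_degree s.+1) = m_ n s.
Proof.
rewrite /m_ [RHS](_ : _ = 'C(n + s, n)); last first.
  by rewrite addnC -(@bin_sub (n + s) n) ?leq_addr // addKn.
rewrite -card_partial_ord_partitions cardE.
pose f (t : n.-tuple 'I_s.+1) : mindex n := [ffun v => tnth t v : nat].
have finj : injective f.
  move=> t t' /ffunP h; apply: eq_from_tnth => v; apply: val_inj.
  by have := h v; rewrite !ffunE.
rewrite -(size_map f); apply/perm_size/uniq_perm.
- exact: low_degree_uniq.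
- by rewrite map_inj_uniq ?enum_uniq.
move=> k; rewrite mem_low_degree ltnS; apply/idP/mapP => [ks|[t]].
  have le v : k v < s.+1 by rewrite ltnS (leq_trans (mdeg_ge k v)).
  exists [tuple Ordinal (le v) | v < n]; last first.
    by apply/ffunP => v; rewrite ffunE tnth_mktuple.
  rewrite mem_enum inE big_tuple (leq_trans _ ks) // /mdeg.
  by apply/eq_leq/eq_bigr => v _; rewrite tnth_mktuple.
rewrite mem_enum inE big_tuple => h ->; apply: leq_trans h.
by apply/eq_leq/eq_bigr => v _; rewrite ffunE.
Qed.

(** The degree is nondecreasing along the enumeration, so that the multi-indices of degree < s
    occupy its first places. *)
Lemma mdeg_kidx_lt i s : (mdeg (kidx i) < s) = (i < size (low_degree s)).
Proof.
apply/idP/idP => h.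
  have : size (map kidx (iota 0 i.+1)) <= size (low_degree s).
    apply: uniq_leq_size.
      by rewrite map_inj_uniq ?iota_uniq //; apply: kidx_inj.
    move=> k /mapP[j]; rewrite mem_iota ltnS => /andP[_ ji] ->.
    by rewrite mem_low_degree (leq_ltn_trans (mdeg_kidx_mono n_gt0 ji)).
  by rewrite size_map size_iota.
rewrite ltnNge; apply: contraL h => h; rewrite -leqNgt.
have : size (low_degree s) <= size (map kidx (iota 0 i)).
  apply: uniq_leq_size; first exact: low_degree_uniq.
  move=> k; rewrite mem_low_degree => ks; have [j jk] := kidx_surj n_gt0 k.
  apply/mapP; exists j => //; rewrite mem_iota /= add0n ltnNge.
  apply/negP => /(mdeg_kidx_mono n_gt0); rewrite jk leqNgt.
  by rewrite (leq_trans ks).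
by rewrite size_map size_iota.
Qed.

Lemma mdeg_kidx_le i s : (mdeg (kidx i) <= s) = (i < m_ n s).
Proof. by rewrite -ltnS mdeg_kidx_lt size_low_degree. Qed.

Lemma m_gt0 s : 0 < m_ n s.
Proof. by rewrite bin_gt0 leq_addr. Qed.

Lemma m_S s : m_ n s.+1 = m_ n s + N_ n s.+1.
Proof. by rewrite -!size_low_degree low_degreeS size_cat. Qed.

Lemma l_S s : l_ n s.+1 = l_ n s + s.+1 * N_ n s.+1.
Proof. by rewrite /l_ big_ord_recr. Qed.

Lemma mul_m_S s : s.+1 * m_ n s.+1 = (s.+1 + n) * m_ n s.
Proof. by rewrite /m_ -mul_bin_diag addSn. Qed.

(** The exact ratio l_s / m_s = n s / (n + 1) governs all comparisons between the number of nodes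
    and the normalizing exponents. *)
Lemma l_m s : n.+1 * l_ n s = n * s * m_ n s.
Proof.
elim: s => [|s IH]; first by rewrite /l_ big_ord_recl big_ord0 /= !muln0.
have h1 := mul_m_S s; have h2 := m_S s; rewrite l_S.
nia.
Qed.

Lemma l_ge s : s * m_ n s <= 2 * l_ n s.
Proof.
have h := l_m s; have hn := n_gt0.
rewrite -(leq_pmul2l (ltn0Sn n)) [leqRHS]mulnCA h -[n * s * _]mulnA [leqRHS]mulnA.
by rewrite leq_mul2r; apply/orP; right; lia.
Qed.

Lemma l_gt0 s : 0 < s -> 0 < l_ n s.
Proof. by have := l_ge s; have := m_gt0 s; case: (l_ n s) => // h1 h2 s0; nia. Qed.

Lemma l_increment s : s.+1 * (s.+1 * N_ n s.+1) <= n.+1 * l_ n s.+1.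
Proof.
have h1 := l_m s; have h2 := l_m s.+1; have h3 := mul_m_S s; have h4 := l_S s.
have h5 := m_S s; nia.
Qed.

Lemma mdeg_kidx_last s : mdeg (kidx (m_ n s).-1) = s.
Proof.
have ms := m_gt0 s.
apply/eqP; rewrite eqn_leq mdeg_kidx_le prednK // leqnn /=.
case: s ms => // s ms; rewrite ltnNge mdeg_kidx_le -leqNgt.
rewrite -ltnS prednK // m_S -addn1 leq_add2l.
pose k : mindex n := [ffun v => if v == Ordinal n_gt0 then s.+1 else 0].
suff : k \in mindices n s.+1 by rewrite /N_; case: (mindices n s.+1).
rewrite mem_mindices /mdeg (bigD1 (Ordinal n_gt0)) //= ffunE eqxx.
by rewrite big1 ?addn0 // => v /negPf vn; rewrite ffunE vn.
Qed.

Lemma m_le_exp s : m_ n s <= 2 ^ (s + n).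
Proof.
have : \sum_(i < (s + n).+1) 'C(s + n, i) = 2 ^ (s + n).
  by rewrite -[2]/(1 + 1) expnDn; apply: eq_bigr => i _; rewrite !exp1n !muln1.
rewrite /m_ => <-; have h : s < (s + n).+1 by lia.
by rewrite (bigD1 (Ordinal h)) //= leq_addr.
Qed.

Lemma m_le_poly s : m_ n s <= s.+1 ^ n.
Proof.
rewrite -size_low_degree -[X in X ^ n]card_ord -[X in _ ^ X]card_ord -card_ffun cardE.
rewrite -(size_map (@box_index n s)); apply: uniq_leq_size; first exact: low_degree_uniq.
move=> k; rewrite mem_low_degree => ks; apply/mapP.
have le v : k v < s.+1 by apply: leq_ltn_trans (mdeg_ge k v) ks.
exists [ffun v => Ordinal (le v)]; first by rewrite mem_enum.
by apply/ffunP => v; rewrite !ffunE.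
Qed.

End Counting.

(** * Upper limits *)

Section UpperLimits.
Variable R : realType.
Local Open Scope ereal_scope.
Implicit Types (u : (\bar R)^nat) (x : \bar R).

Lemma limn_esup_le u x N : (forall k, (N <= k)%N -> u k <= x) -> limn_esup u <= x.
Proof.
move=> h; apply: le_trans (_ : ereal_sup (u @` [set k | (N <= k)%N]) <= _).
  by apply: ereal_inf_lbound; exists [set k | (N <= k)%N] => //; exists N.
by apply: ge_ereal_sup => _ [k /= Nk <-]; apply: h.
Qed.

Lemma limn_esup_ge u x : (forall N, exists2 k, (N <= k)%N & x <= u k) -> x <= limn_esup u.
Proof.
move=> h; apply: le_ereal_inf_tmp => _ [A [N _ NA] <-].
have [k Nk xk] := h N; apply: le_trans xk _.
by apply: ereal_sup_ubound; exists k => //; apply: NA.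
Qed.

Lemma limn_esup_gt u x : x < limn_esup u -> forall N, exists2 k, (N <= k)%N & x < u k.
Proof.
move=> xu N; apply: contrapT => h; move: xu; rewrite ltNge => /negP; apply.
apply: (@limn_esup_le _ _ N) => k Nk; rewrite leNgt; apply/negP => xk.
by apply: h; exists k.
Qed.

Lemma limn_esup_lt u x : limn_esup u < x -> exists N, forall k, (N <= k)%N -> u k < x.
Proof.
move=> ux; apply: contrapT => h; move: ux; rewrite ltNge => /negP; apply.
apply: limn_esup_ge => N; apply: contrapT => h'; apply: h; exists N => k Nk.
by rewrite ltNge; apply/negP => xk; apply: h'; exists k.
Qed.

End UpperLimits.

(** * Vandermonde and Hankel determinants on a bounded set *)

Section Vandermonde.
Variables (R : realType) (n : nat) (K : set 'rV[R[i]]_n) (B : R).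
Hypothesis n_gt0 : (0 < n)%N.
Hypotheses (B1 : 1 <= B) (KB : forall z, K z -> forall v, normc (z 0 v) <= B).
Local Notation C := R[i].
Local Notation Cn := 'rV[R[i]]_n.
Local Notation kidx := (kidx n).

Lemma e_bound i z : K z -> normc (e_ i z) <= B ^+ mdeg (kidx i).
Proof. by move=> Kz; apply: normc_monomial_le; apply: KB. Qed.

Lemma V_has_ubound i : has_ubound [set normc (vandermonde zeta) | zeta in
        [set zeta : 'I_i -> Cn | forall beta, K (zeta beta)]].
Proof.
exists (\sum_(s : 'S_i) \prod_(alpha < i) B ^+ mdeg (kidx alpha)) => _ [zeta /= hz <-].
apply: le_trans (normc_sum _ _ _) _; apply: ler_sum => s _.
rewrite normcM normcX normcN normc1 expr1n mul1r normc_prod.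
by apply: ler_prod => alpha _; rewrite normc_ge0 mxE /= e_bound.
Qed.

Lemma V_ge i (zeta : 'I_i -> Cn) : (forall beta, K (zeta beta)) ->
  normc (vandermonde zeta) <= V_ K i.
Proof. by move=> hz; apply: ub_le_sup; [exact: V_has_ubound | exists zeta]. Qed.

Lemma V_ge0 i : 0 <= V_ K i.
Proof.
rewrite /V_; set S := (X in sup X).
have [->|/set0P [_ [zeta hz _]]] := eqVneq S set0; first by rewrite sup0.
exact: le_trans (normc_ge0 _) (V_ge hz).
Qed.

Lemma V_le i (b : R) : 0 <= b ->
  (forall zeta : 'I_i -> Cn, (forall beta, K (zeta beta)) -> normc (vandermonde zeta) <= b) ->
  V_ K i <= b.
Proof.
move=> b0 h; rewrite /V_; set S := (X in sup X).
have [->|/set0P S0] := eqVneq S set0; first by rewrite sup0.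
by apply: ge_sup => // _ [zeta hz <-]; apply: h.
Qed.

Lemma V_gt i (b : R) : 0 <= b -> b < V_ K i ->
  exists2 zeta : 'I_i -> Cn, (forall beta, K (zeta beta)) & b < normc (vandermonde zeta).
Proof.
move=> b0 bV; apply: contrapT => h; move: bV; rewrite ltNge => /negP; apply.
apply: V_le => // zeta hz; rewrite leNgt; apply/negP => hb.
by apply: h; exists zeta.
Qed.

(** Laplace expansion along the row of the last monomial. *)
Lemma V_S i : V_ K i.+1 <= i.+1%:R * B ^+ mdeg (kidx i) * V_ K i.
Proof.
have B0 : 0 <= B by apply: le_trans B1.
apply: V_le => [|zeta hz]; first by rewrite !mulr_ge0 ?V_ge0 ?exprn_ge0.
rewrite /vandermonde (expand_det_row _ ord_max).
apply: le_trans (normc_sum _ _ _) _.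
apply: le_trans (_ : \sum_(beta < i.+1) B ^+ mdeg (kidx i) * V_ K i <= _); last first.
  by rewrite sumr_const card_ord -mulrA mulr_natl.
apply: ler_sum => beta _; rewrite normcM mxE; apply: ler_pM; rewrite ?normc_ge0 //.
  exact: e_bound.
rewrite /cofactor normcM normcX normcN normc1 expr1n mul1r.
apply: le_trans (@V_ge i (fun gamma => zeta (lift beta gamma)) _) => //.
rewrite le_eqVlt; apply/orP; left; apply/eqP; congr (normc (\det _)).
apply/matrixP => alpha gamma; rewrite !mxE; congr (e_ _ _).
by rewrite /= /bump leqNgt ltn_ord add0n.
Qed.

(** By [det_gram], i! times the Hankel determinant is a sum over i-tuples of nodes whose total
    weight is the i-th power of the mass. *)
Lemma hankel_finite_bound i J (c : 'I_J -> C) (zeta : 'I_J -> Cn) (M : R) :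
  (forall j, K (zeta j)) -> \sum_j normc (c j) <= M ->
  normc (hankel (fun k => \sum_j c j * monomial k (zeta j)) i) <= M ^+ i * V_ K i ^+ 2.
Proof.
move=> hz hM.
pose u (alpha : 'I_i) j := e_ alpha (zeta j).
have hE : hankel (fun k => \sum_j c j * monomial k (zeta j)) i =
   \det (\matrix_(alpha < i, beta < i) \sum_j c j * u alpha j * u beta j).
  congr (\det _); apply/matrixP => alpha beta; rewrite !mxE; apply: eq_bigr => j _.
  rewrite -mulrA; congr (_ * _); rewrite /u /e_ /monomial -big_split /=.
  by apply: eq_bigr => v _; rewrite ffunE exprD.
have H0 : 0 <= normc (hankel (fun k => \sum_j c j * monomial k (zeta j)) i) := normc_ge0 _.
apply: le_trans (_ : normc (i`!%:R * hankel (fun k => \sum_j c j * monomial k (zeta j)) i) <= _).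
  by rewrite normcM normc_nat ler_peMl // ler1n fact_gt0.
rewrite hE det_gram; apply: le_trans (normc_sum _ _ _) _.
apply: le_trans (_ : \sum_(phi : {ffun 'I_i -> 'I_J}) (\prod_alpha normc (c (phi alpha))) * V_ K i ^+ 2 <= _).
  apply: ler_sum => phi _; rewrite normcM normc_prod normcX.
  apply: ler_wpM2l; first by apply: prodr_ge0 => alpha _; apply: normc_ge0.
  by rewrite lerXn2r ?nnegrE ?normc_ge0 ?V_ge0 //; apply: V_ge.
rewrite -mulr_suml; apply: ler_wpM2r; first exact: sqr_ge0.
rewrite -(bigA_distr_bigA (fun (alpha : 'I_i) j => normc (c j))) prodr_const card_ord.
have s0 : 0 <= \sum_j normc (c j) by apply: sumr_ge0 => j _; apply: normc_ge0.
by rewrite lerXn2r ?nnegrE // (le_trans s0).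
Qed.

End Vandermonde.

(** * Growth of sequences *)

Section Growth.
Variable R : realType.
Implicit Types (x e q : R).

Lemma powR_root_exp x l : 0 <= x -> (0 < l)%N -> (x `^ l%:R^-1) ^+ l = x.
Proof.
move=> x0 l0; rewrite -powR_mulrn ?powR_ge0 // -powRrM mulVf ?powRr1 //.
by rewrite pnatr_eq0 -lt0n.
Qed.

Lemma powR_root_le x e l : 0 <= x -> 0 <= e -> (0 < l)%N ->
  (x `^ l%:R^-1 <= e) = (x <= e ^+ l).
Proof.
move=> x0 e0 l0; rewrite -[in RHS](powR_root_exp x0 l0).
by rewrite ler_pXn2r // nnegrE powR_ge0.
Qed.

Lemma powR_root_lt x e l : 0 <= x -> 0 <= e -> (0 < l)%N ->
  (e < x `^ l%:R^-1) = (e ^+ l < x).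
Proof. by move=> x0 e0 l0; rewrite !ltNge powR_root_le. Qed.

Lemma powR_root_ge x e l : 0 <= x -> 0 <= e -> (0 < l)%N ->
  (e <= x `^ l%:R^-1) = (e ^+ l <= x).
Proof.
move=> x0 e0 l0; rewrite -[in RHS](powR_root_exp x0 l0).
by rewrite ler_pXn2r // nnegrE powR_ge0.
Qed.

Lemma exp_ge_linear (h : R) T : 0 <= h -> 1 + T%:R * h <= (1 + h) ^+ T.
Proof.
move=> h0; elim: T => [|T IH]; first by rewrite mul0r addr0 expr0.
rewrite exprS; apply: le_trans (_ : (1 + h) * (1 + T%:R * h) <= _).
  rewrite -natr1; have : 0 <= T%:R * h * h by rewrite !mulr_ge0.
  lra.
by rewrite ler_wpM2l //; lra.
Qed.

Lemma exp_eventually_ge (A q : R) : 1 < q -> exists N, forall T, (N <= T)%N -> A <= q ^+ T.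
Proof.
move=> q1; exists (Num.truncn (`|A| / (q - 1))).+1 => T NT.
have h0 : 0 < q - 1 by lra.
have := exp_ge_linear T (ltW h0); rewrite (_ : 1 + (q - 1) = q); last by ring.
move=> h; apply: le_trans h.
have : `|A| / (q - 1) <= T%:R.
  by apply: le_trans (ltW (truncnS_gt _)) _; rewrite ler_nat.
rewrite ler_pdivrMr // => h; have := ler_norm A; lra.
Qed.

(** With q = r^(2 n), it suffices that r^(2 s) dominates s, and this follows from Bernoulli's
    inequality for r^s, squared. *)
Lemma exp_beats_poly n (d q : R) : (0 < n)%N -> 0 < d -> 1 < q ->
  exists N, forall s, (N <= s)%N -> s.+1%:R ^+ n < d * q ^+ s.
Proof.
move=> n0 d0 q1; pose r := q `^ (2 * n)%:R^-1.
have n20 : (0 < 2 * n)%N by rewrite muln_gt0.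
have q0 : 0 <= q by lra.
have rq : r ^+ (2 * n) = q by apply: powR_root_exp.
have r1 : 1 < r by rewrite powR_root_lt // expr1n.
pose h := r - 1; have h0 : 0 < h by rewrite /h; lra.
pose e := Num.min 1 (d / 2).
have e0 : 0 < e by rewrite lt_min ltr01 divr_gt0.
have ed : e ^+ n < d.
  apply: le_lt_trans (_ : e < d); last by rewrite gt_min; apply/orP; right; lra.
  rewrite -[leRHS]expr1; apply: ler_wiXn2l => //; first exact: ltW.
  by rewrite ge_min lexx.
exists (Num.truncn (2 / (e * h ^+ 2))).+1 => s Ns.
have s1 : (1 <= s%:R :> R) by rewrite ler1n (leq_trans _ Ns).
have hs : 2 <= s%:R * (e * h ^+ 2).
  rewrite -ler_pdivrMr ?mulr_gt0 ?exprn_gt0 //.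
  by apply: le_trans (ltW (truncnS_gt _)) _; rewrite ler_nat.
have h1 : s.+1%:R <= e * (r ^+ s) ^+ 2.
  have h2 : s%:R * h <= r ^+ s.
    by have := exp_ge_linear s (ltW h0); rewrite /h [1 + (r - 1)]addrC subrK; lra.
  apply: le_trans (_ : e * (s%:R * h) ^+ 2 <= _); last first.
    by rewrite ler_wpM2l ?(ltW e0) // lerXn2r ?nnegrE // ?mulr_ge0 // ?exprn_ge0 // ltW //; lra.
  rewrite -natr1; apply: le_trans (_ : s%:R * 2 <= _); first lra.
  rewrite (_ : e * (s%:R * h) ^+ 2 = s%:R * (s%:R * (e * h ^+ 2))); last by ring.
  by rewrite ler_wpM2l.
apply: le_lt_trans (_ : (e * (r ^+ s) ^+ 2) ^+ n < _).
  by rewrite lerXn2r ?nnegrE // (le_trans _ h1).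
rewrite exprMn -!exprM -rq -exprM (_ : (s * 2 * n = 2 * n * s)%N); last by rewrite -mulnA mulnC.
by rewrite ltr_pM2r // exprn_gt0 //; lra.
Qed.

End Growth.

(** * The upper bound for Hankel determinants *)

Section PolyaInequality.
Variables (R : realType) (n : nat) (K : set 'rV[R[i]]_n) (B : R).
Hypothesis n_gt0 : (0 < n)%N.
Hypotheses (B1 : 1 <= B) (KB : forall z, K z -> forall v, normc (z 0 v) <= B).
Local Notation C := R[i].
Local Notation kidx := (kidx n).

(** Each of the at most N_(s+1) steps inside a degree costs a factor m_(s+1) B^(s+1); the total cost
    has an exponent of order s N_s, negligible with respect to l_s. *)
Lemma V_within_degree s p : (p <= N_ n s.+1)%N ->
  V_ K (m_ n s + p) <= ((m_ n s.+1)%:R * B ^+ s.+1) ^+ p * V_ K (m_ n s).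
Proof.
have hB := B1; elim: p => [_|p IH ph]; first by rewrite addn0 expr0 mul1r.
rewrite addnS; apply: le_trans (V_S B1 KB _) _.
rewrite exprS -[leRHS]mulrA; apply: ler_pM.
- by rewrite mulr_ge0 // exprn_ge0 //; lra.
- exact: (V_ge0 KB).
- apply: ler_pM => //; first by rewrite exprn_ge0 //; lra.
    by rewrite ler_nat m_S // -addnS leq_add2l.
  rewrite ler_weXn2l // mdeg_kidx_le // m_S // ltn_add2l //.
- exact: IH (ltnW ph).
Qed.

Lemma transfinite_diameter_ge0 : (0 <= transfinite_diameter K)%E.
Proof.
apply: limn_esup_ge => N; exists N => //.
by rewrite lee_fin powR_ge0.
Qed.

Lemma degree_count_le s : (m_ n s.+1)%:R * B ^+ s.+1 <= (2 ^+ n.+1 * B) ^+ s.+1.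
Proof.
have B0 : 0 <= B by apply: le_trans B1.
rewrite exprMn; apply: ler_wpM2r; first exact: exprn_ge0.
have : (m_ n s.+1 <= 2 ^ (n.+1 * s.+1))%N.
  apply: leq_trans (m_le_exp n_gt0 _) _; rewrite leq_exp2l //.
  by rewrite mulSn leq_add2l leq_pmulr.
by rewrite -(ler_nat R) natrX exprM.
Qed.

(** Up to the power s + 1, this is the bound |H|^(1/(2 l)) <= A^(1/(2 (s + 1))) e with A independent
    of s; raising to that power keeps all exponents integral. The factor max (1, 1/e) pays for
    replacing l_s by l_(s+1) in the exponent of e when e < 1. *)
Lemma hankel_growth (M e : R) s i (H : R) : 1 <= M -> 0 < e -> 0 <= H ->
  H <= M ^+ i.+1 * V_ K i.+1 ^+ 2 -> mdeg (kidx i) = s.+1 ->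
  V_ K (m_ n s) <= e ^+ l_ n s ->
  H ^+ s.+1 <= (M ^+ 2 * (2 ^+ n.+1 * B) ^+ (2 * n.+1) * Num.max 1 e^-1 ^+ (2 * n.+1) *
     e ^+ (2 * s.+1)) ^+ l_ n s.+1.
Proof.
move=> M1 e0 H0 hH di hV; have hB := B1.
set T := s.+1; set G := 2 ^+ n.+1 * B; set E := Num.max 1 e^-1.
have G1 : 1 <= G by apply: mulr_ege1 => //; apply: exprn_ege1; rewrite ler1n.
have E1 : 1 <= E by rewrite le_max lexx.
have eE : 1 <= e * E.
  have en : e != 0 by rewrite gt_eqF.
  by rewrite -[leLHS](mulfV en) ler_wpM2l ?(ltW e0) // le_max lexx orbT.
have iT : (i < m_ n T)%N by rewrite -mdeg_kidx_le // di.
have is_ : (m_ n s <= i)%N by rewrite leqNgt -mdeg_kidx_le // di ltnn.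
pose p := (i.+1 - m_ n s)%N.
have ip : i.+1 = (m_ n s + p)%N by rewrite /p subnKC // ltnW.
have pN : (p <= N_ n T)%N by rewrite -(leq_add2l (m_ n s)) -ip -m_S.
have mT1 : 1 <= (m_ n T)%:R * B ^+ T.
  by apply: mulr_ege1; [rewrite ler1n m_gt0 | apply: exprn_ege1].
have mG : (m_ n T)%:R * B ^+ T <= G ^+ T by exact: degree_count_le.
have M0 : 0 <= M by apply: le_trans M1.
have G0 : 0 <= G by apply: le_trans G1.
have e00 := ltW e0.
have m0 : 0 <= (m_ n T)%:R * B ^+ T by apply: le_trans mT1.
have X0 : H <= M ^+ m_ n T * (G ^+ (T * N_ n T) * e ^+ l_ n s) ^+ 2.
  apply: le_trans hH _; apply: ler_pM.
  - exact: exprn_ge0.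
  - exact: sqr_ge0.
  - exact: ler_weXn2l.
  have V0 : 0 <= V_ K i.+1 by apply: (V_ge0 KB).
  apply: lerXn2r; rewrite ?nnegrE //; first by rewrite mulr_ge0 // exprn_ge0.
  rewrite ip; apply: le_trans (V_within_degree pN) _; apply: ler_pM => //.
  - exact: exprn_ge0.
  - exact: (V_ge0 KB).
  apply: le_trans (_ : ((m_ n T)%:R * B ^+ T) ^+ N_ n T <= _); first exact: ler_weXn2l.
  by rewrite exprM; apply: lerXn2r; rewrite ?nnegrE // exprn_ge0.
apply: le_trans (_ : (M ^+ m_ n T * (G ^+ (T * N_ n T) * e ^+ l_ n s) ^+ 2) ^+ T <= _).
  by rewrite lerXn2r ?nnegrE // (le_trans H0).
have lT : l_ n T = (l_ n s + T * N_ n T)%N by apply: l_S.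
have inc : (T * (T * N_ n T) <= n.+1 * l_ n T)%N by apply: l_increment.
have lge : (T * m_ n T <= 2 * l_ n T)%N by apply: l_ge.
set P := (T * N_ n T)%N in lT inc *; set l := l_ n T in lT inc lge *.
have P2 : (P * (2 * T) <= 2 * n.+1 * l)%N.
  by rewrite mulnCA -[leqRHS]mulnA leq_mul2l /= mulnC.
have h1 : (M ^+ m_ n T) ^+ T <= (M ^+ 2) ^+ l.
  by rewrite -!exprM ler_weXn2l // mulnC.
have h2 : (G ^+ P) ^+ (2 * T) <= (G ^+ (2 * n.+1)) ^+ l.
  by rewrite -!exprM; apply: ler_weXn2l.
have h3 : (e ^+ l_ n s) ^+ (2 * T) <= (E ^+ (2 * n.+1)) ^+ l * (e ^+ (2 * T)) ^+ l.
  rewrite -!exprM.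
  apply: le_trans (_ : e ^+ (l_ n s * (2 * T)) * (e * E) ^+ (P * (2 * T)) <= _).
    by apply: ler_peMr; [exact: exprn_ge0 | exact: exprn_ege1].
  rewrite exprMn mulrA -exprD -mulnDl -lT [leRHS]mulrC [(2 * T * l)%N]mulnC.
  by apply: ler_wpM2l; [exact: exprn_ge0 | exact: ler_weXn2l].
have -> : (M ^+ m_ n T * (G ^+ P * e ^+ l_ n s) ^+ 2) ^+ T =
    (M ^+ m_ n T) ^+ T * ((G ^+ P) ^+ (2 * T) * (e ^+ l_ n s) ^+ (2 * T)).
  by rewrite exprMn -[in LHS](exprM _ 2 T) exprMn.
have -> : (M ^+ 2 * G ^+ (2 * n.+1) * E ^+ (2 * n.+1) * e ^+ (2 * T)) ^+ l =
  (M ^+ 2) ^+ l * ((G ^+ (2 * n.+1)) ^+ l * ((E ^+ (2 * n.+1)) ^+ l * (e ^+ (2 * T)) ^+ l)).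
  by rewrite !exprMn -!mulrA.
apply: ler_pM => //; first by rewrite !exprn_ge0.
  by rewrite mulr_ge0 // !exprn_ge0.
by apply: ler_pM => //; rewrite !exprn_ge0.
Qed.

(** For d(K) < e < x, the factor A of [hankel_growth] is at most (x / e)^(2 (s + 1)) for s large. *)
Lemma polya_inequality (a : mindex n -> C) (M : R) : 1 <= M ->
  (forall i, normc (hankel a i) <= M ^+ i * V_ K i ^+ 2) ->
  (D_ a <= transfinite_diameter K)%E.
Proof.
move=> M1 hH; have hB := B1.
suff main (x : R) : (transfinite_diameter K < x%:E -> D_ a <= x%:E)%E.
  case E : (transfinite_diameter K) transfinite_diameter_ge0 => [d| |] // _.
    by apply/lee_addgt0Pr => e e0; apply: main; rewrite E lte_fin ltrDl.
  exact: leey.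
move=> dx; have := transfinite_diameter_ge0.
have [y [dy yx]] : exists y : R, (transfinite_diameter K <= y%:E)%E /\ y < x.
  move: dx transfinite_diameter_ge0; case: (transfinite_diameter K) => [d| |] // dx _.
  by exists d; split=> //; rewrite -lte_fin.
move=> d0; have y0 : 0 <= y by rewrite -lee_fin (le_trans d0).
pose e := (x + y) / 2; have e0 : 0 < e by rewrite /e; lra.
have ex : e < x by rewrite /e; lra.
have /limn_esup_lt [S hS] : (transfinite_diameter K < e%:E)%E.
  by apply: le_lt_trans dy _; rewrite lte_fin /e; lra.
pose A := M ^+ 2 * (2 ^+ n.+1 * B) ^+ (2 * n.+1) * Num.max 1 e^-1 ^+ (2 * n.+1).
have A0 : 0 <= A.
  apply: mulr_ge0; first apply: mulr_ge0; apply: exprn_ge0.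
  - exact: le_trans M1.
  - by apply: mulr_ge0; [exact: exprn_ge0 | exact: le_trans hB].
  - by rewrite le_max ler01.
have q1 : 1 < (x / e) ^+ 2 by rewrite exprn_egt1 // ltr_pdivlMr // mul1r.
have [N hN] := exp_eventually_ge A q1.
pose s0 := maxn (maxn S N) 1.
apply: (@limn_esup_le _ _ _ (m_ n s0)) => i hi.
have : (s0 < mdeg (kidx i))%N by rewrite ltnNge mdeg_kidx_le // -leqNgt.
case di : (mdeg (kidx i)) => [//|s]; rewrite ltnS !geq_max => /andP[/andP[Ss Ns] s1].
have l0 : (0 < l_ n s)%N by apply: l_gt0.
have lT0 : (0 < l_ n s.+1)%N by apply: l_gt0.
have x0 : 0 <= x by lra.
rewrite lee_fin powR_root_le ?normc_ge0 ?muln_gt0 //.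
have hV : V_ K (m_ n s) <= e ^+ l_ n s.
  have := hS s Ss; rewrite lte_fin => /ltW.
  by rewrite powR_root_le ?(ltW e0) // (V_ge0 KB).
have := hankel_growth M1 e0 (normc_ge0 _) (hH i.+1) di hV.
rewrite -/A => hg; rewrite -(ler_pXn2r (_ : 0 < s.+1)%N) ?nnegrE ?normc_ge0 ?exprn_ge0 //.
apply: le_trans hg _.
rewrite (_ : (x ^+ (2 * l_ n s.+1)) ^+ s.+1 = (x ^+ (2 * s.+1)) ^+ l_ n s.+1); last first.
  by rewrite -!exprM mulnAC.
have AT : A <= (x / e) ^+ (2 * s.+1) by rewrite exprM; apply: hN; apply: leqW.
rewrite lerXn2r ?nnegrE ?exprn_ge0 //.
  by apply: mulr_ge0 => //; apply: exprn_ge0; apply: ltW.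
apply: le_trans (_ : (x / e) ^+ (2 * s.+1) * e ^+ (2 * s.+1) <= _).
  by rewrite ler_wpM2r ?exprn_ge0 ?(ltW e0).
by rewrite -exprMn divfK // gt_eqF.
Qed.

End PolyaInequality.

(** * Construction of an extremal functional *)

Section HankelLimits.
Variables (R : realType) (n : nat).
Local Notation C := R[i].

Lemma clim_subsequence (u : nat -> C) l (g : nat -> nat) : (forall m, (m <= g m)%N) ->
  clim u l -> clim (u \o g) l.
Proof.
move=> hg h e e0; have [N hN] := h e e0; exists N => k Nk.
by apply: hN; apply: leq_trans Nk (hg k).
Qed.

Lemma hankel_clim (b : nat -> mindex n -> C) (a : mindex n -> C) i :
  (forall k, clim (b^~ k) (a k)) -> clim (fun N => hankel (b N) i) (hankel a i).
Proof.
move=> h; apply: clim_sum => s _; apply: climM; first exact: clim_cst.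
apply: clim_prod => alpha _; rewrite mxE.
by under [X in clim X]eq_fun do rewrite mxE; apply: h.
Qed.

End HankelLimits.

Section Construction.
Variables (R : realType) (n : nat) (K : set 'rV[R[i]]_n) (B : R).
Hypothesis n_gt0 : (0 < n)%N.
Hypotheses (B1 : 1 <= B) (KB : forall z, K z -> forall v, normc (z 0 v) <= B).
Local Notation C := R[i].
Local Notation Cn := 'rV[R[i]]_n.
Local Notation kidx := (kidx n).
Local Notation d := (transfinite_diameter K).

Lemma monomial_bound (k : mindex n) z : K z -> normc (monomial k z) <= B ^+ mdeg k.
Proof. by move=> Kz; apply: normc_monomial_le; apply: KB. Qed.

Lemma moments_clim (c : nat -> C) (zeta : nat -> Cn) (M : R) k :
  (forall j, K (zeta j)) -> summable_by c M ->
  clim (fun N => \sum_(j < N) c j * monomial k (zeta j)) (moments c zeta k).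
Proof.
move=> Kz sc; apply: (@csumP _ (fun j => c j * monomial k (zeta j)) (M * B ^+ mdeg k)).
apply: (@summable_byM _ c (fun j => monomial k (zeta j))) => // [|j]; last exact: monomial_bound.
by apply: exprn_ge0; apply: le_trans B1.
Qed.

Lemma moments_hankel_bound (c : nat -> C) (zeta : nat -> Cn) (M : R) i :
  (forall j, K (zeta j)) -> summable_by c M ->
  normc (hankel (moments c zeta) i) <= M ^+ i * V_ K i ^+ 2.
Proof.
move=> Kz sc; have lim := hankel_clim i (fun k => moments_clim k Kz sc).
rewrite -[X in normc X]subr0; apply: (clim_le lim); exists 0%N => N _; rewrite subr0.
exact: (@hankel_finite_bound _ _ _ _ KB i N (fun j => c j) (fun j => zeta j)).
Qed.

Lemma D_moments_le (c : nat -> C) (zeta : nat -> Cn) :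
  (forall j, K (zeta j)) -> summable_by c 1 -> (D_ (moments c zeta) <= d)%E.
Proof.
move=> Kz sc; apply: (polya_inequality n_gt0 B1 KB (lexx 1)) => i.
exact: moments_hankel_bound.
Qed.

Local Notation node := (C * Cn)%type.
Implicit Types (l t : seq node).

(** Finite sets of nodes are lists of pairs (weight, point): a block is added by concatenation. *)
Definition node_moments l (k : mindex n) : C := \sum_(p <- l) p.1 * monomial k p.2.

Definition mass l : R := \sum_(p <- l) normc p.1.

Definition nodes_in l : Prop := forall p, p \in l -> K p.2.

Lemma nodes_in_cat l t : nodes_in l -> nodes_in t -> nodes_in (l ++ t).
Proof. by move=> hl ht p; rewrite mem_cat => /orP[/hl|/ht]. Qed.

Lemma mass_cat l t : mass (l ++ t) = mass l + mass t.
Proof. exact: big_cat. Qed.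

Lemma node_moments_le t k : nodes_in t -> normc (node_moments t k) <= mass t * B ^+ mdeg k.
Proof.
move=> ht; apply: le_trans (normc_sum _ _ _) _; rewrite mulr_suml !big_seq.
apply: ler_sum => p pt; rewrite normcM; apply: ler_wpM2l; first exact: normc_ge0.
by apply: monomial_bound; apply: ht.
Qed.

(** Otherwise lists of nodes of mass tending to 0 could be added while the determinant stays below
    x; in the limit the determinant of l itself would be at most x. *)
Lemma hankel_stable l i (x : R) : x < normc (hankel (node_moments l) i) ->
  exists2 e : R, 0 < e & forall t, nodes_in t -> mass t <= e ->
    x <= normc (hankel (node_moments (l ++ t)) i).
Proof.
move=> hx; apply: contrapT => hN.
have bad m : exists t, [/\ nodes_in t, mass t <= m.+1%:R^-1 &
    normc (hankel (node_moments (l ++ t)) i) < x].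
  apply: contrapT => h; apply: hN; exists m.+1%:R^-1; first by rewrite invr_gt0.
  move=> t ht mt; rewrite leNgt; apply/negP => tx; apply: h; by exists t.
have /choice [t ht] := bad.
have lim : clim (fun m => hankel (node_moments (l ++ t m)) i) (hankel (node_moments l) i).
  apply: hankel_clim => k e e0.
  have Bk0 : 0 < B ^+ mdeg k by apply: exprn_gt0; apply: lt_le_trans B1.
  exists (Num.truncn (B ^+ mdeg k / e)) => m hm.
  rewrite /node_moments big_cat /= addrAC subrr add0r.
  have [h1 h2 _] := ht m; apply: le_trans (node_moments_le k h1) _.
  apply: le_trans (ler_wpM2r (ltW Bk0) h2) _.
  rewrite mulrC ler_pdivrMr // -ler_pdivrMl // mulrC.
  by apply: le_trans (ltW (truncnS_gt _)) _; rewrite ler_nat ltnS.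
have : normc (hankel (node_moments l) i) <= x.
  rewrite -[X in normc X]subr0; apply: (clim_le lim); exists 0%N => m _; rewrite subr0.
  by have [_ _ /ltW] := ht m.
by rewrite leNgt hx.
Qed.

Lemma lt_transfinite_diameter (y : R) : (y%:E < d)%E -> exists2 y' : R, y < y' & (y'%:E < d)%E.
Proof.
case: d => [x| |] //; rewrite ?lte_fin => h.
  by exists ((x + y) / 2); rewrite ?lte_fin; lra.
by exists (y + 1); [lra | rewrite ltry].
Qed.

(** The new block consists of m_s points with a Vandermonde determinant larger than y'^(l_s), where
    y < y' < d(K), all with the same weight t of modulus e / m_s. The loss (e / m_s)^(m_s) is
    compensated by (y' / y)^(2 l_s) when s is large, because s m_s <= 2 l_s. *)
Lemma add_nodes l (e y : R) k : nodes_in l -> 0 < e -> 0 < y -> (y%:E < d)%E ->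
  exists new i, [/\ nodes_in new, mass new <= e, (0 < size new)%N &
    [/\ (k <= i)%N, (0 < mdeg (kidx i))%N &
      y ^+ (2 * l_ n (mdeg (kidx i))) < normc (hankel (node_moments (l ++ new)) i.+1)]].
Proof.
move=> hl e0 y0 yd; have [y' yy' y'd] := lt_transfinite_diameter yd.
have y'0 : 0 < y' by apply: lt_trans yy'.
have q1 : 1 < y' / y by rewrite ltr_pdivlMr // mul1r.
have [N hN] := exp_beats_poly n_gt0 e0 q1.
have [s] := limn_esup_gt y'd (maxn N (mdeg (kidx k)).+1).
rewrite geq_max => /andP[Ns ks].
have s0 : (0 < s)%N by apply: leq_ltn_trans ks.
have l0 : (0 < l_ n s)%N by apply: l_gt0.
rewrite lte_fin powR_root_lt ?(V_ge0 KB) ?(ltW y'0) // => /V_gt.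
case; first by rewrite exprn_ge0 // ltW.
set m := m_ n s => zeta Kz hV; have m0 : (0 < m)%N := m_gt0 n s.
have mR0 : 0 < m%:R :> R by rewrite ltr0n.
pose w := e / m%:R; have w0 : 0 < w by rewrite divr_gt0.
pose U : 'M[C]_m := \matrix_(alpha < m, beta < m) e_ alpha (zeta beta).
have dU : 0 < normc (\det U) by apply: lt_trans hV; rewrite exprn_gt0.
have dU0 : \det U != 0 by rewrite -normc_eq0 gt_eqF.
pose A : 'M[C]_m := \matrix_(alpha < m, beta < m) node_moments l (kidx alpha + kidx beta).
have [t tw ht] := det_perturbation A w0 dU0.
pose new : seq node := [seq (t, zeta beta) | beta <- enum 'I_m].
have newE (F : node -> C) : \sum_(p <- new) F p = \sum_beta F (t, zeta beta).
  by rewrite big_map big_enum.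
have hankelE : hankel (node_moments (l ++ new)) m = \det (A + t *: (U *m U^T)).
  congr (\det _); apply/matrixP => alpha beta; rewrite !mxE /node_moments big_cat /=.
  congr (_ + _); rewrite newE mulr_sumr; apply: eq_bigr => gamma _; rewrite !mxE /=.
  congr (_ * _); rewrite /e_ /monomial -big_split /=; apply: eq_bigr => v _.
  by rewrite ffunE exprD.
exists new, m.-1; rewrite mdeg_kidx_last // prednK //; split.
- by move=> p /mapP[beta _ ->]; apply: Kz.
- rewrite /mass big_map big_enum /= sumr_const card_ord tw -mulr_natr /w divfK //.
  by rewrite gt_eqF.
- by rewrite size_map size_enum_ord.
split=> //.
  rewrite leqNgt; apply/negP => mk; have := mdeg_kidx_mono n_gt0 (ltnW mk).
  by rewrite mdeg_kidx_last // leqNgt ks.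
rewrite hankelE; apply: lt_le_trans ht.
apply: lt_trans (_ : w ^+ m * (y' ^+ l_ n s) ^+ 2 < _); last first.
  rewrite ltr_pM2l ?exprn_gt0 // ltrXn2r // ?nnegrE ?normc_ge0 //.
  by rewrite exprn_ge0 // ltW.
have y'E : (y' ^+ l_ n s) ^+ 2 = (y' / y) ^+ (2 * l_ n s) * y ^+ (2 * l_ n s).
  by rewrite -exprMn divfK ?gt_eqF // -exprM mulnC.
rewrite y'E mulrA ltr_pMl ?exprn_gt0 //.
have wq : 1 < w * (y' / y) ^+ s.
  rewrite /w mulrAC ltr_pdivlMr // mul1r; apply: le_lt_trans (hN s Ns).
  by rewrite -natrX ler_nat m_le_poly.
apply: lt_le_trans (_ : (w * (y' / y) ^+ s) ^+ m <= _).
  by rewrite exprn_egt1 // -lt0n.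
rewrite exprMn ler_wpM2l ?exprn_ge0 ?(ltW w0) // -exprM.
by apply: ler_weXn2l; [exact: ltW | exact: l_ge].
Qed.

Section Recursion.
Variable y : nat -> R.
Hypotheses (y0 : forall k, 0 < y k) (yd : forall k, ((y k)%:E < d)%E).

(** A state consists of the nodes chosen so far and of the mass still available: the determinants
    already made large remain so under any addition within that mass. *)
Definition admissible (x : seq node * R) : Prop := nodes_in x.1 /\ 0 < x.2.

Definition improves k (x x' : seq node * R) : Prop :=
  [/\ admissible x', x'.2 <= x.2 / 2,
    exists new, [/\ x'.1 = x.1 ++ new, nodes_in new, mass new <= x.2 / 2 & (0 < size new)%N] &
    exists i, [/\ (k <= i)%N, (0 < mdeg (kidx i))%N & forall t, nodes_in t -> mass t <= x'.2 ->
      y k ^+ (2 * l_ n (mdeg (kidx i))) <= normc (hankel (node_moments (x'.1 ++ t)) i.+1)]].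

Lemma improve k x : exists x', admissible x -> improves k x x'.
Proof.
have [[hx e0]|hx] := pselect (admissible x); last by exists x.
have e20 : 0 < x.2 / 2 by rewrite divr_gt0.
have [new [i [h1 h2 h3 [h4 h5 /hankel_stable [e' e'0 h6]]]]] := add_nodes k hx e20 (y0 k) (yd k).
exists (x.1 ++ new, Num.min e' (x.2 / 2)) => _; split.
- by split=> /=; [exact: nodes_in_cat | rewrite lt_min e'0].
- by rewrite /= ge_min lexx orbT.
- by exists new.
- exists i; split=> // t ht; rewrite /= le_min => /andP[mt _].
  exact: h6.
Qed.

(** Each stage spends at most half of the available mass and leaves at most the other half, so that
    all the later stages together stay within the mass left. *)
Lemma extremal_nodes : exists (c : nat -> C) (zeta : nat -> Cn),
  [/\ forall j, K (zeta j), summable_by c 1 &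
    forall k, exists i, [/\ (k <= i)%N, (0 < mdeg (kidx i))%N &
      y k ^+ (2 * l_ n (mdeg (kidx i))) <= normc (hankel (moments c zeta) i.+1)]].
Proof.
(* The chosen lists extend one another, and the sequences of weights and points are read off
   from them. *)
have /choice [f hf] := fun p : nat * (seq node * R) => improve p.1 p.2.
pose st := fix st k : seq node * R := if k is k'.+1 then f (k', st k') else ([::], 1).
have adm k : admissible (st k).
  elim: k => [|k IH]; first by split.
  by have [] := hf (k, st k) IH.
have imp k : improves k (st k) (st k.+1) := hf (k, st k) (adm k).
have ext k m : exists t, [/\ (st (k + m)%N).1 = (st k).1 ++ t, nodes_in t &
    mass t <= (st k).2 - (st (k + m)%N).2].
  elim: m => [|m [t [h1 h2 h3]]].
    by exists [::]; rewrite addn0 cats0 subrr /mass big_nil; split.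
  have [_ h4 [new [h5 h6 h7 _]] _] := imp (k + m)%N.
  exists (t ++ new); rewrite addnS h5 h1 catA; split=> //; first exact: nodes_in_cat.
  rewrite mass_cat; lra.
have sz k : (k <= size (st k).1)%N.
  elim: k => // k IH; have [_ _ [new [-> _ _ h]] _] := imp k.
  by rewrite size_cat -addn1 leq_add.
(* This default is never reached: the list of stage j + 1 has a j-th entry. *)
pose def : node := (0, 0).
pose p j := nth def (st j.+1).1 j.
have pE m j : (j < size (st m).1)%N -> nth def (st m).1 j = p j.
  move=> jm; rewrite /p; have [mj|jm'] := leqP m j.+1.
    have [t [e _ _]] := ext m (j.+1 - m)%N; rewrite subnKC // in e.
    by rewrite e nth_cat jm.
  have [t [e _ _]] := ext j.+1 (m - j.+1)%N; rewrite subnKC in e; last exact: ltnW.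
  by rewrite e nth_cat (leq_trans _ (sz j.+1)).
have sumE (V : nmodType) (F : node -> V) m :
    \sum_(j < size (st m).1) F (p j) = \sum_(q <- (st m).1) F q.
  by rewrite (big_nth def) big_mkord; apply: eq_bigr => j _; rewrite pE.
have Kp j : K (p j).2.
  have [h _] := adm j.+1; apply: h; apply: mem_nth.
  exact: leq_trans (sz j.+1).
have sc : summable_by (fun j => (p j).1) 1.
  move=> N; apply: le_trans (_ : mass (st N).1 <= _).
    rewrite /mass -(sumE _ (fun q => normc q.1)) -(subnKC (sz N)) big_split_ord /=.
    by rewrite lerDl sumr_ge0 // => j _; apply: normc_ge0.
  have [t [h1 _ h2]] := ext 0%N N; rewrite add0n /= in h1 h2.
  by rewrite h1; apply: le_trans h2 _; have [_ /ltW] := adm N; lra.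
exists (fun j => (p j).1), (fun j => (p j).2); split=> // k.
have [_ _ _ [i [h1 h2 h3]]] := imp k; exists i; split=> //.
have lim := hankel_clim i.+1 (fun q => moments_clim q Kp sc).
apply: (clim_ge (clim_subsequence sz lim)); exists k.+1 => m km.
have [t [e1 e2 e3]] := ext k.+1 (m - k.+1)%N; rewrite subnKC // in e1 e3.
have mt : mass t <= (st k.+1).2.
  by apply: le_trans e3 _; have [_ /ltW] := adm m; lra.
apply: le_trans (h3 t e2 mt) _; rewrite -e1 /=.
rewrite le_eqVlt; apply/orP; left; apply/eqP; congr (normc (hankel _ _)).
by apply/funext => q; rewrite /node_moments -(sumE _ (fun r => r.1 * monomial q r.2)).
Qed.

End Recursion.

Lemma approximate_from_below (x : \bar R) : (0 < x)%E -> exists y : nat -> R,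
  [/\ forall k, 0 < y k, forall k, ((y k)%:E < x)%E, forall k m, (k <= m)%N -> y k <= y m &
    forall z, (z < x)%E -> exists k, (z < (y k)%:E)%E].
Proof.
case: x => [x| |] // x0; last first.
  exists (fun k => k.+1%:R); split=> [k|k|k m km|z]; rewrite ?ltry //.
    by rewrite ler_nat.
  case: z => [z| |] // _; last by exists 0%N; rewrite ltNyr.
  by exists (Num.truncn z); rewrite lte_fin truncnS_gt.
rewrite lte_fin in x0.
have i1 k : (k.+2%:R^-1 : R) < 1 by rewrite invf_lt1 // ltr1n.
have i0 k : 0 < (k.+2%:R^-1 : R) by rewrite invr_gt0.
exists (fun k => x * (1 - k.+2%:R^-1)); split=> [k|k|k m km|z].
- by rewrite mulr_gt0 // subr_gt0.
- by rewrite lte_fin -[ltRHS]mulr1 ltr_pM2l // ltrBlDr ltrDl.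
- rewrite ler_pM2l // lerD2l lerN2 lef_pV2 ?posrE // ler_nat !ltnS //.
case: z => [z| |] // zx; last by exists 0%N; rewrite ltNyr.
rewrite lte_fin in zx; exists (Num.truncn (x / (x - z))).
set k := Num.truncn _; rewrite lte_fin mulrBr mulr1 ltrBrDr -ltrBrDl.
rewrite ltr_pdivrMr // mulrC -ltr_pdivrMr ?subr_gt0 //.
apply: lt_trans (truncnS_gt _) _; rewrite ltr_nat //.
Qed.

(** If d(K) = 0 the zero functional is extremal; otherwise the stages of the construction aim at
    values increasing to d(K). *)
Lemma extremal_functional : K !=set0 -> exists (c : nat -> C) (zeta : nat -> Cn),
  [/\ forall j, K (zeta j), summable_by c 1 & D_ (moments c zeta) = d].
Proof.
move=> [z0 Kz0].
have [d0|] := ltP 0%E d; last first.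
  move=> d0; exists (fun=> 0), (fun=> z0); have s0 : summable_by (fun=> 0 : C) 1.
    by move=> N; rewrite big1 // => j _; apply: normc0.
  split; [by [] | exact: s0 |].
  apply/le_anti/andP; split; first exact: D_moments_le.
  apply: le_trans d0 _; apply: limn_esup_ge => N; exists N => //.
  by rewrite lee_fin powR_ge0.
have [y [y0 yd ymono ysup]] := approximate_from_below d0.
have [c [zeta [Kz sc hk]]] := extremal_nodes y0 yd.
exists c, zeta; split; [exact: Kz | exact: sc |].
apply/le_anti/andP; split; first exact: D_moments_le.
rewrite leNgt; apply/negP => /ysup [k /limn_esup_lt [N hN]].
have [i [Ni di hi]] := hk (maxn k N).
have := hN i (leq_trans (leq_maxr _ _) Ni); rewrite lte_fin ltNge => /negP; apply.
have ymk := ymono _ _ (leq_maxl k N).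
apply: le_trans ymk _; rewrite powR_root_ge ?normc_ge0 ?(ltW (y0 _)) //.
by rewrite muln_gt0 l_gt0.
Qed.

End Construction.

(** The zero function is plurisubharmonic. *)
Lemma pluripolar_set0 (R : realType) n : pluripolar (set0 : set 'rV[R[i]]_n).
Proof.
exists (fun=> 0%E); split; last by [].
- split=> [z|z a|a b].
  + by [].
  + by move=> h; exists setT => //; exact: filterT.
  + by rewrite integral0 mule0.
- by exists 0.
Qed.

Theorem proposition4p3 (R : realType) (n : nat) (n_gt0 : (0 < n)%N)
    (K : set 'rV[R[i]]_n) (Ks : nat -> set 'rV[R[i]]_n)
    (K_compact : compact K) (Ks_compact : forall i, compact (Ks i))
    (K_convex : polynomially_convex K)
    (Ks_convex : forall i, polynomially_convex (Ks i))
    (K_nonpluripolar : ~ pluripolar K)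
    (Ks_nonpluripolar : forall i, ~ pluripolar (Ks i))
    (K_cap : K = \bigcap_i Ks i)
    (Ks_SP : forall i, sharpness_property (Ks i)) :
  exists (L : nat -> functional R n) (a : nat -> mindex n -> R[i]),
    (forall i, dual_germs (Ks i) (L i) /\ T_transform (L i) (a i)) /\
    D_ (a i) @[i --> \oo] --> transfinite_diameter K.
Proof.
have K0 : K !=set0.
  apply/set0P/eqP => K0; apply: K_nonpluripolar; rewrite K0; exact: pluripolar_set0.
have [B B0 KB] := compact_coord_bounded K_compact.
have KB1 z : K z -> forall v, Normc.normc (z 0 v) <= Num.max 1 B.
  by move=> Kz v; rewrite le_max KB ?orbT.
have B1 : 1 <= Num.max 1 B by rewrite le_max lexx.
have [c [zeta [Kzeta c_summable Dd]]] := extremal_functional n_gt0 B1 KB1 K0.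
exists (fun=> discrete_functional c zeta), (fun=> moments c zeta); split; last first.
  by rewrite Dd; apply: cvg_cst.
move=> i; split.
  apply: (discrete_dual_germs n_gt0 K_compact Kzeta c_summable).
  by rewrite K_cap; apply: bigcap_inf.
apply: (discrete_T_transform n_gt0 K_compact Kzeta c_summable B0) => j.
exact: KB.
Qed.
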